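(* Let $\Bbbk$ be a field of characteristic zero, $t\in\Bbbk$ and $n\in\mathbb N$. The category $\mathbb S(n,t)\text{-mod}$ of $\mathbb S(n,t)$-modules is semisimple if and only if either $n=1$, or $n\ge2$ and $t\notin\mathbb Z_{\ge0}$.
   Context: Combinatorics. $\mathbb N=\{1,2,\dots\}$ and $[1,n]=\{1,\dots,n\}$. $\Lambda(n)_t$ is the set of sequences $\beta=(\beta_1,\dots,\beta_n)$ with $\beta_1\in t-\mathbb Z$, $\beta_i\in\mathbb Z_{\ge 0}$ for $i\ge 2$, and $\sum_i\beta_i=t$. The category $\operatorname{Perm}$. $\mathfrak S_\infty$ is the group of all bijections of $\Omega=\mathbb N$, with the topology in which the pointwise stabilizers of finite subsets of $\Omega$ form a base of open neighborhoods of the identity. An action of an open subgroup $U$ on a set is smooth if all point stabilizers are open. A finitary $\widehat{\mathfrak S}_\infty$-set is a set with a smooth action of some open subgroup $U\subseteq\mathfrak S_\infty$ having finitely many orbits (one may shrink $U$); a finitary $\mathfrak S_\infty$-set is a smooth $\mathfrak S_\infty$-set with finitely many orbits. Let $\mathfrak S(p)$ be the pointwise stabilizer of $\{1,\dots,p\}$. For a finitary $\widehat{\mathfrak S}_\infty$-set $X$ there is a unique polynomial $p_X\in\mathbb Q[T]$ with $p_X(p)=|X^{\mathfrak S(p)}|$ for all sufficiently large integers $p$; set $\mu_t(X)=p_X(t)$. If $f:X\to\Bbbk$ is constant on the orbits of such an open subgroup, put $\int_X f(x)\,dx=\sum_c c\,\mu_t(f^{-1}(c))$, the sum being over the finitely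 many values $c$ of $f$. The category $\operatorname{Perm}(\mathfrak S_\infty;\mu_t)$ has as objects the finitary $\mathfrak S_\infty$-sets; $\operatorname{Hom}(X,Y)$ is the space of functions $Y\times X\to\Bbbk$ constant on the diagonal $\mathfrak S_\infty$-orbits; composition is $(g\circ f)(z,x)=\int_Y g(z,y)f(y,x)\,dy$. The algebra. For $\beta\in\Lambda(n)_t$ and $k\ge2$ let $\{\beta\}_k=[1+\sum_{i=2}^{k-1}\beta_i,\ \sum_{i=2}^{k}\beta_i]\subset\Omega$ and $\{\beta\}_1=\Omega\setminus\bigcup_{k\ge2}\{\beta\}_k$. $\mathfrak S_\beta\le\mathfrak S_\infty$ is the subgroup preserving each $\{\beta\}_k$, and $\mathcal X^\beta=\mathfrak S_\infty/\mathfrak S_\beta$. $\mathbb S(n,t)=\bigoplus_{\beta,\delta\in\Lambda(n)_t}\operatorname{Hom}_{\operatorname{Perm}(\mathfrak S_\infty;\mu_t)}(\mathcal X^\beta,\mathcal X^\delta)$, with product given by composition (zero if not composable); $1_\beta$ is the identity morphism of $\mathcal X^\beta$. An $\mathbb S(n,t)$-module is a module $M$ over this associative algebra such that $M=\bigoplus_{\beta\in\Lambda(n)_t}1_\beta M$ as vector spaces; $\mathbb S(n,t)\text{-mod}$ is the category of all such modules. *)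

(* Defs.v *)
From HB Require Import structures.
From mathcomp Require Import all_boot all_order all_algebra.
From mathcomp Require Import boolp classical_sets functions cardinality fsbigop.
From mathcomp Require Import topology_structure.

Set Implicit Arguments.
Unset Strict Implicit.
Unset Printing Implicit Defensive.

Import GRing.Theory.
Local Open Scope classical_set_scope.
Local Open Scope ring_scope.

Definition Omega := {i : nat | (0 < i)%N}.
HB.instance Definition _ := Countable.on Omega.

Record Sinf := MkSinf {
  sfun :> Omega -> Omega;
  sinv : Omega -> Omega;
  sfunK : cancel sfun sinv;
  sinvK : cancel sinv sfun }.

Lemma sinfP (g h : Sinf) : (forall i, g i = h i) -> g = h.
Proof.
case: g => g g' gK g'K; case: h => h h' hK h'K /= gh.
have e : g = h by apply/funext.
subst h; have e' : g' = h'.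
  by apply/funext => i; rewrite -[in RHS](g'K i) hK.
by subst h'; rewrite (Prop_irrelevance gK hK) (Prop_irrelevance g'K h'K).
Qed.

HB.instance Definition _ := gen_eqMixin Sinf.
HB.instance Definition _ := gen_choiceMixin Sinf.

Definition sone : Sinf :=
  @MkSinf id id (fun=> erefl) (fun=> erefl).
Definition sinvg (g : Sinf) : Sinf := MkSinf (sinvK g) (sfunK g).
Definition smul (g h : Sinf) : Sinf :=
  MkSinf (can_comp (sfunK g) (sfunK h)) (can_comp (sinvK h) (sinvK g)).

Fact smulA : associative smul. Proof. by move=> f g h; exact: sinfP. Qed.
Fact smul1g : left_id sone smul. Proof. by move=> g; exact: sinfP. Qed.
Fact smulg1 : right_id sone smul. Proof. by move=> g; exact: sinfP. Qed.
Fact smulVg : left_inverse sone sinvg smul.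
Proof. by move=> g; apply: sinfP => i /=; rewrite sfunK. Qed.
Fact smulgV : right_inverse sone sinvg smul.
Proof. by move=> g; apply: sinfP => i /=; rewrite sinvK. Qed.

(* (g * h) i = g (h i). *)
HB.instance Definition _ :=
  isGroup.Build Sinf smulA smul1g smulg1 smulVg smulgV.

Definition pstab (F : set Omega) : set Sinf := [set g | forall i, F i -> g i = i].

(* Group topology whose open neighborhoods of 1 have the pointwise stabilizers
   of finite sets as a base; the left cosets g * pstab F are a base at g. *)
Definition sinf_open (A : set Sinf) := forall g, A g ->
  exists2 F : set Omega, finite_set F & forall h, pstab F h -> A (g * h)%g.

Fact sinf_openT : sinf_open setT.
Proof. by move=> g _; exists set0. Qed.

Fact sinf_openI : setI_closed sinf_open.
Proof.
move=> A B oA oB g [/oA[F finF FA] /oB[G finG GB]].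
exists (F `|` G); first by rewrite finite_setU.
by move=> h hFG; split; [apply: FA|apply: GB] => i ?; apply: hFG; [left|right].
Qed.

Fact sinf_open_bigU (I : Type) (f : I -> set Sinf) :
  (forall i, sinf_open (f i)) -> sinf_open (\bigcup_i f i).
Proof.
move=> of_ g [i _ /of_[F finF Ff]]; exists F => // h /Ff ?; by exists i.
Qed.

HB.instance Definition _ :=
  isOpenTopological.Build Sinf sinf_openT sinf_openI sinf_open_bigU.

Lemma openSinf (A : set Sinf) : open A = sinf_open A.
Proof. by []. Qed.

Record finitary_set := FinitarySet {
  carrier :> Type;
  sact : Sinf -> carrier -> carrier;
  act1 : forall x, sact 1%g x = x;
  actM : forall g h x, sact (g * h)%g x = sact g (sact h x);
  act_smooth : forall x, open [set g | sact g x = x];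
  act_orbits : finite_set (range (fun x => range (sact^~ x))) }.

Section Cosets.
Context (V : set Sinf) (V1 : V 1%g) (VM : forall g h, V g -> V h -> V (g / h)%g)
  (openV : open V).

Definition lcoset (g : Sinf) : set Sinf := [set (g * v)%g | v in V].

Definition cosets := {C : set Sinf | exists g, C = lcoset g}.

Fact coset_act_subproof (g : Sinf) (C : cosets) :
  exists h, [set (g * x)%g | x in sval C] = lcoset h.
Proof.
case: C => C /= [h ->]; exists (g * h)%g; apply/seteqP; split=> x.
  by case=> _ [v Vv <-] <-; exists v => //; rewrite mulgA.
by case=> v Vv <-; exists (h * v)%g; [exists v|rewrite mulgA].
Qed.

Definition coset_act g (C : cosets) : cosets := exist _ _ (coset_act_subproof g C).

Fact coset_act1 C : coset_act 1%g C = C.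
Proof.
case: C => C hC; apply: eq_exist => /=; apply/seteqP; split=> [x [y Cy <-]|x Cx].
  by rewrite mul1g.
by exists x => //; rewrite mul1g.
Qed.

Fact coset_actM g h C : coset_act (g * h)%g C = coset_act g (coset_act h C).
Proof.
apply: eq_exist => /=; apply/seteqP; split=> x.
  by case=> y Cy <-; exists (h * y)%g; [exists y|rewrite mulgA].
by case=> _ [y Cy <-] <-; exists y => //; rewrite mulgA.
Qed.

Let VV g : V g -> V (g^-1)%g.
Proof. by move=> Vg; rewrite -[(g^-1)%g]mul1g; exact: VM. Qed.

Let VMM g h : V g -> V h -> V (g * h)%g.
Proof. by move=> Vg /VV Vh; rewrite -[h]invgK; exact: VM. Qed.

Lemma lcoset_act g h : V h -> lcoset (g * h)%g = lcoset g.
Proof.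
move=> Vh; apply/seteqP; split=> _ [v Vv <-].
  by exists (h * v)%g; [exact: VMM|rewrite mulgA].
by exists (h^-1 * v)%g; [apply: VMM => //; exact: VV|rewrite mulgA mulgK].
Qed.

Fact coset_act_smooth C : open [set g | coset_act g C = C].
Proof.
rewrite openSinf; case: C => C [k hC] g /= gC.
have := openV; rewrite openSinf => /(_ _ V1) [F finF FV].
exists (k @` F); first exact: finite_image.
move=> h hF; rewrite coset_actM -[RHS]gC; congr (coset_act _ _).
apply: eq_exist => /=; rewrite hC.
have Vkhk : V (k^-1 * h * k)%g.
  rewrite -[X in V X]mul1g; apply: FV => i Fi.
  rewrite /= hF; last by exists i.
  exact: sfunK.
rewrite -[RHS](lcoset_act k Vkhk); apply/seteqP; split=> x.
  case=> _ [v Vv <-] <-; exists v => //.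
  by rewrite !mulgA mulgV mul1g.
by case=> v Vv <-; exists (k * v)%g; [exists v|rewrite !mulgA mulgV mul1g].
Qed.

Fact coset_act_orbits : finite_set (range (fun C => range (coset_act^~ C))).
Proof.
have trans C D : range (coset_act^~ C) D.
  case: C D => [C [g hC]] [D [h hD]]; exists (h * g^-1)%g => //.
  apply: eq_exist => /=; rewrite hC hD; apply/seteqP; split=> x.
    by case=> _ [v Vv <-] <-; exists v => //; rewrite !mulgA mulgVK.
  by case=> v Vv <-; exists (g * v)%g; [exists v|rewrite !mulgA mulgVK].
apply: (@sub_finite_set _ _ [set setT]); last exact: finite_set1.
by move=> _ [C _ <-] /=; apply/seteqP; split=> // D _; exact: trans.
Qed.

Definition coset_set : finitary_set :=
  FinitarySet coset_act1 coset_actM coset_act_smooth coset_act_orbits.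

End Cosets.

(* [fixed_points sact B p] and [germ_poly sact B] are the fixed points of S(p)
   in B and the polynomial p_B, for a subset B that is stable under an open
   subgroup U and on which [sact] restricts to an action of U (S(p) is contained
   in U for p large, so nothing else about [sact] matters). *)
Definition fixed_points (X : Type) (sact : Sinf -> X -> X) (B : set X) (p : nat) :
    set X :=
  [set x | B x /\ forall g, pstab [set i | (val i <= p)%N] g -> sact g x = x].

Definition is_germ_poly (X : Type) (sact : Sinf -> X -> X) (B : set X)
    (q : {poly rat}) :=
  exists N : nat, forall p : nat, (N <= p)%N ->
    exists m : nat, (fixed_points sact B p #= `I_m)%card /\ q.[p%:R] = m%:R.

(* The default value 0 of xget is not used: p_B exists for all sets B above
   that have finitely many U-orbits. *)
Definition germ_poly (X : Type) (sact : Sinf -> X -> X) (B : set X) : {poly rat} :=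
  xget 0 [set q | is_germ_poly sact B q].

Definition swap_fun (a b i : Omega) := if i == a then b else if i == b then a else i.

Fact swap_funK a b : involutive (swap_fun a b).
Proof.
move=> i; rewrite /swap_fun; have [->|ia] := eqVneq i a.
  by rewrite eqxx; case: eqVneq.
by have [->|ib] := eqVneq i b; rewrite ?eqxx// (negPf ia) (negPf ib).
Qed.

Definition swap a b : Sinf := MkSinf (@swap_funK a b) (@swap_funK a b).

Lemma approx_perm (g : Sinf) (F : set Omega) : finite_set F ->
  exists N, forall p, (N <= p)%N -> exists2 r : Sinf,
    (forall i, (val (r i) <= p)%N = (val i <= p)%N) & forall i, F i -> r i = g i.
Proof.
move=> /finite_seqP[s ->].
exists (\max_(i <- s) maxn (val i) (val (g i))) => p.
elim: s => [_|x s IH]; first by exists 1%g.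
rewrite big_cons geq_max => /andP[]; rewrite geq_max => /andP[xp gxp] /IH[r rp rg].
exists (swap (r x) (g x) * r)%g.
  move=> i /=; rewrite /swap_fun.
  have [/(can_inj (sfunK r))->|_] := eqVneq (r i) (r x); first by rewrite gxp xp.
  have [e|_] := eqVneq (r i) (g x); last exact: rp.
  by rewrite rp xp -rp e gxp.
move=> i /=; rewrite inE => /orP[/eqP->|si]; rewrite /swap_fun ?eqxx//.
rewrite rg//; have [e|_] := eqVneq (g i) (r x).
  by have /(can_inj (sfunK r))-> : r i = r x by rewrite rg.
by have [/(can_inj (sfunK g))<-|//] := eqVneq (g i) (g x); rewrite rg.
Qed.

Section Translation.
Context (X : finitary_set) (F : set Omega) (finF : finite_set F) (B : set X).
Context (stabB : forall g, pstab F g -> forall x, B x -> B (sact g x)).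

Lemma actK (g : Sinf) : cancel (@sact X g) (sact (g^-1)%g).
Proof. by move=> x; rewrite -actM mulVg act1. Qed.

Lemma actVK (g : Sinf) : cancel (@sact X (g^-1)%g) (sact g).
Proof. by move=> x; rewrite -actM mulgV act1. Qed.

Lemma fixed_points_translate (g : Sinf) : exists N, forall p, (N <= p)%N ->
  (fixed_points (@sact X) (sact g @` B) p #= fixed_points (@sact X) B p)%card.
Proof.
have [N HN] := approx_perm g finF; exists N => p /HN[r rp rg] {N HN}.
have rF : pstab F (g^-1 * r)%g by move=> i Fi /=; rewrite rg// sfunK.
have rF' : pstab F (r^-1 * g)%g by move=> i Fi /=; rewrite -rg// sfunK.
have rp' i : (val ((r^-1)%g i) <= p)%N = (val i <= p)%N.
  by rewrite -rp /= sinvK.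
suff -> : fixed_points (@sact X) (sact g @` B) p =
    sact r @` fixed_points (@sact X) B p.
  by apply: inj_card_eq; apply: in2W; exact: can_inj (actK r).
apply/seteqP; split=> x.
  case=> -[b Bb <-] fixb; exists (sact (r^-1 * g)%g b); last first.
    by rewrite -actM mulgA mulgV mul1g.
  split; first exact: stabB.
  move=> h hp; rewrite actM -[RHS](_ : sact (r^-1)%g (sact (r * h * r^-1)%g (sact g b)) = _).
    by rewrite -!actM !mulgA mulVg mul1g.
  congr sact; apply: fixb => i ip /=; rewrite hp ?sinvK//=.
  by rewrite rp'.
case=> b [Bb fixb] <-; split.
  exists (sact (g^-1 * r)%g b); first exact: stabB.
  by rewrite -actM mulgA mulgV mul1g.
move=> h hp; rewrite -[in RHS](fixb (r^-1 * h * r)%g).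
  by rewrite -!actM !mulgA mulgV mul1g.
move=> i ip /=; rewrite hp ?sfunK//=.
by rewrite rp.
Qed.

Lemma is_germ_poly_translate (g : Sinf) (q : {poly rat}) :
  is_germ_poly (@sact X) (sact g @` B) q <-> is_germ_poly (@sact X) B q.
Proof.
have [N HN] := fixed_points_translate g.
split=> -[M HM]; exists (maxn M N) => p; rewrite geq_max => /andP[/HM[m [e qm]] /HN eN];
  exists m; split=> //.
- by apply: card_eq_trans e; rewrite card_eq_sym.
- exact: card_eq_trans eN e.
Qed.

Lemma germ_poly_translate (g : Sinf) :
  germ_poly (@sact X) (sact g @` B) = germ_poly (@sact X) B.
Proof.
congr (xget _ _); apply/seteqP.
by split=> q /=; [apply: (is_germ_poly_translate g q).1|
  apply: (is_germ_poly_translate g q).2].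
Qed.

End Translation.

Section Perm.
Context (k : fieldType) (t : k).

Definition mu (X : Type) (sact : Sinf -> X -> X) (B : set X) : k :=
  (map_poly ratr (germ_poly sact B)).[t].

Definition integral (X : finitary_set) (f : X -> k) : k :=
  \sum_(c \in range f) c * mu (@sact X) (f @^-1` [set c]).

Lemma integral_translate (X : finitary_set) (F : set Omega) (f : X -> k) g :
  finite_set F -> (forall h, pstab F h -> forall x, f (sact h x) = f x) ->
  integral (f \o sact (g^-1)%g) = integral f.
Proof.
move=> finF Ff; rewrite /integral.
have -> : range (f \o sact (g^-1)%g) = range f.
  apply/seteqP; split=> _ [x _ <-]; first by exists (sact (g^-1)%g x).
  by exists (sact g x) => //=; rewrite actK.
apply: eq_fsbigr => c _; congr (_ * _).
have -> : (f \o sact (g^-1)%g) @^-1` [set c] = sact g @` (f @^-1` [set c]).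
  apply/seteqP; split=> [x /= fx|_ [x /= fx <-]].
    by exists (sact (g^-1)%g x) => //; rewrite actVK.
  by rewrite /= actK.
rewrite /mu (germ_poly_translate finF)// => h hF x /= <-; exact: Ff.
Qed.

Definition hom_pred (X Y : finitary_set) : {pred Y * X -> k^o} :=
  [pred f | `[< forall (g : Sinf) y x, f (sact g y, sact g x) = f (y, x) >]].
Arguments hom_pred : clear implicits.

Record hom (X Y : finitary_set) :=
  MkHom { hom_fun :> Y * X -> k^o; hom_funP : hom_fun \in hom_pred X Y }.

HB.instance Definition _ X Y := [isSub for @hom_fun X Y].
HB.instance Definition _ X Y := [Choice of hom X Y by <:].

Fact hom_submod X Y : submod_closed (hom_pred X Y).
Proof.
split; first by apply/asboolP.
move=> a u v /asboolP uP /asboolP vP; apply/asboolP => g y x.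
by rewrite /GRing.add /GRing.scale /= uP vP.
Qed.

HB.instance Definition _ X Y :=
  GRing.SubChoice_isSubLmodule.Build _ _ (hom_pred X Y) (hom X Y) (hom_submod X Y).

Definition comp_fun (X Y Z : finitary_set) (g : hom Y Z) (f : hom X Y) :
    Z * X -> k^o :=
  fun zx => integral (fun y => g (zx.1, y) * f (y, zx.2)).

Fact comp_funP (X Y Z : finitary_set) (g : hom Y Z) (f : hom X Y) :
  comp_fun g f \in hom_pred X Z.
Proof.
apply/asboolP => s z x; rewrite /comp_fun /=.
have /asboolP fP := hom_funP f; have /asboolP gP := hom_funP g.
have stab1 (W : finitary_set) (w : W) :
    exists2 F, finite_set F & forall h, pstab F h -> sact h w = w.
  have := @act_smooth W w; rewrite openSinf => /(_ _ (act1 w))[F finF FP].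
  by exists F => // h /FP; rewrite /= mul1g.
have [F finF Fz] := stab1 _ z; have [G finG Gx] := stab1 _ x.
rewrite -(@integral_translate _ (F `|` G) (fun y => g (z, y) * f (y, x)) s);
  first last.
- move=> h hFG y.
  have hz : sact h z = z by apply: Fz => i Fi; apply: hFG; left.
  have hx : sact h x = x by apply: Gx => i Gi; apply: hFG; right.
  by move=> /=; rewrite -(gP h z y) -(fP h y x) hz hx.
- by rewrite finite_setU.
congr integral; apply/funext => y /=.
by rewrite -(gP s z) -(fP s _ x) actVK.
Qed.

Definition hcomp X Y Z (g : hom Y Z) (f : hom X Y) : hom X Z := MkHom (comp_funP g f).

Lemma comp0l X Y Z (f : hom X Y) : hcomp (0 : hom Y Z) f = 0.
Proof.
apply: val_inj; apply/funext => -[z x] /=; rewrite /comp_fun /integral.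
apply: fsbig1 => _ [y _ <-] /=.
by rewrite [X in X * _](_ : _ = 0) ?mul0r.
Qed.

Lemma comp0r X Y Z (g : hom Y Z) : hcomp g (0 : hom X Y) = 0.
Proof.
apply: val_inj; apply/funext => -[z x] /=; rewrite /comp_fun /integral.
apply: fsbig1 => _ [y _ <-] /=.
by rewrite [X in X * _](_ : _ = 0) ?mul0r// mulr0.
Qed.

Fact id_funP (X : finitary_set) :
  (fun yx : X * X => `[< yx.1 = yx.2 >]%:R) \in hom_pred X X.
Proof.
apply/asboolP => g y x /=; congr (_%:R); congr nat_of_bool.
by apply: asbool_equiv_eq; split=> [/(can_inj (actK g))//|->].
Qed.

Definition idmor X : hom X X := MkHom (id_funP X).

End Perm.
Section SchurAlgebra.
Context (k : fieldType) (t : k) (n : nat).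

(* Lambda(n)_t for n >= 1: the pair (beta_1, (beta_2, .., beta_n)). *)
Definition is_weight (b : k * n.-1.-tuple nat) : bool :=
  `[< exists z : int, b.1 = t - z%:~R >] &&
  (b.1 + \sum_(i < n.-1) (tnth b.2 i)%:R == t).

Definition weight := {b : k * n.-1.-tuple nat | is_weight b}.
HB.instance Definition _ := Choice.on weight.

Implicit Types b d e : weight.

(* beta_i, for 2 <= i <= n. *)
Definition part b (i : nat) : nat := nth 0%N (val b).2 (i - 2).

Definition interval_block b (j : nat) : set Omega :=
  [set x | (1 + \sum_(2 <= i < j) part b i <= val x <= \sum_(2 <= i < j.+1) part b i)%N].

Definition block b (j : nat) : set Omega :=
  if j == 1%N then ~` \bigcup_(i in [set i | (2 <= i <= n)%N]) interval_block b i
  else interval_block b j.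

Definition young b : set Sinf :=
  [set g | forall j, (1 <= j <= n)%N -> [set g x | x in block b j] = block b j].

Fact young1 b : young b 1%g.
Proof. by move=> j _; apply: image_id. Qed.

Fact youngM b g h : young b g -> young b h -> young b (g / h)%g.
Proof.
move=> Yg Yh j jn; apply/seteqP; split=> x.
  case=> y; rewrite -[in X in X -> _](Yh _ jn) => -[z bz <-] <- /=.
  by rewrite sfunK -(Yg _ jn); exists z.
rewrite -[in X in X -> _](Yg _ jn) => -[y byj <-]; exists (h y).
  by rewrite -(Yh _ jn); exists y.
by rewrite /= sfunK.
Qed.

Fact young_open b : open (young b).
Proof.
rewrite openSinf => g Yg.
exists (\bigcup_(i in [set i | (2 <= i <= n)%N]) interval_block b i).
  apply: bigcup_finite.
    by apply: (sub_finite_set _ (finite_II n.+1)) => i /= /andP[].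
  move=> i _; set m := (\sum_(2 <= j < i.+1) part b j)%N.
  apply: (@sub_finite_set _ _ (val @^-1` `I_m.+1)).
    by move=> x /= /andP[].
  by apply: finite_preimage; [move=> x y _ _; exact: val_inj|exact: finite_II].
move=> h hF; suff Yh : young b h.
  have Yh' : young b (h^-1)%g by rewrite -[(h^-1)%g]mul1g; apply: youngM => //; exact: young1.
  by rewrite -[h]invgK; exact: youngM.
move=> j /andP[j1 jn]; rewrite /block; case: eqVneq => [_|jn1].
  apply/seteqP; split=> [_ [x xF <-] hxF|x xF].
    by apply: xF; move: (hF _ hxF) => /(can_inj (sfunK h)) <-.
  exists ((h^-1)%g x); last exact: sinvK.
  move=> hxF; apply: xF; move: (hF _ hxF); rewrite /= sinvK => ->.
  exact: hxF.
have jF x : interval_block b j x -> h x = x.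
  by move=> jx; apply: hF; exists j => //=; rewrite jn andbT ltn_neqAle eq_sym jn1.
apply/seteqP; split=> [_ [x jx <-]|x jx]; first by rewrite jF.
by exists x => //; exact: jF.
Qed.

Definition coset_obj b : finitary_set :=
  coset_set (young1 b) (@youngM b) (@young_open b).

Local Notation Hom b d := (hom k (coset_obj b) (coset_obj d)).

(* Elements of the direct sum of the Hom(X^b, X^d) over all pairs (b, d). *)
Record schur := Schur {
  component :> forall b d, Hom b d;
  component_finite :
    finite_set [set bd : weight * weight | component bd.1 bd.2 != 0] }.

Lemma schurP (s s' : schur) : (forall b d, s b d = s' b d) -> s = s'.
Proof.
case: s s' => [s fs] [s' fs'] /= ss'.
have e : s = s'.
  by apply: functional_extensionality_dep => b;
     apply: functional_extensionality_dep => d; exact: ss'.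
by subst s'; rewrite (Prop_irrelevance fs fs').
Qed.

HB.instance Definition _ := gen_eqMixin schur.
HB.instance Definition _ := gen_choiceMixin schur.

Fact schur_zero_finite :
  finite_set [set bd : weight * weight | (0 : Hom bd.1 bd.2) != 0].
Proof.
by apply: (@sub_finite_set _ _ set0) => [bd /=|]; [rewrite eqxx|exact: finite_set0].
Qed.

Fact schur_opp_finite (s : schur) :
  finite_set [set bd : weight * weight | - s bd.1 bd.2 != 0].
Proof.
by apply: sub_finite_set (component_finite s) => bd /=; rewrite oppr_eq0.
Qed.

Fact schur_add_finite (s s' : schur) :
  finite_set [set bd : weight * weight | s bd.1 bd.2 + s' bd.1 bd.2 != 0].
Proof.
apply: (@sub_finite_set _ _ ([set bd | s bd.1 bd.2 != 0] `|`
                             [set bd | s' bd.1 bd.2 != 0])).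
  move=> bd /=; have [->|] := eqVneq (s bd.1 bd.2) 0; last by left.
  by rewrite add0r; right.
by rewrite finite_setU; split; exact: component_finite.
Qed.

Fact schur_scale_finite (a : k) (s : schur) :
  finite_set [set bd : weight * weight | a *: s bd.1 bd.2 != 0].
Proof.
apply: sub_finite_set (component_finite s) => bd /=.
by apply: contra_neq => ->; rewrite scaler0.
Qed.

Definition schur_zero := @Schur (fun b d => 0) schur_zero_finite.
Definition schur_opp (s : schur) := @Schur (fun b d => - s b d) (schur_opp_finite s).
Definition schur_add (s s' : schur) :=
  @Schur (fun b d => s b d + s' b d) (schur_add_finite s s').
Definition schur_scale a (s : schur) :=
  @Schur (fun b d => a *: s b d) (schur_scale_finite a s).

Fact schur_addA : associative schur_add.
Proof. by move=> ? ? ?; apply: schurP => b d /=; rewrite addrA. Qed.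
Fact schur_addC : commutative schur_add.
Proof. by move=> ? ?; apply: schurP => b d /=; rewrite addrC. Qed.
Fact schur_add0 : left_id schur_zero schur_add.
Proof. by move=> ?; apply: schurP => b d /=; rewrite add0r. Qed.
Fact schur_addN : left_inverse schur_zero schur_opp schur_add.
Proof. by move=> ?; apply: schurP => b d /=; rewrite addNr. Qed.

HB.instance Definition _ :=
  GRing.isZmodule.Build schur schur_addA schur_addC schur_add0 schur_addN.

Fact schur_scaleA (a c : k) s :
  schur_scale a (schur_scale c s) = schur_scale (a * c) s.
Proof. by apply: schurP => b d /=; rewrite scalerA. Qed.
Fact schur_scale1 : left_id 1 schur_scale.
Proof. by move=> s; apply: schurP => b d /=; rewrite scale1r. Qed.
Fact schur_scaleDr : right_distributive schur_scale +%R.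
Proof. by move=> a s s'; apply: schurP => b d /=; rewrite scalerDr. Qed.
Fact schur_scaleDl s : {morph schur_scale^~ s : a c / a + c}.
Proof. by move=> a c; apply: schurP => b d /=; rewrite scalerDl. Qed.

HB.instance Definition _ := GRing.Zmodule_isLmodule.Build k schur
  schur_scaleA schur_scale1 schur_scaleDr schur_scaleDl.

Fact schur_mul_finite (s s' : schur) : finite_set [set be : weight * weight |
  \sum_(d \in setT) hcomp t (s d be.2) (s' be.1 d) != 0].
Proof.
pose S (u : schur) := [set bd : weight * weight | u bd.1 bd.2 != 0].
apply: (@sub_finite_set _ _ ((fst @` S s') `*` (snd @` S s))); last first.
  by apply: finite_setX; apply: finite_image; exact: component_finite.
move=> [b e] /= /eqP sum_neq0; apply: contrapT => Nbe; apply: sum_neq0.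
apply: fsbig1 => d _; have [s0|s0] := eqVneq (s d e) 0.
  by rewrite s0 comp0l.
have [s'0|s'0] := eqVneq (s' b d) 0; first by rewrite s'0 comp0r.
by case: Nbe; split; [exists (b, d)|exists (d, e)].
Qed.

(* The (b, e) component of a product is the sum over d of the compositions
   X^b -> X^d -> X^e. *)
Definition schur_mul (s s' : schur) : schur :=
  @Schur (fun b e => \sum_(d \in setT) hcomp t (s d e) (s' b d))
         (schur_mul_finite s s').

Definition schur_inj_component b d (f : Hom b d) b' d' : Hom b' d' :=
  match b =P b', d =P d' with
  | ReflectT bb', ReflectT dd' =>
      ecast x (Hom x d') bb' (ecast y (Hom b y) dd' f)
  | _, _ => 0
  end.

Fact schur_inj_finite b d (f : Hom b d) : finite_set
  [set bd : weight * weight | schur_inj_component f bd.1 bd.2 != 0].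
Proof.
apply: (@sub_finite_set _ _ [set (b, d)]); last exact: finite_set1.
move=> [b' d'] /=; rewrite /schur_inj_component.
case: eqP => [bb'|_]; last by rewrite eqxx.
case: eqP => [dd'|_]; last by rewrite eqxx.
by move=> _; rewrite bb' dd'.
Qed.

Definition schur_inj b d (f : Hom b d) : schur := Schur (schur_inj_finite f).

Definition schur_one b : schur := schur_inj (idmor k (coset_obj b)).

Definition is_direct_sum (M : lmodType k) (I : choiceType) (N : I -> set M) :=
  forall m, exists! x : I -> M,
    [/\ forall i, N i (x i), finite_set [set i | x i != 0] &
        m = \sum_(i \in setT) x i].

Record schur_module := SchurModule {
  module_carrier :> lmodType k;
  module_act : schur -> module_carrier -> module_carrier;
  module_act_linearl : forall a s s' m,
    module_act (a *: s + s') m = a *: module_act s m + module_act s' m;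
  module_act_linearr : forall s a m m',
    module_act s (a *: m + m') = a *: module_act s m + module_act s m';
  module_actA : forall s s' m, module_act (schur_mul s s') m = module_act s (module_act s' m);
  module_weights : is_direct_sum (fun b => range (module_act (schur_one b))) }.

(* Such an N is the direct sum of the schur_one b N, so that it is a subobject
   in the category of modules. *)
Definition is_submodule (M : schur_module) (N : set M) :=
  [/\ N 0, forall (a : k) m m', N m -> N m' -> N (a *: m + m') &
      forall s m, N m -> N (module_act s m)].

Definition is_simple (M : schur_module) (N : set M) :=
  [/\ is_submodule N, N <> [set 0] &
      forall N', is_submodule N' -> N' `<=` N -> N' = [set 0] \/ N' = N].

(* Every module, of any dimension, is a direct sum of simple modules. *)
Definition schur_semisimple := forall M : schur_module,
  exists (I : choiceType) (N : I -> set M),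
    (forall i, is_simple (N i)) /\ is_direct_sum N.

End SchurAlgebra.

(* Main.v *)
From HB Require Import structures.
Require Import Defs.
From mathcomp Require Import all_boot all_order all_algebra fingroup perm finmap.
From mathcomp Require Import boolp classical_sets functions cardinality fsbigop.
From mathcomp Require Import topology_structure.
From Stdlib Require List.

(* A point of X^b is a coloring of Omega with prescribed numbers of points of each
   color but the first one. The integral of a function invariant under S(N) is a
   polynomial in t whose value at a large integer p is the sum of the function over
   the colorings supported in [1, p]; all identities follow by interpolation.

   If n = 1 or t is not a natural number, the orbits have nonzero measure, so the
   pairing Hom(X^d, X^b) x Hom(X^b, X^d) -> End(X^b) is nondegenerate on both sides.
   Modulo morphisms through objects of lower degree (degree = sum of the b_i, i >= 2),
   a morphism between objects of equal degree D is an equivariant map between finite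
   permutation modules of S_D, hence has a generalized inverse by Maschke. An
   induction on the degree, in the spirit of Knop, then shows that every morphism f is
   von Neumann regular: f h f = f for some h. Since the End(X^b) are finite
   dimensional, primitive idempotents e exist and generate simple submodules
   S(n, t) e v, so that every module is a sum, hence a direct sum, of simple ones.

   If n >= 2 and t = m is a natural number, let a be the constant function 1 from the
   one-point object to X^d with d_i = m + 1 for i >= 2. Then c a = 0 for all morphisms c
   back to the point, because the measure of X^d vanishes. Hence a kills every simple
   module, but it does not kill the regular module. *)

Set Implicit Arguments.
Unset Strict Implicit.
Unset Printing Implicit Defensive.

Import GRing.Theory.
Local Open Scope classical_set_scope.
Local Open Scope ring_scope.

(** * Von Neumann regularity in graded linear categories *)

(** Regularity is the right target because f h f = f is an equation: it can be tested against other
    morphisms and asks for no kernels or images, which the category does not offer a priori. The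
    obstacle is that nondegeneracy transfers regularity from End(a) to all morphisms out of a, but
    does not by itself make End(a) regular. The degree supplies what is missing: between colorings
    with the same D colored points, composition is a finite sum in which t does not occur, so the
    top layer of End(a) is governed by a finite group acting on a finite set, whatever t is. The
    value of t enters through the ideal of lower degrees, which has a unit thanks to the nonzero
    orbit measures. Such a measure is a positive rational number times a product of factors t - j
    with j a natural number; for n = 1 the only object is a point, of measure 1. Integrals are taken
    at a parameter s kept apart from the t that indexes the objects. This is what allows evaluation
    at integers while the objects stay fixed. *)

Section GradedCategory.
Context (k : fieldType) (W : Type) (H : W -> W -> lmodType k).
Context (comp : forall a b c, H b c -> H a b -> H a c) (one : forall a, H a a).
Local Notation "g \c f" := (comp g f) (at level 40, left associativity).
Context (catA : forall a b c d (h : H c d) (g : H b c) (f : H a b),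
  h \c (g \c f) = h \c g \c f).
Context (cat1l : forall a b (f : H a b), one b \c f = f).
Context (cat1r : forall a b (f : H a b), f \c one a = f).
Context (catPl : forall a b c x (g g' : H b c) (f : H a b),
  (x *: g + g') \c f = x *: (g \c f) + g' \c f).
Context (catPr : forall a b c x (g : H b c) (f f' : H a b),
  g \c (x *: f + f') = x *: (g \c f) + g \c f').

Lemma cat0l a b c (f : H a b) : (0 : H b c) \c f = 0.
Proof.
have := catPl (-1) 0 (0 : H b c) f.
by rewrite scaler0 addr0 scaleN1r addNr.
Qed.

Lemma cat0r a b c (g : H b c) : g \c (0 : H a b) = 0.
Proof.
have := catPr (-1) g (0 : H a b) 0.
by rewrite scaler0 addr0 scaleN1r addNr.
Qed.

Lemma catDl a b c (g g' : H b c) (f : H a b) : (g + g') \c f = g \c f + g' \c f.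
Proof. by rewrite -[g]scale1r catPl !scale1r. Qed.

Lemma catDr a b c (g : H b c) (f f' : H a b) : g \c (f + f') = g \c f + g \c f'.
Proof. by rewrite -[f]scale1r catPr !scale1r. Qed.

Lemma catZl a b c x (g : H b c) (f : H a b) : (x *: g) \c f = x *: (g \c f).
Proof. by rewrite -[x *: g]addr0 catPl cat0l !addr0. Qed.

Lemma catZr a b c x (g : H b c) (f : H a b) : g \c (x *: f) = x *: (g \c f).
Proof. by rewrite -[x *: f]addr0 catPr cat0r !addr0. Qed.

Lemma catNl a b c (g : H b c) (f : H a b) : (- g) \c f = - (g \c f).
Proof. by rewrite -scaleN1r catZl scaleN1r. Qed.

Lemma catNr a b c (g : H b c) (f : H a b) : g \c (- f) = - (g \c f).
Proof. by rewrite -scaleN1r catZr scaleN1r. Qed.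

Definition regular a b (f : H a b) := exists h : H b a, f \c h \c f = f.

(* Successively adjoin to an idempotent e, for the next generator l, the idempotent
   (1 - e) y (l - l e) with y a generalized inverse of l - l e. *)
Lemma left_ideal_unit a (J : forall c, H a c -> Prop) (s : seq {c : W & H a c}) :
  (forall c, J c 0) -> (forall c (x y : H a c), J c x -> J c y -> J c (x + y)) ->
  (forall b c (h : H b c) x, J b x -> J c (h \c x)) ->
  (forall i u, onth s i = Some u ->
     J _ (projT2 u) /\ forall h : H a (projT1 u), regular h) ->
  exists e : H a a, [/\ J a e, e \c e = e &
    forall i u, onth s i = Some u -> projT2 u \c e = projT2 u].
Proof.
move=> J0 JD JM; elim: s => [_|[c l] s IH hs].
  by exists 0; split=> [||i u]; rewrite ?cat0l// onthE; case: i.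
have [|e [Je ee se]] := IH.
  by move=> i u iu; apply: (hs i.+1).
have JN b x : J b x -> J b (- x).
  by move=> Jx; rewrite -[x]cat1l -catNl; exact: JM.
have [Jl regc] : J c l /\ forall h : H a c, regular h by apply: (hs 0%N (existT _ c l)).
pose l' := l - l \c e.
have l'e : l' \c e = 0 by rewrite catDl catNl -catA ee subrr.
have [y ly] := regc l'.
pose th := y \c l' - e \c (y \c l').
have Jl' : J c l' by apply: JD => //; apply: JN; exact: JM.
have the : th \c e = 0 by rewrite /th catDl catNl -!catA l'e !cat0r subrr.
have eth : e \c th = 0 by rewrite /th catDr catNr !catA ee subrr.
have lth : l' \c th = l'.
  by rewrite /th catDr catNr [l' \c (e \c _)]catA l'e cat0l subr0 catA.
have thth : th \c th = th.
  rewrite {1}/th catDl catNl -!catA lth.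
  by rewrite -[RHS]/th.
have Jth : J a th by apply: JD; [exact: JM|apply: JN; do 2 apply: (JM)].
have le : l = l' + l \c e by rewrite subrK.
clearbody th l'; exists (e + th); split; first exact: JD.
- by rewrite catDl !catDr ee eth the thth addr0 add0r.
case=> [|i] u /=.
  case=> <- /=; rewrite catDr [in l \c th]le catDl lth -catA eth cat0r addr0.
  by rewrite addrC -le.
move=> iu; rewrite catDr (se _ _ iu) -[X in X \c th](se _ _ iu).
by rewrite -catA eth cat0r addr0.
Qed.

Context (deg : W -> nat).
Context (tr : forall a b, H a b -> H b a).
Context (trM : forall a b c (g : H b c) (f : H a b), tr (g \c f) = tr f \c tr g).
Context (trK : forall a b (f : H a b), tr (tr f) = f).
Context (nondeg : forall a b (g : H a b), (forall f : H b a, f \c g = 0) -> g = 0).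
(** Finite dimension of [H a b], in the form in which it is used: a spanning list, as an induction
    principle for linear conditions. *)
Context (fin_hom : forall a b, exists s : seq (H a b), forall P : H a b -> Prop,
  P 0 -> (forall x f g, P f -> P g -> P (x *: f + g)) ->
  (forall f, List.In f s -> P f) -> forall f, P f).
Context (fin_deg : forall d, exists s : seq W, forall a, (deg a < d)%N -> List.In a s).

(** The ideal of morphisms that factor through degrees below [d]. Scalars are absorbed into the
    factor [g] of a composite. *)
Inductive low (d : nat) (a b : W) : H a b -> Prop :=
| low0 : low d 0
| lowD f g : low d f -> low d g -> low d (f + g)
| low_comp c (g : H c b) (f : H a c) : (deg c < d)%N -> low d (g \c f).

Context (mod_low : forall a b (f : H a b), deg a = deg b ->
  exists (c : H a b) (c' : H b a), c \c c' \c c = c /\ low (deg a) (f - c)).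

Lemma low_l d a b c (h : H b c) (f : H a b) : low d f -> low d (h \c f).
Proof.
elim=> [|f' g' _ IH1 _ IH2|e g f' e_d]; first by rewrite cat0r; constructor.
  by rewrite catDr; constructor.
by rewrite catA; constructor.
Qed.

Lemma low_r d a b c (f : H b c) (h : H a b) : low d f -> low d (f \c h).
Proof.
elim=> [|f' g' _ IH1 _ IH2|e g f' e_d]; first by rewrite cat0l; constructor.
  by rewrite catDl; constructor.
by rewrite -catA; constructor.
Qed.

Lemma regular_tr a b (f : H a b) : regular (tr f) -> regular f.
Proof. by case=> h e; exists (tr h); rewrite -[RHS]trK -e !trM !trK catA. Qed.

(** For [g] in a spanning list of [H b a], the composites g f are endomorphisms of [a], hence
    regular. The idempotent of the left ideal that they generate has the form h f and satisfies g f
    h f = g f for all g; nondegeneracy cancels g. *)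
Lemma regular_src a b (f : H a b) : (forall g : H a a, regular g) -> regular f.
Proof.
move=> ra; have [s sP] := fin_hom b a.
pose J c (x : H a c) := exists h, x = h \c f.
have [| | | |e [[h ->] _ se]] := @left_ideal_unit a J
    [seq existT (H a) a (g \c f) | g <- s].
- by move=> c; exists 0; rewrite cat0l.
- by move=> c _ _ [h ->] [h' ->]; exists (h + h'); rewrite catDl.
- by move=> b' c h _ [h' ->]; exists (h \c h'); rewrite catA.
- move=> i u iu.
  have [g ->] : exists g, u = existT (H a) a (g \c f).
    elim: s i iu {sP} => [|g s IH] [|i]//=; last exact: IH.
    by case=> <-; exists g.
  by split=> //=; exists g.
exists h; apply/eqP; rewrite -subr_eq0; apply/eqP; apply: nondeg => g.
rewrite catDr catNr; apply/eqP; rewrite subr_eq0; apply/eqP; move: g.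
apply: sP; first by rewrite !cat0l.
  by move=> x g g' eg eg'; rewrite !catPl eg eg'.
elim: s se => //= g s IH se g' [<-|]; last first.
  by apply: IH => i u iu; apply: (se i.+1).
have /= <- := se 0%N _ erefl; by rewrite !catA.
Qed.

Lemma onth_in (T : Type) (s : seq T) i u : onth s i = Some u -> List.In u s.
Proof. by elim: s i => [|v s IH] [|i]//= => [[<-]|/IH]; [left|right]. Qed.

Lemma in_onth (T : Type) (s : seq T) u : List.In u s -> exists i, onth s i = Some u.
Proof.
elim: s => //= v s IH [<-|/IH[i iu]]; first by exists 0%N.
by exists i.+1.
Qed.

(** Collects spanning lists for all targets of lower degree into one, so that [left_ideal_unit] can
    treat these targets together. *)
Lemma fin_low b d : exists S : seq {c : W & H b c},
  (forall u, List.In u S -> (deg (projT1 u) < d)%N) /\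
  forall P : forall c, H b c -> Prop, (forall c, P c 0) ->
  (forall c x f g, P c f -> P c g -> P c (x *: f + g)) ->
  (forall u, List.In u S -> P _ (projT2 u)) ->
  forall a (f : H b a), (deg a < d)%N -> P a f.
Proof.
have [s sP] := fin_deg d.
suff [S [S1 S2]] : exists S : seq {c : W & H b c},
  (forall u, List.In u S -> (deg (projT1 u) < d)%N) /\
  forall P : forall c, H b c -> Prop, (forall c, P c 0) ->
  (forall c x f g, P c f -> P c g -> P c (x *: f + g)) ->
  (forall u, List.In u S -> P _ (projT2 u)) ->
  forall a (f : H b a), (deg a < d)%N -> List.In a s -> P a f.
  by exists S; split=> // P P0 PD PS a f ab; apply: S2 => //; exact: sP.
elim: s {sP} => [|c s [S [S1 S2]]]; first by exists [::]; split.
have [cb|cb] := ltnP (deg c) d; last first.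
  exists S; split=> // P P0 PD PS a f ab /= [ca|]; last exact: S2.
  by rewrite ca leqNgt ab in cb.
have [s' s'P] := fin_hom b c.
exists ([seq existT _ c f | f <- s'] ++ S); split.
  move=> u /List.in_app_iff[|/S1//].
  by elim: s' {s'P} => //= g s' IH [<-//|/IH].
move=> P P0 PD PS a f ab /= [ca|sa]; last first.
  by apply: S2 => // u Su; apply: PS; apply/List.in_app_iff; right.
subst a; apply: s'P => //; first by move=> x g g'; exact: PD.
move=> g s'g; apply: (PS (existT _ c g)); apply/List.in_app_iff; left.
by elim: s' s'g {PS} => //= g' s' IH [<-|/IH]; [left|right].
Qed.

(** The idempotent of the left ideal generated by all maps from [b] to lower degrees is a right unit
    by construction. It is also a left unit: for g into [b] from a lower degree, h (e g - g) = (h e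
    - h) g = 0 for all h going back, and nondegeneracy applies. *)
Lemma low_unit b : (forall a (f : H b a), (deg a < deg b)%N -> regular f) ->
  exists e : H b b, [/\ low (deg b) e,
    forall a (f : H b a), low (deg b) f -> f \c e = f &
    forall a (f : H a b), low (deg b) f -> e \c f = f].
Proof.
move=> regb; have [S [S1 S2]] := fin_low b (deg b).
have [| | | |e [elow ee se]] := @left_ideal_unit b (fun c (x : H b c) => low (deg b) x) S.
- by move=> c; constructor.
- by move=> c x y; apply: lowD.
- by move=> a c h x; exact: low_l.
- move=> i u iu; have uS := onth_in iu; have ub := S1 _ uS; split; last by move=> h;
  exact: regb.
  by rewrite -[projT2 u]cat1l; constructor.
have eR a (f : H b a) : (deg a < deg b)%N -> f \c e = f.
  move: a f; apply: S2; first by move=> c; rewrite cat0l.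
    by move=> c x f g fe ge; rewrite catPl fe ge.
  by move=> u uS; have [i iu] := in_onth uS; exact: se iu.
exists e; split=> // a f.
  elim=> [|f' g' _ e1 _ e2|c g f' cb]; first by rewrite cat0l.
    by rewrite catDl e1 e2.
  by rewrite -catA eR.
elim=> [|f' g' _ e1 _ e2|c g f' cb]; first by rewrite cat0r.
  by rewrite catDr e1 e2.
rewrite catA; congr (_ \c _); apply/eqP; rewrite -subr_eq0; apply/eqP.
apply: nondeg => h; rewrite catDr catNr catA eR//.
by rewrite subrr.
Qed.

(* Induction on the degree: with e the unit of the ideal of endomorphisms factoring
   through lower degrees, f = e f e + (1 - e) f (1 - e). The first summand is regular
   by [left_ideal_unit], and the second one by [mod_low]. *)
Theorem all_regular a b (f : H a b) : regular f.
Proof.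
suff R d : forall a b (f : H a b), (deg a < d)%N -> (deg b < d)%N -> regular f.
  by apply: (R (maxn (deg a) (deg b)).+1); rewrite ltnS ?leq_maxl ?leq_maxr.
elim: d {a b f} => [//|d IH] a b f; rewrite !ltnS.
have Rsrc a' b' (g : H a' b') : (deg a' < d)%N -> regular g.
  by move=> ad; apply: regular_src => h; exact: IH.
have Rtgt a' b' (g : H a' b') : (deg b' < d)%N -> regular g.
  by move=> bd; apply: regular_tr; exact: Rsrc.
rewrite leq_eqVlt => /predU1P[ad|]; last by move=> *; exact: Rsrc.
rewrite leq_eqVlt => /predU1P[bd|]; last by move=> *; exact: Rtgt.
have [|ea [ealow eaR eaL]] := @low_unit a.
  by move=> c g; rewrite ad; exact: Rtgt.
have [|eb [eblow ebR ebL]] := @low_unit b.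
  by move=> c g; rewrite bd; exact: Rtgt.
rewrite ad in ealow eaR eaL; rewrite bd in eblow ebR ebL.
have [x xdef] : exists x, x = eb \c f by exists (eb \c f).
(* Both eb f and f ea lie in the low ideal, on which [ea] and [eb] are units, so both equal eb f
   ea. *)
have xE : f \c ea = x.
  by rewrite xdef -[LHS]ebL; [rewrite catA eaR// ; exact: low_r|exact: low_l].
have xlow : low d x by rewrite xdef; exact: low_r.
have eaea : ea \c ea = ea by exact: eaR.
have ebeb : eb \c eb = eb by exact: ebR.
have xea : x \c ea = x by exact: eaR.
have ebx : eb \c x = x by exact: ebL.
have [h xhx] : regular x.
  (* The left ideal of x is tested only against maps g to lower degrees, for which g x is regular by
     [Rtgt]. This suffices because [eb] is a sum of composites through lower degrees and fixes x. *)
  pose J c (y : H a c) := exists h, y = h \c x.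
  suff [e [[h ->] _ he]] : exists e : H a a, [/\ J a e, e \c e = e &
      forall c (g : H b c), (deg c < d)%N -> g \c x \c e = g \c x].
    exists h; apply/eqP; rewrite -subr_eq0; apply/eqP.
    set w := _ - x.
    have -> : w = eb \c w by rewrite /w catDr catNr !catA ebx.
    elim: eblow => [|g g' _ e1 _ e2|c g g' cd]; first by rewrite cat0l.
      by rewrite catDl e1 e2 addr0.
    rewrite -catA [X in _ \c X](_ : _ = 0) ?cat0r//.
    by rewrite /w catDr catNr -[x \c h \c x]catA catA he// subrr.
  have [S [S1 S2]] := fin_low b d.
  have [| | | |e [Je ee se]] := @left_ideal_unit a J
      [seq existT (H a) (projT1 u) (projT2 u \c x) | u <- S].
  - by move=> c; exists 0; rewrite cat0l.
  - by move=> c _ _ [h ->] [h' ->]; exists (h + h'); rewrite catDl.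
  - by move=> b' c h _ [h' ->]; exists (h \c h'); rewrite catA.
  - move=> i u iu.
    have [v Sv ->] : exists2 v, List.In v S & u = existT (H a) (projT1 v) (projT2 v \c x).
      elim: S i iu {S1 S2} => [|v S IHS] [|i]//=; first by case=> <-; exists v; [left|].
      by move=> /IHS[w Sw ->]; exists w => //; right.
    by split=> [|g] /=; [exists (projT2 v)|apply: Rtgt; exact: S1].
  exists e; split=> //; apply: S2; first by move=> c; rewrite !cat0l.
    by move=> c z g g' eg eg'; rewrite !catPl eg eg'.
  elim: S se {S1} => //= v S IHS se u [<-|]; last first.
    by apply: IHS => i w iw; apply: (se i.+1).
  exact: (se 0%N _ erefl).
have [c [c' [cc ilow]]] := mod_low f (etrans ad (esym bd)).
rewrite ad in ilow.
set i := f - c in ilow.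
have iea : i \c ea = i by exact: eaR.
have ebi : eb \c i = i by exact: ebL.
pose y := f - x.
have fE : f = x + y by rewrite addrC subrK.
have yl : y = c - eb \c c.
  by rewrite /y xdef -[f](subrK c) -/i catDr ebi opprD addrACA subrr add0r.
have yr : y = c - c \c ea.
  by rewrite /y -xE -[f](subrK c) -/i catDl iea opprD addrACA subrr add0r.
have eby : eb \c y = 0 by rewrite yl catDr catNr catA ebeb subrr.
have yea : y \c ea = 0 by rewrite yr catDl catNl -catA eaea subrr.
have ycy : y \c c' \c y = y.
  have ebc : eb \c (c \c ea) = eb \c c.
    by apply/esym/eqP; rewrite -subr_eq0 -catNr -catDr -yr eby.
  have -> : y \c c' \c y = (c - eb \c c) \c c' \c (c - c \c ea) by rewrite -yl -yr.
  rewrite !(catDl, catNl, catDr, catNr) !catA -!(catA eb) cc.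
  by rewrite ebc opprK yr [- (c \c ea) + _]addrC addrA subrK.
clearbody y.
have [pa [xpa ypa]] : exists p, x \c p = 0 /\ y \c p = y.
  by exists (one a - ea); rewrite !catDr !catNr !cat1r xea yea subrr subr0.
have [pb [pbx pby]] : exists p, p \c x = 0 /\ p \c y = y.
  by exists (one b - eb); rewrite !catDl !catNl !cat1l ebx eby subrr subr0.
(* The first summand is annihilated by y on either side and the second one by x, so the two
   generalized inverses do not interfere. *)
exists (ea \c h \c eb + pa \c c' \c pb).
rewrite fE !(catDl, catDr) !catA xea yea xpa ypa -!(catA _ eb) -!(catA _ pb).
by rewrite ebx eby pbx pby !(cat0l, cat0r) xhx ycy !addr0 !add0r.
Qed.
End GradedCategory.

(** * Points as colorings *)

(** Positions in words start at 0 but [Omega] starts at 1: the points of [1, p] are the [omega v]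
    with v < p. *)
Definition omega (v : nat) : Omega := exist _ v.+1 isT.

Lemma omegaE (i : Omega) : omega (val i).-1 = i.
Proof. by apply: val_inj; case: i => -[]. Qed.

Lemma omega_inj : injective omega.
Proof. by move=> u v /(congr1 val)[]. Qed.

Definition word (T : Type) (c : Omega -> T) p := [seq c (omega v) | v <- iota 0 p].

Lemma size_word T (c : Omega -> T) p : size (word c p) = p.
Proof. by rewrite size_map size_iota. Qed.

Lemma nth_word T (x0 : T) c p v : (v < p)%N -> nth x0 (word c p) v = c (omega v).
Proof. by move=> vp; rewrite (nth_map 0%N) ?size_iota// nth_iota. Qed.

Lemma eq_word T (c c' : Omega -> T) p :
  word c p = word c' p <-> forall v, (v < p)%N -> c (omega v) = c' (omega v).
Proof.
split=> [e v vp|e].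
  by rewrite -(nth_word (c (omega 0)) c vp) e nth_word.
by apply/eq_in_map => v; rewrite mem_iota add0n => /e.
Qed.

Lemma word_cat T (c : Omega -> T) p q :
  word c (p + q) = word c p ++ [seq c (omega v) | v <- iota p q].
Proof. by rewrite /word iotaD map_cat. Qed.

Definition perm_ext p (s : 'S_p) (i : Omega) : Omega :=
  if insub (val i).-1 is Some o then omega (s (o : 'I_p)) else i.

Lemma perm_ext_omega p (s : 'S_p) (o : 'I_p) : perm_ext s (omega o) = omega (s o).
Proof. by rewrite /perm_ext /= valK. Qed.

Lemma perm_ext_out p (s : 'S_p) v : (p <= v)%N -> perm_ext s (omega v) = omega v.
Proof. by move=> pv; rewrite /perm_ext /= insubN// -leqNgt. Qed.

Lemma omega_ind (P : Omega -> Prop) : (forall v, P (omega v)) -> forall i, P i.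
Proof. by move=> Pom i; rewrite -[i]omegaE; exact: Pom. Qed.

Lemma perm_extK p (s : 'S_p) : cancel (perm_ext s) (perm_ext s^-1%g).
Proof.
apply: omega_ind => v; have [pv|vp] := leqP p v; first by rewrite !perm_ext_out.
by rewrite -[v]/(nat_of_ord (Ordinal vp)) !perm_ext_omega permK.
Qed.

Lemma perm_extVK p (s : 'S_p) : cancel (perm_ext s^-1%g) (perm_ext s).
Proof. by have := perm_extK s^-1%g; rewrite invgK. Qed.

Definition sinf_of_perm p (s : 'S_p) : Sinf := MkSinf (perm_extK s) (perm_extVK s).

(** The source of all transitivity statements: a rearrangement of the letters in [1, p] is realized
    by a permutation that fixes all points beyond p. *)
Lemma perm_word (T : eqType) (c c' : Omega -> T) p :
  (forall v, (p <= v)%N -> c (omega v) = c' (omega v)) ->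
    perm_eq (word c p) (word c' p) ->
  exists g : Sinf, (forall i, c' (g i) = c i) /\ forall v, (p <= v)%N ->
    g (omega v) = omega v.
Proof.
have sz : size (word c' p) == p by rewrite size_word.
move=> e /(@tuple_permP _ _ _ (Tuple sz))[s es].
exists (sinf_of_perm s); split; last by move=> v pv; exact: perm_ext_out.
apply: omega_ind => v /=; have [pv|vp] := leqP p v; first by rewrite perm_ext_out// e.
rewrite -{1}[v]/(nat_of_ord (Ordinal vp)) perm_ext_omega.
rewrite -[RHS](nth_word (c (omega v)) c vp) es -[v in RHS]/(nat_of_ord (Ordinal vp)).
by rewrite -tnth_nth tnth_mktuple (tnth_nth (c (omega v))) nth_word.
Qed.

Lemma word_perm (T : eqType) (c : Omega -> T) (r : Sinf) p :
  (forall i, (val (r i) <= p)%N = (val i <= p)%N) ->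
  perm_eq (word (c \o r) p) (word c p).
Proof.
move=> r_le; rewrite /word.
have -> : [seq (c \o r) (omega v) | v <- iota 0 p] = map c (map r (map omega (iota 0 p))).
  by rewrite -!map_comp.
rewrite (map_comp c omega); apply: perm_map.
have memom i : (i \in map omega (iota 0 p)) = (val i <= p)%N.
  move: i; apply: omega_ind => v; rewrite (mem_map omega_inj) mem_iota /=.
  by rewrite add0n.
apply: uniq_perm; rewrite ?map_inj_uniq ?iota_uniq//.
- exact: omega_inj.
- exact: can_inj (sfunK r).
- exact: omega_inj.
move=> i; rewrite memom; apply/mapP/idP => [[j jp ->]|ip].
  by rewrite r_le -memom.
by exists (sinv r i); rewrite ?sinvK// memom -r_le sinvK.
Qed.

Lemma count_itv a b p : (a <= b <= p)%N ->
  count (fun v => (a <= v < b)%N) (iota 0 p) = (b - a)%N.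
Proof.
case/andP=> ab bp.
have -> : iota 0 p = iota 0 a ++ iota a (b - a) ++ iota b (p - b).
  have e : p = (a + (b - a) + (p - b))%N by rewrite subnKC// subnKC.
  by rewrite [in LHS]e !iotaD !add0n subnKC// -catA.
rewrite !count_cat.
rewrite (eq_in_count (a2 := pred0)) ?count_pred0; last first.
  by move=> v; rewrite mem_iota add0n /= => va; rewrite leqNgt va.
rewrite (eq_in_count (a2 := predT)) ?count_predT ?size_iota; last first.
  by move=> v; rewrite mem_iota (subnKC ab) => ->.
rewrite (eq_in_count (a2 := pred0)) ?count_pred0 ?addn0//.
by move=> v; rewrite mem_iota => /andP[bv _] /=; rewrite [(v < b)%N]ltnNge bv andbF.
Qed.

Lemma size_count (U : finType) (s : seq U) : size s = (\sum_u count_mem u s)%N.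
Proof.
elim: s => [|a s IH] /=; first by rewrite big1.
rewrite big_split /= -IH (bigD1 a)//= eqxx big1 ?addn0 ?add1n// => i.
by rewrite eq_sym => /negPf ->.
Qed.

Section Points.
Context (k : fieldType) (t : k) (n : nat) (n_gt0 : (0 < n)%N).
Local Notation weight := (weight t n).
Local Notation T := (option 'I_n.-1).
Implicit Types b d : weight.

(** Total size of the finite blocks preceding block i + 2, which is the block of color i. *)
Definition offset b i := (\sum_(2 <= j < i.+2) part b j)%N.
Definition deg b := (\sum_i tnth (val b).2 i)%N.

Lemma offsetS b (i : 'I_n.-1) : offset b i.+1 = (offset b i + tnth (val b).2 i)%N.
Proof.
by rewrite /offset big_nat_recr//= /part !subSS subn0 (tnth_nth 0%N).
Qed.

Lemma offset_mono b i j : (i <= j)%N -> (offset b i <= offset b j)%N.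
Proof.
move=> ij; rewrite /offset [leqRHS](big_cat_nat (n := i.+2))//=.
exact: leq_addr.
Qed.

Lemma offset_deg b : offset b n.-1 = deg b.
Proof.
rewrite /offset /deg (big_addn 0 _ 2) subn2 big_mkord; apply: eq_bigr => i _.
by rewrite /part addnK (tnth_nth 0%N).
Qed.

(* Colors encode blocks: [None] is block 1 and [Some i] is block [i + 2]. *)
Definition base_color b (x : Omega) : T :=
  [pick i : 'I_n.-1 | (offset b i < val x <= offset b i.+1)%N].

Lemma cstP b x i : base_color b x = Some i <-> (offset b i < val x <= offset b i.+1)%N.
Proof.
rewrite /base_color; split=> [|xi]; first by case: pickP => // j xj [<-].
case: pickP => [j xj|/(_ i)]; last by rewrite xi.
congr Some; apply: val_inj; case: (ltngtP j i) => // ij.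
  have := offset_mono b ij; case/andP: xj => _ xj; case/andP: xi => xi _.
  by rewrite leqNgt (leq_trans xi).
have := offset_mono b ij; case/andP: xi => _ xi; case/andP: xj => xj _.
by rewrite leqNgt (leq_trans xj).
Qed.

Lemma cst_big b v : (deg b <= v)%N -> base_color b (omega v) = None.
Proof.
move=> bv; rewrite /base_color; case: pickP => // i /andP[_].
rewrite leqNgt /= ltnS (leq_trans _ bv)// -offset_deg.
exact: offset_mono.
Qed.

Lemma count_cst b p i : (deg b <= p)%N ->
  count_mem (Some i) (word (base_color b) p) = tnth (val b).2 i.
Proof.
move=> bp; rewrite count_map (eq_count (a2 := fun v =>
  (offset b i <= v < offset b i.+1)%N)).
  rewrite count_itv ?offsetS ?addKn// leq_addr /= -offsetS (leq_trans _ bp)//.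
  by rewrite -offset_deg; exact: offset_mono.
by move=> v /=; apply/eqP/idP => [/(cstP b _ i).1|/(cstP b (omega v) i).2].
Qed.

Lemma block_cst b (i : 'I_n.-1) x : block b i.+2 x <-> base_color b x = Some i.
Proof.
by rewrite cstP /block /= /interval_block /=.
Qed.

Lemma block1_cst b x : block b 1 x <-> base_color b x = None.
Proof.
rewrite /block /=; split=> [nx|nx [i /= /andP[i2 ni] xi]].
  case e : base_color => [i|//]; case: nx; exists i.+2 => /=.
    by rewrite -[X in (_ <= X)%N](prednK n_gt0) ltnS.
  by move/block_cst: e.
have ii : (i.-2 < n.-1)%N by case: i i2 ni {xi} => [|[|i]]//= _; case: (n).
have := nx; have -> // : base_color b x = Some (Ordinal ii).
by apply/block_cst => /=; case: i i2 {ni ii} xi => [|[|i]].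
Qed.

Lemma youngP b g : young b g <-> forall x, base_color b (g x) = base_color b x.
Proof.
have blk (c : T) : exists2 j, (1 <= j <= n)%N & forall x, block b j x <->
  base_color b x = c.
  case: c => [i|]; last by exists 1%N; [rewrite n_gt0|exact: block1_cst].
  exists i.+2; last exact: block_cst.
  by rewrite /= -[X in (_ <= X)%N](prednK n_gt0) ltnS.
split=> [yg x|yg j jn].
  have [j jn jx] := blk (base_color b x).
  by apply/jx; rewrite -(yg _ jn); exists x => //; apply/jx.
have [c jc] : exists c, forall x, block b j x <-> base_color b x = c.
  case: j jn => [|[|j]]// jn; first by exists None; exact: block1_cst.
  have jn' : (j < n.-1)%N by move: jn; case: (n).
  by exists (Some (Ordinal jn')); exact: (@block_cst b (Ordinal jn')).
apply/seteqP; split=> [_ [x /jc xc <-]|x /jc xc].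
  by apply/jc; rewrite yg.
by exists (sinv g x); [apply/jc; rewrite -yg sinvK|rewrite sinvK].
Qed.

Local Notation X b := (coset_obj b).

Definition coset_pt b (g : Sinf) : X b := exist _ _ (ex_intro _ g erefl).

Lemma coset_eq b (x y : cosets (young b)) : sval x = sval y -> x = y.
Proof. by case: x y => x hx [y hy] /= xy; exact: eq_exist. Qed.

Definition coset_rep b (x : X b) : Sinf := projT1 (cid (svalP x)).

Lemma coset_ptK b (x : X b) : coset_pt b (coset_rep x) = x.
Proof. by apply: coset_eq => /=; rewrite -(projT2 (cid (svalP x))). Qed.

Lemma act_coset_pt b g h : sact g (coset_pt b h) = coset_pt b (g * h)%g.
Proof.
apply: coset_eq => /=; apply/seteqP; split=> x.
  by case=> _ [v Vv <-] <-; exists v => //; rewrite mulgA.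
by case=> v Vv <-; exists (h * v)%g; [exists v|rewrite mulgA].
Qed.

(** The coset of g becomes the base coloring composed with the inverse of g. By [youngP] the choice
    of representative is immaterial. *)
Definition color b (x : X b) (i : Omega) : T := base_color b (sinv (coset_rep x) i).

Lemma color_coset_pt b g i : color (coset_pt b g) i = base_color b (sinv g i).
Proof.
rewrite /color; have /(congr1 sval)/= e := coset_ptK (coset_pt b g).
have : Defs.lcoset (young b) g (coset_rep (coset_pt b g)).
  by rewrite -e; exists 1%g; [exact: young1|rewrite mulg1].
case=> v /youngP yv <-; rewrite /= -[in RHS](sinvK v (sinv g i)).
exact/esym/yv.
Qed.

Lemma coset_pt_eq b g h : (forall i, color (coset_pt b g) i = color (coset_pt b h) i)
  -> coset_pt b g = coset_pt b h.
Proof.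
move=> e; have yv : young b (h^-1 * g)%g.
  apply/youngP => i /=; have := e (g i); rewrite !color_coset_pt sfunK => ->.
  by [].
have -> : g = (h * (h^-1 * g))%g by rewrite mulgA mulgV mul1g.
by apply: coset_eq; exact: (lcoset_act (young1 b) (@youngM _ _ _ b) h yv).
Qed.

Lemma color_inj b (x y : X b) : (forall i, color x i = color y i) -> x = y.
Proof. by rewrite -[x]coset_ptK -[y]coset_ptK; exact: coset_pt_eq. Qed.

Lemma color_act b g (x : X b) i : color (sact g x) i = color x (sinv g i).
Proof. by rewrite -[x]coset_ptK act_coset_pt !color_coset_pt. Qed.

Definition none_from (c : Omega -> T) p := forall v, (p <= v)%N -> c (omega v) = None.

Lemma none_fromW c p q : (p <= q)%N -> none_from c p -> none_from c q.
Proof. by move=> pq cp v qv; apply: cp; exact: leq_trans qv. Qed.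

Lemma count_none_from c p q i : (p <= q)%N -> none_from c p ->
  count_mem (Some i) (word c q) = count_mem (Some i) (word c p).
Proof.
move=> /subnKC <- cp; rewrite word_cat count_cat -[RHS]addn0; congr addn.
apply/eqP; rewrite -leqn0 leqNgt -has_count -all_predC; apply/allP => _ /mapP[v vi ->].
by rewrite cp//; move: vi; rewrite mem_iota => /andP[].
Qed.

(** Only the values of the representative on [1, [deg b]] matter, so [approx_perm] replaces it by a
    permutation r that preserves some [1, p]. The word of x on [1, p] is then a rearrangement of
    that of the base coloring. *)
Lemma colorP b (x : X b) : exists p, none_from (color x) p /\
  forall i, count_mem (Some i) (word (color x) p) = tnth (val b).2 i.
Proof.
pose F := [set i : Omega | (val i <= deg b)%N].
have finF : finite_set F.
  apply: (@sub_finite_set _ _ (val @^-1` `I_(deg b).+1)) => //.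
  by apply: finite_preimage; [move=> ? ? _ _; exact: val_inj|exact: finite_II].
have [N HN] := approx_perm (coset_rep x) finF.
have [r rp_ rF] := HN _ (leq_maxl N (deg b)).
set p := maxn N (deg b) in rp_ *.
have out j : ~~ (val j <= deg b)%N -> base_color b j = None.
  by move: j; apply: omega_ind => v /=; rewrite -leqNgt; exact: cst_big.
have colorE i : color x i = base_color b (sinv r i).
  rewrite /color; have [jF|jF] := boolP (val (sinv (coset_rep x) i) <= deg b)%N.
    by rewrite -[in RHS](sinvK (coset_rep x) i) -rF// sfunK.
  rewrite !out//; apply: contra jF => jF.
  by rewrite -[in sinv (coset_rep x) i](sinvK r i) rF// sfunK.
have rp' i : (val (sinv r i) <= p)%N = (val i <= p)%N by rewrite -rp_ sinvK.
exists p; split=> [v pv|i].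
  rewrite colorE out//; have : ~~ (val (sinv r (omega v)) <= p)%N by rewrite rp' -ltnNge.
  by apply: contra => h; apply: leq_trans h _; exact: leq_maxr.
rewrite -(@count_cst b p); last exact: leq_maxr.
have -> : word (color x) p = word (base_color b \o (r^-1)%g) p by apply/eq_word => v _;
  rewrite colorE.
by have /seq.permP -> := @word_perm _ (base_color b) (r^-1)%g p rp'.
Qed.

Lemma color_count b (x : X b) p i : none_from (color x) p ->
  count_mem (Some i) (word (color x) p) = tnth (val b).2 i.
Proof.
move=> xp; have [q [xq <-]] := colorP x.
rewrite -(count_none_from i (leq_maxl p q) xp); exact: count_none_from (leq_maxr p q) xq.
Qed.

Lemma perm_count p (s s' : seq T) : size s = p -> size s' = p ->
  (forall i, count_mem (Some i) s = count_mem (Some i) s') -> perm_eq s s'.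
Proof.
move=> sp s'p e.
suff eN : count_mem None s = count_mem None s'.
  by rewrite /perm_eq; apply/allP => -[i|] _ /=; apply/eqP.
have := size_count s; rewrite sp -s'p size_count (bigD1 None)//= [in RHS](bigD1 None)//=.
rewrite (eq_bigr (fun c => count_mem c s)); first by move=> /addIn.
by move=> -[i|]//.
Qed.

Lemma color_ex b c p : none_from c p ->
  (forall i, count_mem (Some i) (word c p) = tnth (val b).2 i) ->
  exists x : X b, forall i, color x i = c i.
Proof.
move=> cp cc; set q := maxn p (deg b).
have [| |g [gc _]] := @perm_word T c (base_color b) q.
- by move=> v; rewrite geq_max => /andP[pv bv]; rewrite cp// cst_big.
- apply: (@perm_count q); rewrite ?size_word// => i.
  by rewrite count_cst ?leq_maxr// (count_none_from _ (leq_maxl _ _) cp).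
exists (coset_pt b g^-1%g) => i; rewrite color_coset_pt.
exact: gc.
Qed.
End Points.

(** * Rational polynomials and the number of words *)

Lemma poly_natr_inj (R : idomainType) (char0 : [pchar R] =i pred0) (P Q : {poly R}) N :
  (forall p, (N <= p)%N -> P.[p%:R] = Q.[p%:R]) -> P = Q.
Proof.
move=> e; apply/eqP; rewrite -subr_eq0; apply: contraT => PQ0.
have natr_inj : injective (fun p : nat => p%:R : R).
  move/pcharf0P: char0 => c0 p q /eqP pq; apply/eqP; move: pq.
  wlog pq : p q / (p <= q)%N.
    move=> H; case/orP: (leq_total p q) => [/H//|/H].
    by rewrite eq_sym [q == p]eq_sym.
  by rewrite eq_sym -subr_eq0 -natrB// c0 subn_eq0 eqn_leq pq.
pose s := [seq p%:R : R | p <- iota N (size (P - Q))].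
have := @max_poly_roots R (P - Q) s PQ0.
rewrite size_map size_iota ltnn => -> //; last by rewrite map_inj_uniq ?iota_uniq.
apply/allP => x /mapP[p]; rewrite mem_iota => /andP[/e ep _] ->.
by rewrite /root hornerD hornerN ep subrr.
Qed.

(** * Rational numbers in a field of characteristic zero *)

Section Ratr.
Context (k : fieldType) (char0 : [pchar k] =i pred0).

Lemma intr_neq0 (z : int) : (z%:~R == 0 :> k) = (z == 0).
Proof.
move/pcharf0P: char0 => c0; case: z => z; first exact: c0.
by rewrite NegzE mulrNz !oppr_eq0; exact: c0.
Qed.

(** Denominators stay invertible in characteristic zero. Unreduced fractions are allowed because
    sums and products of reduced ones are of this kind. *)
Lemma ratr_frac (a b : int) : b != 0 -> ratr (a%:~R / b%:~R) = a%:~R / b%:~R :> k.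
Proof.
move=> b0; rewrite /ratr; set x : rat := _ / _.
have d0 : (denq x)%:~R != 0 :> k by rewrite intr_neq0 denq_neq0.
have b0' : b%:~R != 0 :> k by rewrite intr_neq0.
apply/eqP; rewrite eqr_div// -!intrM; apply/eqP; congr (_%:~R).
have b0q : b%:~R != 0 :> rat by rewrite intr_eq0.
have := divq_num_den x; rewrite {3}/x => /eqP.
rewrite eqr_div ?intr_eq0 ?denq_neq0// -!intrM => /eqP /intr_inj.
by [].
Qed.

Lemma ratr_zmod_morphism : zmod_morphism (@ratr k).
Proof.
move=> x y; rewrite -[x]divq_num_den -[y]divq_num_den.
have [dx dy] := (denq_neq0 x, denq_neq0 y).
rewrite -mulNr addf_div ?intr_eq0//.
rewrite -!rmorphN -!rmorphM -rmorphD /= !ratr_frac ?mulf_neq0//.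
by rewrite -mulNr addf_div ?intr_neq0// !rmorphD/= !rmorphM/= !rmorphN.
Qed.

Lemma ratr_monoid_morphism : monoid_morphism (@ratr k).
Proof.
split=> [|x y]; first by rewrite -[1 in LHS]/(1%:~R) ratr_int.
rewrite -[x]divq_num_den -[y]divq_num_den.
have [dx dy] := (denq_neq0 x, denq_neq0 y).
rewrite mulf_div -!rmorphM /= !ratr_frac ?mulf_neq0//.
by rewrite mulf_div !rmorphM.
Qed.

Definition ratr_rmorphism : {rmorphism rat -> k} :=
  HB.pack (@ratr k) (GRing.isZmodMorphism.Build rat k (@ratr k) ratr_zmod_morphism)
    (GRing.isMonoidMorphism.Build rat k (@ratr k) ratr_monoid_morphism).
End Ratr.

(** * Multinomial coefficients as numbers of words *)

Section Counting.
Context (m : nat).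
Local Notation T := (option 'I_m).

Definition word_count q (c : 'I_m -> nat) :=
  #|[pred w : q.-tuple T | [forall i, count_mem (Some i) w == c i]]|.

Lemma card_tuple_cons q (P : pred (seq T)) :
  #|[pred w : q.+1.-tuple T | P w]| =
  (\sum_(a : T) #|[pred w : q.-tuple T | P (a :: w)]|)%N.
Proof.
under [RHS]eq_bigr => a _ do rewrite -sum1_card.
rewrite -sum1_card.
rewrite pair_big_dep /= (reindex (fun u : T * q.-tuple T => cons_tuple u.1 u.2)) /=.
  exact: eq_bigl.
exists (fun w : q.+1.-tuple T => (thead w, behead_tuple w)) => [[a w] _|w _].
  by congr pair; apply: val_inj.
by rewrite [RHS]tuple_eta; apply: val_inj.
Qed.

(** Splits off the first letter, [None] or [Some i]; the condition 0 < c i guards the truncated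
    subtraction. *)
Lemma word_count_rec q c : word_count q.+1 c = (word_count q c +
  \sum_(i | (0 < c i)%N) word_count q (fun j => c j - (i == j)))%N.
Proof.
rewrite /word_count (card_tuple_cons q (fun w : seq T =>
  [forall i, count_mem (Some i) w == c i])).
rewrite (bigD1 None)//=; congr addn.
rewrite [RHS]big_mkcond (reindex_omap Some id)/=; last by case.
apply: eq_big => [i|i _]; first by rewrite eqxx.
case: ifP => [ci|/negbT]; last first.
  rewrite -eqn0Ngt => /eqP ci; apply: eq_card0 => w.
  rewrite !inE; apply/negbTE/forallPn; exists i.
  by rewrite eqxx ci.
apply: eq_card => w; rewrite !inE; apply/eq_forallb => j.
have /= -> : (Some i == Some j :> T) = (i == j) by [].
have [<-|_] := eqVneq i j; last by rewrite subn0.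
by rewrite -[in RHS](eqn_add2l 1) subnKC.
Qed.

(** The multinomial coefficient without denominators, [None] filling the other positions. With D + 1
    the sum of the c i, the recursion becomes (q + 1)^_(D + 1) = q^_(D + 1) + (D + 1) q^_D. *)
Lemma word_countE q c : (word_count q c * \prod_i (c i)`!)%N = q ^_ (\sum_i c i).
Proof.
elim: q c => [|q IH] c.
  rewrite /word_count; have [/eqP|c0] := boolP (\sum_i c i == 0)%N.
    move=> c0; have ci i : c i = 0%N by apply/eqP; move/eqP: c0; rewrite sum_nat_eq0 =>
      /forallP/(_ i).
    rewrite c0 big1 => [|i _]; last by rewrite ci.
    rewrite muln1 -[RHS](card_tuple 0 T); apply: eq_card => w.
    by rewrite !inE; apply/forallP => i; rewrite tuple0 ci.
  have -> : 0 ^_ (\sum_i c i) = 0%N by case: (\sum_i c i)%N c0.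
  rewrite eq_card0// => w.
  rewrite !inE; apply/negbTE; move: c0; apply: contra => /forallP wc.
  by rewrite sum_nat_eq0; apply/forallP => i /=; rewrite -(eqP (wc i)) tuple0.
rewrite word_count_rec mulnDl IH big_distrl /=.
have e i : (0 < c i)%N -> (word_count q (fun j => c j - (i == j)) * \prod_j (c j)`! =
    c i * q ^_ (\sum_j c j).-1)%N.
  move=> ci; rewrite -(_ : \sum_j (c j - (i == j)) = (\sum_j c j).-1)%N; last first.
    rewrite (bigD1 i)//= [in RHS](bigD1 i)//= eqxx.
    rewrite (eq_bigr c) => [|j /negPf]; last by rewrite eq_sym => ->; rewrite subn0.
    by case: (c i) ci => // u _; rewrite subn1.
  rewrite -IH mulnCA; congr muln.
  rewrite (bigD1 i)//= [in RHS](bigD1 i)//= eqxx mulnA subn1 -{1}(prednK ci) factS.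
  rewrite prednK//; congr muln.
  by apply: eq_bigr => j /negPf; rewrite eq_sym => ->; rewrite subn0.
rewrite (eq_bigr _ e) -big_distrl /=.
have -> : (\sum_(i | (0 < c i)%N) c i = \sum_i c i)%N.
  by rewrite big_mkcond; apply: eq_bigr => i _; case: (c i).
case: (\sum_i c i)%N => [|D]; first by rewrite !ffactn0 mul0n.
rewrite ffactSS ffactnSr /= [in RHS]mulnC [in X in (_ + X)%N]mulnC -mulnDr.
have [Dq|qD] := leqP D q; last by rewrite ffact_small.
by rewrite addnS subnK.
Qed.
End Counting.

(** * The integral as a polynomial in the parameter *)

Definition stab (N : nat) : set Sinf := pstab [set i | (val i <= N)%N].

Lemma stab_inv N g i : stab N g -> (val (sinv g i) <= N)%N = (val i <= N)%N.
Proof.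
move=> gN; apply/idP/idP => h; first by rewrite -(sinvK g i) gN.
by rewrite -{1}(gN i h) sfunK.
Qed.

Lemma stab_fix N g i : stab N g -> (val i <= N)%N -> sinv g i = i.
Proof. by move=> gN iN; rewrite -{1}(gN i iN) sfunK. Qed.

Section Integration.
Context (k : fieldType) (t : k) (n : nat) (n_gt0 : (0 < n)%N).
Local Notation weight := (weight t n).
Local Notation T := (option 'I_n.-1).
Implicit Types b d : weight.
Local Notation X b := (coset_obj b).

Lemma stab_trans b N (x y : X b) : word (color x) N = word (color y) N ->
  exists2 g, stab N g & sact g x = y.
Proof.
move=> e; have [p [xp _]] := colorP x; have [q [yq _]] := colorP y.
set P := (N + maxn p q)%N.
have pP : (p <= P)%N by rewrite (leq_trans (leq_maxl p q))// leq_addl.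
have qP : (q <= P)%N by rewrite (leq_trans (leq_maxr p q))// leq_addl.
(* Recoloring [1, N] by the identity forces the permutation to fix it pointwise. *)
pose c (z : X b) i : nat + T := if (val i <= N)%N then inl (val i) else inr (color z i).
have letters z : word (c z) P = [seq inl v.+1 | v <- iota 0 N] ++
    [seq inr u | u <- [seq color z (omega v) | v <- iota N (maxn p q)]].
  rewrite word_cat; congr cat; last rewrite -map_comp.
    by apply/eq_in_map => v; rewrite mem_iota add0n /c /= => ->.
  apply/eq_in_map => v; rewrite mem_iota /c /= => /andP[Nv _].
  by rewrite ltnNge Nv.
have [| |g [gc _]] := @perm_word _ (c x) (c y) P.
- move=> v Pv; rewrite /c; case: ifP => // _.
  by rewrite (none_fromW pP xp)// (none_fromW qP yq).
- rewrite !letters perm_cat2l; apply: perm_map.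
  rewrite -(perm_cat2l (word (color x) N)) {2}e -!word_cat.
  apply: (@perm_count _ P); rewrite ?size_word// => i.
  by rewrite !(color_count)//; [exact: none_fromW yq|exact: none_fromW xp].
have gN : stab N g.
  by move=> i /= iN; have := gc i; rewrite /c iN; case: ifP => // _ [] /val_inj.
exists g => //; apply: (color_inj n_gt0) => i; rewrite color_act// -(sinvK g i) sfunK.
set j := sinv g i; have := gc j; rewrite /c.
have [jN|jN] := boolP (val j <= N)%N; last by case: ifP => // _ [].
move=> _; rewrite gN//; move: j jN; apply: omega_ind => v vN.
exact: ((eq_word (color x) (color y) N).1 e _ vN).
Qed.

Definition stab_invariant b N (B : Type) (f : X b -> B) :=
  forall g, stab N g -> forall x, f (sact g x) = f x.

Lemma stab_invariant_word b N B (f : X b -> B) x y : stab_invariant N f ->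
  word (color x) N = word (color y) N -> f x = f y.
Proof. by move=> fN /stab_trans[g gN <-]; rewrite fN. Qed.

Lemma stab_none_from b N (x : X b) g : none_from (color x) N -> stab N g -> sact g x = x.
Proof.
move=> xN gN; apply: (color_inj n_gt0) => i; rewrite color_act//.
have [iN|iN] := boolP (val i <= N)%N; first by rewrite (stab_fix gN).
have big j : ~~ (val j <= N)%N -> color x j = None.
  by move: j; apply: omega_ind => v /=; rewrite -leqNgt => /xN.
by rewrite !big// (stab_inv _ gN).
Qed.

(** A colored point beyond N can be swapped, inside [stab N], with one so far out that its color is
    [None]; so a fixed x has no such point. *)
Lemma fixed_none_from b N (x : X b) : (forall g, stab N g -> sact g x = x) <->
  none_from (color x) N.
Proof.
split=> [fx v Nv|xN g gN]; last exact: stab_none_from xN gN.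
have [p [xp _]] := colorP x.
pose u := maxn p N; have gN : stab N (swap (omega v) (omega u)).
  move=> i /= iN; rewrite /swap_fun.
  have [iv|_] := eqVneq i (omega v); first by move: iN; rewrite iv /= ltnNge Nv.
  have [iv|//] := eqVneq i (omega u); move: iN; rewrite iv /= ltnNge.
  by rewrite leq_maxr.
rewrite -(fx _ gN) color_act//= /swap_fun eqxx.
by rewrite xp// leq_maxl.
Qed.

(** * Words of length N as orbits of the stabilizer of [1, N] *)

Definition full_word b (w : seq T) := [forall i,
  count_mem (Some i) w == tnth (val b).2 i].
(** The words that arbitrary points of X^b show on an initial segment; the [full_word]s come from
    the points supported there. *)
Definition part_word b (w : seq T) := [forall i,
  (count_mem (Some i) w <= tnth (val b).2 i)%N].
Definition missing b (w : seq T) i := (tnth (val b).2 i - count_mem (Some i) w)%N.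

Lemma full_part_word b w : full_word b w -> part_word b w.
Proof. by move=> /forallP bw; apply/forallP => i; rewrite (eqP (bw i)). Qed.

Lemma part_word_color b (x : X b) N : part_word b (word (color x) N).
Proof.
have [p [xp _]] := colorP x; apply/forallP => i.
rewrite -(color_count i (none_fromW (leq_addl N p) xp)) word_cat count_cat.
exact: leq_addr.
Qed.

Lemma full_word_color b (x : X b) N : none_from (color x) N ->
  full_word b (word (color x) N).
Proof. by move=> xN; apply/forallP => i; rewrite color_count. Qed.

Lemma full_word_none_from b (x : X b) N : full_word b (word (color x) N) ->
  none_from (color x) N.
Proof.
move=> /forallP xN v Nv; have [p [xp _]] := colorP x.
case e : (color x (omega v)) => [i|//].
have := color_count i (none_fromW (leq_addl N (maxn p v.+1))
  (none_fromW (leq_maxl _ _) xp)).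
rewrite word_cat count_cat -(eqP (xN i)) -[RHS]addn0 => /addnI /eqP.
rewrite -leqn0 leqNgt -has_count => /hasPn/(_ (Some i)); rewrite /= eqxx.
suff -> : Some i \in [seq color x (omega u) | u <- iota N (maxn p v.+1)] by move=>
  /(_ isT).
rewrite -e; apply/mapP; exists v => //; rewrite mem_iota Nv /=.
by rewrite (leq_trans (leq_maxr p v.+1))// leq_addl.
Qed.

Definition letters (w : seq T) (i : Omega) : T := nth None w (val i).-1.

Lemma word_letters w q : (q <= size w)%N -> word (letters w) q = take q w.
Proof.
move=> qw; apply: (@eq_from_nth _ None); first by rewrite size_word size_takel.
by rewrite size_word => v vq; rewrite nth_word// nth_take.
Qed.

Lemma none_from_letters w : none_from (letters w) (size w).
Proof. by move=> v sv; rewrite /letters nth_default. Qed.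

Lemma part_word_ex b w : part_word b w -> exists x : X b, word (color x) (size w) = w.
Proof.
move=> /forallP bw.
pose s := w ++ flatten [seq nseq (missing b w i) (Some i) | i <- enum 'I_n.-1].
have [|x xs] := color_ex n_gt0 (@none_from_letters s) (b := b).
  move=> i; rewrite word_letters// take_size count_cat count_flatten -map_comp.
  rewrite sumnE big_map big_enum /= (bigD1 i)//= big1 => [|j /negPf ji].
    by rewrite count_nseq /= eqxx mul1n addn0 subnKC.
  by rewrite count_nseq /= (_ : (Some j == Some i :> T) = false).
exists x; have -> : word (color x) (size w) = word (letters s) (size w).
  by apply/eq_word => v _.
by rewrite word_letters ?take_size_cat// size_cat leq_addr.
Qed.

(** By [stab_trans] the orbits of [stab N] correspond to words, and this chooses a point in each.
    The default value for words that no point shows is harmless, since their [ext_poly] is 0. *)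
Definition word_pt b N (w : seq T) : X b := 
  if pselect (exists x : X b, word (color x) N = w) is left h then projT1 (cid h)
  else coset_pt b 1%g.

Lemma word_ptP b N (w : seq T) : size w = N -> part_word b w ->
  word (color (word_pt b N w)) N = w.
Proof.
move=> <- /part_word_ex[x xw]; rewrite /word_pt; case: pselect => [h|[]];
  last by exists x.
exact: (projT2 (cid h)).
Qed.

Lemma word_pt_word b (x : X b) N : word (color (word_pt b N (word (color x) N))) N =
  word (color x) N.
Proof. by rewrite word_ptP ?size_word ?part_word_color. Qed.

Lemma word_pt_none_from b (x : X b) N : none_from (color x) N ->
  word_pt b N (word (color x) N) = x.
Proof.
move=> xN; have [g gN e] := stab_trans (word_pt_word x N).
by rewrite -[RHS]e (@stab_none_from _ N)//; apply: full_word_none_from;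
  rewrite word_pt_word full_word_color.
Qed.

Lemma none_from_word_pt b N w : size w = N -> full_word b w ->
  none_from (color (word_pt b N w)) N.
Proof. by move=> sw bw; apply: full_word_none_from;
  rewrite word_ptP// full_part_word. Qed.

(* Interpolates, in p, the number of full words of length p extending [w]. *)
Definition ext_poly b N (w : seq T) : {poly rat} := if part_word b w then
  ((\prod_i (missing b w i)`!)%N%:R)^-1 *:
    \prod_(j < \sum_i missing b w i) ('X - (N + j)%N%:R%:P) else 0.

Lemma ffact_prod (R : comNzRingType) N q D :
  \prod_(j < D) ((N + q)%N%:R - (N + j)%N%:R) = (q ^_ D)%:R :> R.
Proof.
elim: D => [|D IH]; first by rewrite big_ord0 ffactn0.
rewrite big_ord_recr /= IH ffactnSr; have [Dq|qD] := leqP D q.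
  by rewrite natrM !natrD opprD addrACA subrr add0r natrB.
by rewrite ffact_small// mul0r mul0n.
Qed.

Lemma ext_poly_nat b N q (w : N.-tuple T) : (ext_poly b N w).[(N + q)%N%:R] =
  #|[pred u : (N + q).-tuple T | (take N u == w) && full_word b u]|%:R.
Proof.
have card_rem : #|[pred u : (N + q).-tuple T | (take N u == w) && full_word b u]| =
    if part_word b w then word_count q (missing b w) else 0%N.
  case: ifP => [/forallP bw|bw]; last first.
    apply: eq_card0 => u; rewrite !inE; apply/negbTE; move: bw; apply: contraFN.
    case/andP=> /eqP <- /forallP bu; apply/forallP => i.
    by rewrite -(eqP (bu i)) -{2}(cat_take_drop N u) count_cat leq_addr.
  rewrite /word_count -(fintype.card_image (f := fun v : q.-tuple T => cat_tuple w v)).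
    apply: eq_card => u; rewrite !inE; apply/andP/fintype.imageP =>
      [[/eqP uw /forallP bu]|].
      have sz : size (drop N u) == q by rewrite size_drop size_tuple addKn.
      exists (Tuple sz); last by apply: val_inj; rewrite /= -uw cat_take_drop.
      rewrite inE; apply/forallP => i; rewrite /missing -(eqP (bu i)) -uw.
      by rewrite -{2}(cat_take_drop N u) count_cat addKn.
    move=> [v /forallP bv ->]; split.
      by rewrite /= take_size_cat// size_tuple.
    apply/forallP => i; rewrite /= count_cat (eqP (bv i)).
    by rewrite subnKC.
  move=> u v /(congr1 val)/= /eqP; rewrite eqseq_cat// => /andP[_ /eqP].
  exact: val_inj.
rewrite card_rem /ext_poly; case: ifP => [bw|_]; last by rewrite horner0.
rewrite hornerZ horner_prod.
under [Z in _ * Z]eq_bigr => j _ do rewrite hornerXsubC.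
rewrite ffact_prod -(word_countE q (missing b w)) natrM mulrC mulfK//
  Num.Theory.pnatr_eq0 -lt0n.
by rewrite prodn_gt0// => i; exact: fact_gt0.
Qed.

Lemma word_take (c : Omega -> T) N q : take N (word c (N + q)) = word c N.
Proof. by rewrite word_cat take_size_cat// size_word. Qed.

Lemma word_pt_take b N q w (B : set (X b)) : stab_invariant N B ->
  size w = (N + q)%N -> full_word b w ->
  B (word_pt b N (take N w)) = B (word_pt b (N + q) w).
Proof.
move=> BN sw bw; apply: (stab_invariant_word BN).
have e : take N w = word (color (word_pt b (N + q) w)) N.
  by rewrite -{1}(@word_ptP b (N + q) w)// ?full_part_word// word_take.
by rewrite e word_pt_word.
Qed.

Lemma card_mem_set (U : finType) (S : {pred U}) : ([set` S] #= `I_#|S|)%card.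
Proof.
have -> : [set` S] = (@enum_val U S) @` setT.
  apply/seteqP; split=> [x xS|_ [i _ <-]]; last exact: enum_valP.
  by exists (enum_rank_in xS x) => //; rewrite enum_rankK_in.
rewrite (card_eqr card_II).
by apply: inj_card_eq; apply: in2W; exact: enum_val_inj.
Qed.

(** B is a union of orbits of [stab N], one for each admissible word w. The points of such an orbit
    fixed by S(N + q) are the full words of length N + q that extend w, counted by
    [ext_poly_nat]. *)
Lemma is_germ_sum b N (B : set (X b)) : stab_invariant N B ->
  is_germ_poly (@sact (X b)) B (\sum_(w : N.-tuple T | `[< B (word_pt b N w) >])
    ext_poly b N w).
Proof.
move=> BN; exists N => p /subnKC <-; set q := (p - N)%N.
pose S := [pred u : (N + q).-tuple T | full_word b u && `[< B (word_pt b (N + q) u) >]].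
exists #|S|; split; last first.
  rewrite horner_sum; under eq_bigr => w _ do rewrite ext_poly_nat.
  rewrite -natr_sum; congr (_%:R); under eq_bigr => w _ do rewrite -sum1_card.
  rewrite (exchange_big_dep S) /=; last first.
    move=> w u /asboolP Bw; rewrite !inE => /andP[/eqP uw bu]; rewrite bu.
    by apply/asboolP; rewrite -word_pt_take ?size_tuple// uw.
  rewrite -sum1_card; apply: eq_bigr => u /andP[bu /asboolP Bu].
  have sz : size (take N u) == N by rewrite size_takel// size_tuple leq_addr.
  rewrite (big_pred1 (Tuple sz))// => w; rewrite !inE bu andbT.
  rewrite andbC -val_eqE /= eq_sym; have [->|//] := eqVneq.
  by apply/asboolP; rewrite (word_pt_take BN (size_tuple u)).
have -> : fixed_points (@sact (X b)) B (N + q) =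
    (fun v : (N + q).-tuple T => word_pt b (N + q) v) @` [set` S].
  apply/seteqP; split=> [x [Bx /fixed_none_from xb]|_ [v /andP[bv /asboolP Bv] <-]].
    have sz : size (word (color x) (N + q)) == (N + q)%N by rewrite size_word.
    exists (Tuple sz) => /=; last exact: word_pt_none_from.
    by rewrite inE /= full_word_color// word_pt_none_from//; exact/asboolP.
  by split=> //; apply/fixed_none_from/none_from_word_pt => //; rewrite size_tuple.
apply: card_eq_trans (card_mem_set S); apply: inj_card_eq => u v.
rewrite !in_setE => /andP[bu _] /andP[bv _] /(congr1 (fun x => word (color x) (N + q))).
by rewrite !word_ptP ?size_tuple ?full_part_word// => /val_inj.
Qed.

Lemma germ_polyE b N (B : set (X b)) : stab_invariant N B ->
  germ_poly (@sact (X b)) B = \sum_(w : N.-tuple T | `[< B (word_pt b N w) >]) ext_poly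
    b N w.
Proof.
move=> /is_germ_sum Bg; have Pg := xgetPex 0 (ex_intro _ _ Bg).
have [N1 H1] := Pg; have [N2 H2] := Bg.
apply: (@poly_natr_inj _ (@Num.Theory.pchar_num _) _ _ (maxn N1 N2)) => p.
rewrite geq_max => /andP[/H1[m1 [e1 ->]] /H2[m2 [e2 ->]]]; congr (_%:R).
by apply/card_eq_II; apply: card_eq_trans e2; rewrite card_eq_sym.
Qed.

Context (char0 : [pchar k] =i pred0).

(** The measure, at parameter s, of the set of points that show w on [1, N]. *)
Definition ext_num b N w (s : k) : k := (map_poly ratr (ext_poly b N w)).[s].

Lemma muE b N (B : set (X b)) s : stab_invariant N B ->
  mu s (@sact (X b)) B = \sum_(w : N.-tuple T | `[< B (word_pt b N w) >]) ext_num b N w s.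
Proof.
move=> /germ_polyE e; rewrite /mu e -[ratr]/(ratr_rmorphism char0 : rat -> k).
by rewrite rmorph_sum horner_sum.
Qed.

Lemma ext_numE b N w s : part_word b w -> ext_num b N w s =
  ((\prod_i (missing b w i)`!)%N%:R)^-1 * \prod_(j < \sum_i missing b w i)
    (s - (N + j)%N%:R).
Proof.
rewrite /ext_num /ext_poly => ->; rewrite -[ratr]/(ratr_rmorphism char0 : rat -> k).
rewrite map_polyZ hornerZ fmorphV rmorph_nat; congr (_ * _).
rewrite rmorph_prod horner_prod; apply: eq_bigr => j _.
transitivity (map_poly (ratr_rmorphism char0) ('X - (N + j)%N%:R%:P)).[s] => //.
by rewrite map_polyXsubC hornerXsubC rmorph_nat.
Qed.

Lemma ext_num0 b N w s : ~~ part_word b w -> ext_num b N w s = 0.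
Proof. by rewrite /ext_num /ext_poly => /negPf ->; rewrite map_poly0 horner0. Qed.

Lemma ext_num_full b N w s : full_word b w -> ext_num b N w s = 1.
Proof.
move=> bw; rewrite ext_numE ?full_part_word//.
have r0 i : missing b w i = 0%N by rewrite /missing (eqP (forallP bw i)) subnn.
have -> : (\sum_i missing b w i = 0)%N by rewrite big1.
rewrite big_ord0 (_ : (\prod_i (missing b w i)`!)%N = 1%N) ?invr1 ?mul1r//.
by rewrite big1 => [|i _]; rewrite ?r0.
Qed.

(** The level sets of f are unions of orbits of [stab N], so the sum over values can be rewritten as
    a sum over orbits. *)
Lemma integralE b N (f : X b -> k) s : stab_invariant N f ->
  integral s f = \sum_(w : N.-tuple T) f (word_pt b N w) * ext_num b N w s.
Proof.
move=> fN; pose S := undup [seq f (word_pt b N (w : N.-tuple T)) | w <- enum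
  {: N.-tuple T}].
have -> : integral s f = \sum_(c <- S) c * mu s (@sact (X b)) (f @^-1` [set c]).
  rewrite [RHS]fsbig_seq ?undup_uniq//; apply: eq_fsbigl; apply/seteqP; split=> c /=.
    case=> x _ <-; rewrite mem_undup.
    have sz : size (word (color x) N) == N by rewrite size_word.
    apply/mapP; exists (Tuple sz); first exact: mem_enum.
    by apply: (stab_invariant_word fN) => /=; rewrite word_pt_word.
  by rewrite mem_undup => /mapP[w _ ->]; exists (word_pt b N w).
under eq_bigr => c _.
  rewrite (@muE b N); last by move=> g gN x; rewrite /preimage /= fN.
  rewrite big_distrr /= big_mkcond; over.
rewrite exchange_big /=; apply: eq_bigr => w _.
have fS : f (word_pt b N w) \in S by rewrite mem_undup map_f ?mem_enum.
rewrite (bigD1_seq (f (word_pt b N w)))//= ?undup_uniq// asboolT// big1 ?addr0// => c cw'.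
by rewrite asboolF// => /eqP; rewrite eq_sym (negPf cw').
Qed.
End Integration.

(** * The permutation category *)

Section Category.
Context (k : fieldType) (char0 : [pchar k] =i pred0) (t : k) (n : nat)
  (n_gt0 : (0 < n)%N).
Local Notation weight := (weight t n).
Local Notation T := (option 'I_n.-1).
Implicit Types a b c d e : weight.
Local Notation X b := (coset_obj b).
Local Notation Hom b d := (Defs.hom k (X b) (X d)).

Lemma integralP b N (f g : X b -> k) x s : stab_invariant N f -> stab_invariant N g ->
  integral s (fun y => x * f y + g y) = x * integral s f + integral s g.
Proof.
move=> fN gN; rewrite !(@integralE _ _ _ n_gt0 char0 b N)//.
  by rewrite mulr_sumr -big_split; apply: eq_bigr => w _; rewrite mulrDl mulrA.
by move=> h hN y; rewrite fN// gN.
Qed.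

(** A point supported in [1, N] is an orbit by itself and has measure 1, so the result does not
    depend on s. *)
Lemma integral_supp b N (f : X b -> k) s : stab_invariant N f ->
  (forall x, ~ none_from (color x) N -> f x = 0) ->
  integral s f = \sum_(w : N.-tuple T | full_word b w) f (word_pt b N w).
Proof.
move=> fN f0; rewrite (@integralE _ _ _ n_gt0 char0 b N)// [RHS]big_mkcond.
apply: eq_bigr => w _; case: ifP => bw; first by rewrite ext_num_full// mulr1.
have [lw|lw] := boolP (part_word b w); last by rewrite ext_num0// mulr0.
rewrite f0 ?mul0r// => rw; have := full_word_color rw.
by rewrite word_ptP ?size_tuple// bw.
Qed.

(** At s = N the orbit of a word with missing letters has measure 0, its first factor being s - N.
    What remains is counting. *)
Lemma integral_nat b N (f : X b -> k) : stab_invariant N f ->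
  integral N%:R f = \sum_(w : N.-tuple T | full_word b w) f (word_pt b N w).
Proof.
move=> fN; rewrite (@integralE _ _ _ n_gt0 char0 b N)// [RHS]big_mkcond.
apply: eq_bigr => w _; case: ifP => bw; first by rewrite ext_num_full// mulr1.
have [lw|lw] := boolP (part_word b w); last by rewrite ext_num0// mulr0.
rewrite ext_numE//; case D : (\sum_i missing b w i)%N => [|m]; last first.
  by rewrite big_ord_recl addn0 subrr mul0r !mulr0.
case/negP: bw; apply/forallP => i; rewrite eqn_leq (forallP lw) /= -subn_eq0.
by move/eqP: D; rewrite sum_nat_eq0 => /forallP/(_ i).
Qed.

Lemma integral_poly b N (F : k -> X b -> k) : (forall s, stab_invariant N (F s)) ->
  (forall x, exists Q : {poly k}, forall s, F s x = Q.[s]) ->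
  exists Q : {poly k}, forall s, integral s (F s) = Q.[s].
Proof.
move=> FN /choice[Q FQ].
exists (\sum_(w : N.-tuple T) Q (word_pt b N w) * map_poly ratr (ext_poly b N w)) => s.
rewrite (@integralE _ _ _ n_gt0 char0 b N)// horner_sum; apply: eq_bigr => w _.
by rewrite hornerM FQ.
Qed.

Lemma homP b d (f : Hom b d) g y x : f (sact g y, sact g x) = f (y, x).
Proof. by have /asboolP := hom_funP f. Qed.

Lemma hom_eq b d (f g : Hom b d) : (forall y x, f (y, x) = g (y, x)) -> f = g.
Proof. by move=> fg; apply: val_inj; apply/funext => -[y x]; exact: fg. Qed.

Lemma hom_inv_l b d (f : Hom b d) N x : none_from (color x) N ->
  stab_invariant N (fun y => f (y, x)).
Proof. by move=> xN g gN y; rewrite -[x in LHS](stab_none_from n_gt0 xN gN) homP. Qed.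

Lemma hom_inv_r b d (f : Hom b d) N y : none_from (color y) N ->
  stab_invariant N (fun x => f (y, x)).
Proof. by move=> yN g gN x; rewrite -[y in LHS](stab_none_from n_gt0 yN gN) homP. Qed.

Lemma hcomp_inv b d e (g : Hom d e) (f : Hom b d) N z x :
  none_from (color z) N -> none_from (color x) N ->
    stab_invariant N (fun y => g (z, y) * f (y, x)).
Proof. by move=> zN xN h hN y; rewrite (hom_inv_r g zN)// (hom_inv_l f xN). Qed.

Lemma none_from_pair b d (y : X d) (x : X b) : exists N, none_from (color y) N /\
  none_from (color x) N.
Proof.
have [p [yp _]] := colorP y; have [q [xq _]] := colorP x.
by exists (maxn p q); split; [exact: none_fromW (leq_maxl p q) yp|exact: none_fromW
  (leq_maxr p q) xq].
Qed.

Lemma hcomp_nat b d e (g : Hom d e) (f : Hom b d) N z x :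
  none_from (color z) N -> none_from (color x) N ->
  hcomp N%:R g f (z, x) = \sum_(w : N.-tuple T | full_word d w) g (z, word_pt d N w) *
    f (word_pt d N w, x).
Proof. by move=> zN xN; rewrite /= /comp_fun (integral_nat (hcomp_inv _ _ zN xN)). Qed.

Lemma hcomp_poly b d e (g : Hom d e) (f : Hom b d) z x :
  exists Q : {poly k}, forall s, hcomp s g f (z, x) = Q.[s].
Proof.
have [N [zN xN]] := none_from_pair z x.
apply: (@integral_poly _ N (fun s y => g (z, y) * f (y, x))) => [s|y].
  exact: hcomp_inv.
by exists (g (z, y) * f (y, x))%:P => s; rewrite hornerC.
Qed.

(* For fixed arguments both sides are polynomial in [s]; at large integers [s]
   the integrals are finite sums, which can be exchanged. *)
Lemma hcompA s a b c d (h : Hom c d) (g : Hom b c) (f : Hom a b) :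
  hcomp s h (hcomp s g f) = hcomp s (hcomp s h g) f.
Proof.
apply: hom_eq => z x; have [N [zN xN]] := none_from_pair z x.
have [||P1 E1] := @integral_poly _ N (fun s y => h (z, y) * hcomp s g f (y, x)).
- by move=> u; exact: hcomp_inv.
- move=> y; have [Q EQ] := hcomp_poly g f y x.
  by exists ((h (z, y))%:P * Q) => u; rewrite hornerM hornerC EQ.
have [||P2 E2] := @integral_poly _ N (fun s y => hcomp s h g (z, y) * f (y, x)).
- by move=> u; exact: hcomp_inv.
- move=> y; have [Q EQ] := hcomp_poly h g z y.
  by exists (Q * (f (y, x))%:P) => u; rewrite hornerM hornerC EQ.
suff e : P1 = P2 by rewrite [LHS]E1 [RHS]E2 e.
apply: (@poly_natr_inj _ char0 _ _ N) => p Np.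
have [zp xp] := (none_fromW Np zN, none_fromW Np xN).
rewrite -E1 -E2 (integral_nat (hcomp_inv _ _ zp xp)) (integral_nat (hcomp_inv _ _ zp xp)).
under eq_bigr => w letters.
  rewrite (hcomp_nat _ _ (none_from_word_pt n_gt0 (size_tuple w) letters) xp)
    mulr_sumr; over.
under [RHS]eq_bigr => w bw.
  rewrite (hcomp_nat _ _ zp (none_from_word_pt n_gt0 (size_tuple w) bw)) mulr_suml; over.
rewrite exchange_big; apply: eq_bigr => w _; apply: eq_bigr => u _.
by rewrite mulrA.
Qed.

Lemma hcomp_Pl s b d e x (g g' : Hom d e) (f : Hom b d) :
  hcomp s (x *: g + g') f = x *: hcomp s g f + hcomp s g' f.
Proof.
apply: hom_eq => z y; have [N [zN yN]] := none_from_pair z y.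
rewrite -[RHS]/(x * integral s (fun u => g (z, u) * f (u, y)) +
  integral s (fun u => g' (z, u) * f (u, y))).
rewrite -(integralP x s (hcomp_inv _ _ zN yN) (hcomp_inv _ _ zN yN)) /= /comp_fun.
by congr integral; apply/funext => u; rewrite mulrA -mulrDl.
Qed.

Lemma hcomp_Pr s b d e x (g : Hom d e) (f f' : Hom b d) :
  hcomp s g (x *: f + f') = x *: hcomp s g f + hcomp s g f'.
Proof.
apply: hom_eq => z y; have [N [zN yN]] := none_from_pair z y.
rewrite -[RHS]/(x * integral s (fun u => g (z, u) * f (u, y)) +
  integral s (fun u => g (z, u) * f' (u, y))).
rewrite -(integralP x s (hcomp_inv _ _ zN yN) (hcomp_inv _ _ zN yN)) /= /comp_fun.
by congr integral; apply/funext => u; rewrite mulrCA -mulrDr.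
Qed.

Lemma integral_point b (f : X b -> k) N x s : none_from (color x) N ->
  stab_invariant N f ->
  (forall y, y <> x -> f y = 0) -> integral s f = f x.
Proof.
move=> xN fN f0; rewrite (integral_supp s fN); last first.
  by move=> y yN; apply: f0 => yx; rewrite yx in yN.
have sz : size (word (color x) N) == N by rewrite size_word.
rewrite (bigD1 (Tuple sz)) /= ?full_word_color// word_pt_none_from// big1 ?addr0// =>
  w /andP[bw wx].
rewrite f0// => rx; move/eqP: wx; apply; apply: val_inj => /=.
by rewrite -rx word_ptP ?size_tuple ?full_part_word.
Qed.

Lemma hcomp1l s b d (f : Hom b d) : hcomp s (idmor k (X d)) f = f.
Proof.
apply: hom_eq => y x; have [N [yN xN]] := none_from_pair y x.
rewrite /= /comp_fun (@integral_point _ _ N y)/= ?asboolT ?mul1r//.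
  exact: (hcomp_inv (idmor k (X d)) f yN xN).
by move=> z zy; rewrite asboolF ?mul0r// => /esym.
Qed.

Lemma hcomp1r s b d (f : Hom b d) : hcomp s f (idmor k (X b)) = f.
Proof.
apply: hom_eq => y x; have [N [yN xN]] := none_from_pair y x.
rewrite /= /comp_fun (@integral_point _ _ N x)/= ?asboolT ?mulr1//.
  exact: (hcomp_inv f (idmor k (X b)) yN xN).
by move=> z zy; rewrite asboolF ?mulr0.
Qed.

Definition mkhom b d (f : X d -> X b -> k)
  (fP : forall g y x, f (sact g y) (sact g x) = f y x) : Hom b d :=
  @MkHom _ _ _ (fun yx => f yx.1 yx.2) (asboolT (fun g y x => fP g y x)).

Definition transpose b d (f : Hom b d) : Hom d b :=
  mkhom (f := fun x y => f (y, x)) (fun g x y => homP f g y x).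

Lemma transposeK b d (f : Hom b d) : transpose (transpose f) = f.
Proof. exact: hom_eq. Qed.

Lemma transposeM s b d e (g : Hom d e) (f : Hom b d) :
  transpose (hcomp s g f) = hcomp s (transpose f) (transpose g).
Proof.
apply: hom_eq => z x; rewrite /= /comp_fun /=; congr integral.
by apply/funext => y; rewrite mulrC.
Qed.
End Category.

(** * Orbits of pairs and nondegeneracy *)

Lemma big_option (I : finType) (F : option I -> nat) :
  (\sum_c F c = F None + \sum_i F (Some i))%N.
Proof.
rewrite (bigD1 None)//=; congr addn.
by rewrite (reindex_omap Some id)/=; [apply: eq_bigl => i; rewrite eqxx|case].
Qed.

Lemma count_sum (U V : finType) (s : seq (U * V)) v :
  count_mem v (unzip2 s) = (\sum_(u : U) count_mem (u, v) s)%N.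
Proof.
elim: s => [|[u w] s IH] /=; first by rewrite big1.
rewrite big_split /= -IH; congr addn; rewrite (bigD1 u)//= big1 => [|u' /negPf uu'].
  by rewrite xpair_eqE eqxx addn0.
by rewrite xpair_eqE eq_sym uu'.
Qed.

Lemma count_sum1 (U V : finType) (s : seq (U * V)) u :
  count_mem u (unzip1 s) = (\sum_(v : V) count_mem (u, v) s)%N.
Proof.
elim: s => [|[w v] s IH] /=; first by rewrite big1.
rewrite big_split /= -IH; congr addn; rewrite (bigD1 v)//= big1 => [|v' /negPf vv'].
  by rewrite xpair_eqE eqxx andbT addn0.
by rewrite xpair_eqE [v == v']eq_sym vv' andbF.
Qed.

Lemma count_act (U : eqType) (u0 u : U) (c c' : Omega -> U) (g : Sinf) p q :
  (forall v, (p <= v)%N -> c (omega v) = u0) ->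
    (forall v, (q <= v)%N -> c' (omega v) = u0) ->
  (forall i, c' (g i) = c i) -> u != u0 ->
  count_mem u (word c' q) = count_mem u (word c p).
Proof.
move=> cp cq cc' uu0; rewrite !count_map.
have mem e r : (forall v, (r <= v)%N -> e (omega v) = u0) -> forall i,
    (i \in seq.filter (preim e (pred1 u)) (map omega (iota 0 r))) = (e i == u).
  move=> er; apply: omega_ind => v; rewrite mem_filter (mem_map omega_inj) mem_iota
    add0n /=.
  have [vr|/er ->] := ltnP v r; first by rewrite andbT.
  by rewrite andbF eq_sym (negPf uu0).
have word_count e r : count (preim (fun v => e (omega v)) (pred1 u)) (iota 0 r) =
    size (seq.filter (preim e (pred1 u)) (map omega (iota 0 r))).
  by rewrite size_filter count_map.
rewrite !word_count -[RHS](size_map g); apply/perm_size/uniq_perm.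
- by rewrite filter_uniq// map_inj_uniq ?iota_uniq//; exact: omega_inj.
- rewrite map_inj_uniq; last exact: can_inj (sfunK g).
  by rewrite filter_uniq// map_inj_uniq ?iota_uniq//; exact: omega_inj.
move=> i; rewrite mem//; apply/idP/mapP => [|[j]].
  by exists (sinv g i); rewrite ?mem// ?sinvK// -cc' sinvK.
by rewrite mem// => cj ->; rewrite cc'.
Qed.

Lemma count_mono (U : Type) (P Q : pred U) (s : seq U) :
  (forall x, P x -> Q x) -> (count Q s <= count P s)%N ->
  all (fun x => Q x ==> P x) s.
Proof.
move=> ext_poly; elim: s => //= x s IH.
have PQs : (count P s <= count Q s)%N by apply: sub_count.
case Px : (P x); first by rewrite ext_poly //= !add1n ltnS.
case: (Q x) => /=; last by rewrite !add0n.
by rewrite add1n add0n ltnNge PQs.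
Qed.

Section Overlap.
Context (k : fieldType) (t : k) (n : nat) (n_gt0 : (0 < n)%N).
Local Notation weight := (weight t n).
Local Notation I := 'I_n.-1.
Local Notation T := (option I).
Implicit Types a b c d e : weight.
Local Notation X b := (coset_obj b).

Definition pair_color (c c' : Omega -> T) i := (c i, c' i).

(* [overlap y x (i, j)] counts the points in block [i + 2] of [y] and block [j + 2]
   of [x]; these numbers determine the orbit of [(y, x)]. *)
Definition overlap d b (y : X d) (x : X b) (ij : I * I) : nat :=
  count_mem (Some ij.1, Some ij.2) (word (pair_color (color y) (color x))
    (projT1 (cid (colorP x)))).

Lemma count_pair (c c' : Omega -> T) p q u : u.2 != None -> none_from c' p ->
  none_from c' q ->
  count_mem u (word (pair_color c c') p) = count_mem u (word (pair_color c c') q).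
Proof.
move=> u2; wlog pq : p q / (p <= q)%N.
  by move=> H cp cq; case/orP: (leq_total p q) => /H; [apply|move=> ->].
move=> cp _; rewrite -(subnKC pq) word_cat count_cat -[LHS]addn0; congr addn.
apply/esym/eqP; rewrite -leqn0 leqNgt -has_count -all_predC; apply/allP =>
  _ /mapP[v vi ->].
rewrite /= /pair_color cp; last by move: vi; rewrite mem_iota => /andP[].
by case: u u2 => u1 u2 /=; apply: contra => /eqP[_ <-].
Qed.

Lemma overlapE d b (y : X d) (x : X b) p ij : none_from (color x) p ->
  overlap y x ij = count_mem (Some ij.1, Some ij.2)
    (word (pair_color (color y) (color x)) p).
Proof.
by move=> xp; rewrite /overlap; case: cid => q [xq _] /=; apply: count_pair.
Qed.

Lemma overlap_act d b (y : X d) (x : X b) g : overlap (sact g y) (sact g x) =1 overlap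
  y x.
Proof.
move=> ij; have [p [yp xp]] := none_from_pair y x.
have [q [yq xq]] := none_from_pair (sact g y) (sact g x).
rewrite (overlapE _ _ xp) (overlapE _ _ xq).
apply: (@count_act _ (None, None) _ _ _ g) => [v pv|v qv|i|//].
- by rewrite /pair_color yp// xp.
- by rewrite /pair_color yq// xq.
- by rewrite /pair_color !color_act// sfunK.
Qed.

Lemma unzip1_pair_color (c c' : Omega -> T) p : unzip1 (word (pair_color c c') p) =
  word c p.
Proof. by rewrite /unzip1 -map_comp. Qed.

Lemma unzip2_pair_color (c c' : Omega -> T) p : unzip2 (word (pair_color c c') p) =
  word c' p.
Proof. by rewrite /unzip2 -map_comp. Qed.

Lemma count_None1 d b (y : X d) (x : X b) p i : none_from (color y) p ->
  none_from (color x) p ->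
  (count_mem (Some i, None) (word (pair_color (color y) (color x)) p) +
    \sum_j overlap y x (i, j) = tnth (val d).2 i)%N.
Proof.
move=> yp xp; rewrite -(color_count i yp) -(unzip1_pair_color (color y) (color x))
  count_sum1.
by rewrite big_option; congr addn; apply: eq_bigr => j _; rewrite (overlapE _ _ xp).
Qed.

Lemma count_None2 d b (y : X d) (x : X b) p j : none_from (color y) p ->
  none_from (color x) p ->
  (count_mem (None, Some j) (word (pair_color (color y) (color x)) p) +
    \sum_i overlap y x (i, j) = tnth (val b).2 j)%N.
Proof.
move=> yp xp; rewrite -(color_count j xp) -(unzip2_pair_color (color y) (color x))
  count_sum.
by rewrite big_option; congr addn; apply: eq_bigr => i _; rewrite (overlapE _ _ xp).
Qed.

(** The counts of pairs with one [None] follow from the weights and that of ([None], [None]) from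
    the length, so the words of pairs are rearrangements of each other. *)
Lemma overlap_orbit d b (y y' : X d) (x x' : X b) : overlap y x =1 overlap y' x' ->
  exists g, sact g y = y' /\ sact g x = x'.
Proof.
move=> MM; have [p [yp xp]] := none_from_pair y x; have [q [yq xq]] :=
  none_from_pair y' x'.
pose P := maxn p q.
have [{}yp {}xp] := (none_fromW (leq_maxl p q) yp, none_fromW (leq_maxl p q) xp).
have [{}yq {}xq] := (none_fromW (leq_maxr p q) yq, none_fromW (leq_maxr p q) xq).
set s := word (pair_color (color y) (color x)) P.
set s' := word (pair_color (color y') (color x')) P.
have cS i j : count_mem (Some i, Some j) s = count_mem (Some i, Some j) s'.
  by have := MM (i, j); rewrite (overlapE _ _ xp) (overlapE _ _ xq).
have c1 i : count_mem (Some i, None) s = count_mem (Some i, None) s'.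
  have := count_None1 i yp xp; rewrite -(count_None1 i yq xq).
  by rewrite (eq_bigr _ (fun j _ => MM (i, j))) => /addIn.
have c2 j : count_mem (None, Some j) s = count_mem (None, Some j) s'.
  have := count_None2 j yp xp; rewrite -(count_None2 j yq xq).
  by rewrite (eq_bigr _ (fun i _ => MM (i, j))) => /addIn.
have c0 : count_mem (None, None) s = count_mem (None, None) s'.
  have : size s = size s' by rewrite !size_word.
  rewrite !size_count (bigD1 (None, None))//= [in RHS](bigD1 (None, None))//=.
  rewrite (eq_bigr (fun u => count_mem u s')) => [/addIn//|].
  by case=> -[i|] [j|].
have [| |g [gc _]] := @perm_word _ (pair_color (color y) (color x))
  (pair_color (color y') (color x')) P.
- by move=> v Pv; rewrite /pair_color yp// xp// yq// xq.
- by apply/allP => -[[i|] [j|]] _; apply/eqP.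
exists g; split; apply: (color_inj n_gt0) => i; rewrite color_act// -{2}(sinvK g i).
  by have := gc (sinv g i); rewrite /pair_color => -[<-].
by have := gc (sinv g i); rewrite /pair_color => -[_ <-].
Qed.

Definition overlap_size d b (y : X d) (x : X b) := (\sum_ij overlap y x ij)%N.

Lemma sum_pair (F : I * I -> nat) : (\sum_ij F ij = \sum_i \sum_j F (i, j))%N.
Proof. by rewrite pair_big /=; apply: eq_bigr => -[]. Qed.

Lemma sum_pair2 (F : I * I -> nat) : (\sum_ij F ij = \sum_j \sum_i F (i, j))%N.
Proof. by rewrite sum_pair exchange_big. Qed.

Lemma overlap_leq d b (y : X d) (x : X b) ij : (overlap y x ij <= deg b)%N.
Proof.
case: ij => i j; have [p [yp xp]] := none_from_pair y x.
rewrite /deg (bigD1 j)//= -(count_None2 j yp xp) (bigD1 i)//=.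
by rewrite addnCA -!addnA leq_addr.
Qed.

Lemma overlap_size_leq d b (y : X d) (x : X b) : (overlap_size y x <= deg b)%N.
Proof.
rewrite /overlap_size sum_pair2; apply: leq_sum => j _; have [p [yp xp]] :=
  none_from_pair y x.
by rewrite -(count_None2 j yp xp) leq_addl.
Qed.

Lemma overlap_size_full d b (y : X d) (x : X b) : overlap_size y x = deg b ->
  forall i, color y i = None -> color x i = None.
Proof.
move=> yx; have [p [yp xp]] := none_from_pair y x.
have c0 j : count_mem (None, Some j) (word (pair_color (color y) (color x)) p) = 0%N.
  apply/eqP; suff : (\sum_j count_mem (None, Some j)
      (word (pair_color (color y) (color x)) p) == 0)%N.
    by rewrite sum_nat_eq0 => /forallP/(_ j).
  rewrite -(eqn_add2r (overlap_size y x)) add0n {1}/overlap_size sum_pair2 -big_split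
    /= yx /deg.
  by apply/eqP/eq_bigr => i _; exact: count_None2.
apply: omega_ind => v yv; case xv : (color x (omega v)) => [j|//].
have [pv|vp] := leqP p v; first by move: xv; rewrite xp.
have := c0 j => /eqP; rewrite -leqn0 leqNgt -has_count => /hasPn/(_ (None, Some j)).
rewrite /= eqxx; suff -> : (None, Some j) \in word (pair_color (color y) (color x)) p.
  by move=> /(_ isT).
by apply/mapP; exists v; rewrite ?mem_iota// /pair_color yv xv.
Qed.

Lemma overlap_tr d b (y : X d) (x : X b) i j : overlap y x (i, j) = overlap x y (j, i).
Proof.
have [p [yp xp]] := none_from_pair y x; rewrite (overlapE _ _ xp) (overlapE _ _ yp)
  !count_map.
by apply: eq_count => v /=; rewrite /pair_color !xpair_eqE andbC.
Qed.

Lemma overlap_size_tr d b (y : X d) (x : X b) : overlap_size y x = overlap_size x y.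
Proof.
rewrite /overlap_size sum_pair sum_pair2; apply: eq_bigr => i _; apply: eq_bigr => j _.
exact: overlap_tr.
Qed.

Fact weight_of_subproof (m : I -> nat) :
  is_weight t (t - (\sum_i m i)%:R, [tuple m i | i < n.-1]).
Proof.
apply/andP; split; first by apply/asboolP; exists (\sum_i m i)%N%:Z.
rewrite /= -[Z in _ + Z == _](_ : (\sum_i m i)%:R = _); first by rewrite subrK.
by rewrite natr_sum; apply: eq_bigr => i _; rewrite tnth_mktuple.
Qed.

Definition weight_of (m : I -> nat) : weight :=
  exist (fun u => is_weight t u) _ (weight_of_subproof m).

Lemma weight_ofE m i : tnth (val (weight_of m)).2 i = m i.
Proof. exact: tnth_mktuple. Qed.

Lemma deg_weight_of m : deg (weight_of m) = (\sum_i m i)%N.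
Proof. by apply: eq_bigr => i _; rewrite weight_ofE. Qed.

Lemma weight_eq b d : (forall i, tnth (val b).2 i = tnth (val d).2 i) -> b = d.
Proof.
case: b d => [[b1 b2] hb] [[d1 d2] hd] /= e; apply: val_inj => /=.
have {}e : b2 = d2 by apply: eq_from_tnth.
subst d2; congr pair; move/andP: hb => [_ /eqP/= hb]; move/andP: hd => [_ /eqP/= hd].
by apply: (addIr (\sum_(i < n.-1) (tnth b2 i)%:R)); rewrite hb.
Qed.

Lemma mem_In (U : eqType) (u : U) (s : seq U) : u \in s -> List.In u s.
Proof. by elim: s => //= v s IH; rewrite inE => /predU1P[->|/IH]; [left|right]. Qed.

Lemma fin_deg D : exists s : seq weight, forall a, (deg a < D)%N -> List.In a s.
Proof.
exists [seq weight_of (fun i => (f : {ffun I -> 'I_D}) i) | f <- enum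
  {: {ffun I -> 'I_D}}] => a aD.
have part_lt i : (tnth (val a).2 i < D)%N.
  by apply: leq_ltn_trans aD; rewrite /deg (bigD1 i)//= leq_addr.
apply: mem_In; apply/mapP; exists [ffun i => Ordinal (part_lt i)]; first exact: mem_enum.
by apply: weight_eq => i; rewrite weight_ofE ffunE.
Qed.

Lemma color_full b (x : X b) v : none_from (color x) (deg b) -> (v < deg b)%N ->
  color x (omega v) != None.
Proof.
move=> xb vb; apply/negP => /eqP xv.
have := size_count (word (color x) (deg b)); rewrite size_word big_option.
rewrite (eq_bigr (fun i => tnth (val b).2 i)); last by move=> i _; exact: color_count.
rewrite -/(deg b) -[Z in Z = _]add0n => /addIn /esym/eqP;
  rewrite -leqn0 leqNgt -has_count.
move=> /hasPn/(_ None) h; suff /h : None \in word (color x) (deg b) by [].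
by apply/mapP; exists v; rewrite ?mem_iota.
Qed.

Lemma color_coset_pt1 b i : color (coset_pt b 1%g) i = base_color b i.
Proof. by rewrite color_coset_pt. Qed.

Lemma none_from_pt1 b : none_from (color (coset_pt b 1%g)) (deg b).
Proof. by move=> v bv; rewrite color_coset_pt1 cst_big. Qed.

Lemma act_coset_repV b (x : X b) : sact (coset_rep x)^-1%g x = coset_pt b 1%g.
Proof. by rewrite -{2}[x]coset_ptK act_coset_pt mulVg. Qed.

Local Notation Hom b d := (Defs.hom k (X b) (X d)).

Definition overlap_hom d b (m : I * I -> nat) : Hom b d :=
  mkhom (f := fun y x => [forall ij, overlap y x ij == m ij]%:R)
    (fun g y x => congr1 (fun c : bool => c%:R)
       (eq_forallb (fun ij => congr1 (fun u => u == m ij) (overlap_act y x g ij)))).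

Lemma overlap_homE d b m (y : X d) (x : X b) :
  overlap_hom d b m (y, x) = [forall ij, overlap y x ij == m ij]%:R.
Proof. by []. Qed.

Context (char0 : [pchar k] =i pred0).

(* If f is the indicator of the transposed orbit of (y1, x1), then the (x1, x1)
   entry of f g is g (y1, x1) times a positive multiple of a product of factors
   t - j with j a natural number. *)
Lemma hom_nondegenerate a b (g : Hom a b) : n = 1%N \/ ~ (exists m, t = m%:R) ->
  (forall f : Hom b a, hcomp t f g = 0) -> g = 0.
Proof.
move=> nt fg; apply: hom_eq => y0 x0; apply: contrapT => /eqP gyx.
set h := ((coset_rep x0)^-1)%g; pose x1 := coset_pt a 1%g; pose y1 := sact h y0.
have hx : sact h x0 = x1 by exact: act_coset_repV.
have {gyx} g1 : g (y1, x1) != 0 by rewrite -hx homP.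
set N := deg a; have xN : none_from (color x1) N by exact: none_from_pt1.
have := fg (transpose (overlap_hom b a (overlap y1 x1))) =>
  /(congr1 (fun f : Hom a a => f (x1, x1))).
rewrite /= /comp_fun /=.
rewrite (@integralE _ _ _ n_gt0 char0 _ N); last first.
  exact: (hcomp_inv n_gt0 (transpose (overlap_hom b a (overlap y1 x1))) g xN xN).
(* The base point x1 colors all of [1, N], so for y paired with x1 in the same orbit the letters of
   y in [1, N] are counted by the overlaps, and exactly r i letters i lie beyond N. *)
pose r i := (tnth (val b).2 i - \sum_j overlap y1 x1 (i, j))%N.
pose q := ((\prod_i (r i)`!)%N%:R)^-1 * \prod_(j < \sum_i r i) (t - (N + j)%N%:R).
have q0 : q != 0.
  (* Factorials are nonzero in characteristic zero. A factor t - (N + j) vanishes only for a natural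
     t, and for n = 1 the product is empty. *)
  rewrite mulf_neq0 ?invr_neq0//.
    move/pcharf0P: char0 => ->; rewrite -lt0n prodn_gt0// => i; exact: fact_gt0.
  apply/prodf_neq0 => j _; rewrite subr_eq0; apply/eqP => tN.
  case: nt => [n1|[]]; last by exists (N + j)%N.
  case: j tN => j; rewrite big1 // => i _.
  by case: i => i ii; exfalso; move: (ii); rewrite n1.
pose C (w : seq T) := part_word b w && [forall ij,
  overlap (word_pt b N w) x1 ij == overlap y1 x1 ij].
have remr w : size w = N -> C w -> missing b w =1 r.
  move=> sw /andP[lw /forallP Mw] i; rewrite /missing /r; congr subn.
  rewrite -{1}(word_ptP n_gt0 sw lw) -(unzip1_pair_color _ (color x1)) count_sum1
    big_option.
  rewrite (_ : count_mem _ _ = 0%N) ?add0n.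
    by apply: eq_bigr => j _; rewrite -(eqP (Mw _)) (overlapE _ _ xN).
  apply/eqP; rewrite -leqn0 leqNgt -has_count -all_predC; apply/allP => _ /mapP[v vi ->].
  move: vi; rewrite mem_iota add0n /= => vN; have := color_full xN vN.
  by apply: contra => /eqP[_ ->].
rewrite (eq_bigr (fun w : N.-tuple T => (C w)%:R * (g (y1, x1) * q))); last first.
  move=> w _; rewrite /C; have [lw|lw] := boolP (part_word b w);
    last by rewrite ext_num0// mulr0 mul0r.
  case: (boolP [forall ij, _]) => Mw /=; last by rewrite !mul0r.
  rewrite !mul1r; congr (_ * _).
    have [|g' [<- {2}<-]] := @overlap_orbit b a (word_pt b N w) y1 x1 x1;
      last by rewrite homP.
    by move=> ij; apply/eqP/(forallP Mw).
  have rr : missing b w =1 r by apply: remr; rewrite ?size_tuple// /C lw.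
  by rewrite ext_numE// /q (eq_bigr _ (fun i _ => rr i))
    (eq_bigr _ (fun i _ => congr1 factorial (rr i))).
clearbody q; rewrite -mulr_suml -natr_sum => /eqP;
  rewrite !mulf_eq0 (negPf g1) (negPf q0) !orbF.
(* The remaining factor is the number of words satisfying [C], and the word of y1 is one of them. *)
move/pcharf0P: char0 => ->; apply/negP; rewrite -lt0n.
have sz : size (word (color y1) N) == N by rewrite size_word.
rewrite (bigD1 (Tuple sz))//= {1}/C part_word_color//=.
suff -> : [forall ij, overlap (word_pt b N (word (color y1) N)) x1 ij == overlap y1 x1
  ij] by [].
have [g' g'N e] := stab_trans n_gt0 (word_pt_word n_gt0 y1 N).
apply/forallP => ij; rewrite eq_sym -{1}e -{1}(stab_none_from n_gt0 xN g'N).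
by rewrite overlap_act.
Qed.

(** * Orbit indicators as coordinates on morphisms *)

Lemma hom_sumE b d (J : Type) (r : seq J) (P : pred J) (F : J -> Hom b d) yx :
  (\sum_(j <- r | P j) F j) yx = \sum_(j <- r | P j) F j yx.
Proof. exact: (big_morph (fun f : Hom b d => f yx)). Qed.

Definition overlap_coef b d (m : I * I -> nat) (f : Hom b d) : k :=
  if pselect (exists yx : X d * X b, overlap yx.1 yx.2 =1 m) is left h
  then f (projT1 (cid h)) else 0.

Lemma overlap_coefE b d m (f : Hom b d) y x : overlap y x =1 m ->
  overlap_coef m f = f (y, x).
Proof.
move=> Mm; rewrite /overlap_coef; case: pselect => [h|[]]; last by exists (y, x).
case: cid => -[y' x'] /= M'm.
have [|g [<- <-]] := @overlap_orbit d b y' y x' x; last by rewrite homP.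
by move=> ij; rewrite M'm Mm.
Qed.

Lemma overlap_coefP b d m (u : k) (f g : Hom b d) :
  overlap_coef m (u *: f + g) = u * overlap_coef m f + overlap_coef m g.
Proof. by rewrite /overlap_coef; case: pselect => // _; rewrite mulr0 addr0. Qed.

(** Overlaps never exceed [deg b], so a finite type indexes the orbits of pairs; some indices may
    correspond to no orbit. *)
Definition overlap_ffun d b (y : X d) (x : X b) : {ffun I * I -> 'I_(deg b).+1} :=
  [ffun ij => inord (overlap y x ij)].

Lemma overlap_ffunE d b (y : X d) (x : X b) ij : overlap_ffun y x ij = overlap y x ij
  :> nat.
Proof. by rewrite ffunE inordK// ltnS overlap_leq. Qed.

Lemma overlap_ffunP d b (y : X d) (x : X b) (m : {ffun I * I -> 'I_(deg b).+1}) :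
  [forall ij, overlap y x ij == m ij] = (m == overlap_ffun y x).
Proof.
apply/forallP/eqP => [Mm|-> ij]; last by rewrite overlap_ffunE.
by apply/ffunP => ij; apply: val_inj; rewrite /= overlap_ffunE -(eqP (Mm ij)).
Qed.

Definition ffun_nat b (m : {ffun I * I -> 'I_(deg b).+1}) (ij : I * I) : nat := m ij.

Lemma overlap_hom_ffunE b d (y : X d) (x : X b) m :
  overlap_hom d b (ffun_nat m) (y, x) = (m == overlap_ffun y x)%:R.
Proof. by rewrite overlap_homE overlap_ffunP. Qed.

Lemma hom_coord b d (f : Hom b d) : f =
  \sum_(m : {ffun I * I -> 'I_(deg b).+1}) overlap_coef (ffun_nat m) f *: overlap_hom d
    b (ffun_nat m).
Proof.
apply: hom_eq => y x; rewrite hom_sumE (bigD1 (overlap_ffun y x))//= big1 ?addr0 =>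
  [|m mM].
  transitivity (overlap_coef (ffun_nat (overlap_ffun y x)) f * overlap_hom d b
    (ffun_nat (overlap_ffun y x)) (y, x)) => //.
  rewrite overlap_hom_ffunE eqxx mulr1 (@overlap_coefE _ _ _ _ y x)// => ij.
  by rewrite /ffun_nat overlap_ffunE.
transitivity (overlap_coef (ffun_nat m) f * overlap_hom d b (ffun_nat m) (y, x)) => //.
by rewrite overlap_hom_ffunE (negPf mM) mulr0.
Qed.
End Overlap.

(** * Reduction modulo lower degrees *)

Lemma eq_of_sum (J : finType) (f g : J -> nat) :
  (forall i, f i <= g i)%N -> (\sum_i g i <= \sum_i f i)%N -> f =1 g.
Proof.
move=> fg gf i; apply/eqP; rewrite eqn_leq fg /=.
move: gf; rewrite (bigD1 i)//= [X in (_ <= X)%N](bigD1 i)//= => gf.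
have le' : (\sum_(j | j != i) f j <= \sum_(j | j != i) g j)%N by exact: leq_sum.
by rewrite -(leq_add2r (\sum_(j | j != i) g j)) (leq_trans gf)// leq_add2l.
Qed.

Section Reduction.
Context (k : fieldType) (char0 : [pchar k] =i pred0) (t : k) (n : nat)
  (n_gt0 : (0 < n)%N).
Local Notation weight := (weight t n).
Local Notation I := 'I_n.-1.
Local Notation T := (option I).
Implicit Types b d e : weight.
Local Notation X b := (coset_obj b).
Local Notation Hom b d := (Defs.hom k (X b) (X d)).

Definition subcolor d b (z : X d) (x : X b) : Prop :=
  forall i, color z i <> None -> color x i = color z i.

Lemma subcolor_act d b g (z : X d) (x : X b) :
  `[< subcolor (sact g z) (sact g x) >] = `[< subcolor z x >].
Proof.
apply: asbool_equiv_eq; split=> zx i.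
  by have := zx (g i); rewrite !color_act// sfunK.
by rewrite !color_act//; exact: zx.
Qed.

Definition restr_hom b d : Hom b d := mkhom (f := fun z x => `[< subcolor z x >]%:R)
  (fun g z x => congr1 (fun c : bool => c%:R) (subcolor_act g z x)).

Definition meet_color d b (y : X d) (x : X b) i : T :=
  if color y i is Some _ then color x i else None.

(** An equality case. Every colored point of z is colored in y, and z is a restriction of x, so the
    overlaps of y with z are at most those with x. The bound on [overlap_size] forces equality, and
    z is all of x over the colored points of y. *)
Lemma subcolor_meet b d (c : weight) (m : I * I -> nat) (y : X d) (z : X c) (x : X b) :
  deg c = (\sum_ij m ij)%N -> (overlap_size y x <= \sum_ij m ij)%N ->
  overlap y z =1 m -> subcolor z x -> overlap y x =1 m /\ forall i,
    color z i = meet_color y x i.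
Proof.
move=> cm yx Mz zx.
have yz : overlap_size y z = deg c by rewrite cm; apply: eq_bigr => ij _.
have yz0 := overlap_size_full yz.
have [p [yp xp]] := none_from_pair y x.
have zp : none_from (color z) p by move=> v pv; apply: yz0; rewrite yp.
have le_c ij : (count_mem (Some ij.1, Some ij.2)
  (word (pair_color (color y) (color z)) p) <=
    count_mem (Some ij.1, Some ij.2) (word (pair_color (color y) (color x)) p))%N.
  rewrite !count_map; apply: sub_count => v /= /eqP[yv zv].
  by rewrite /pair_color zx zv// yv.
have Mx : overlap y z =1 overlap y x.
  apply: eq_of_sum => [ij|]; first by rewrite (overlapE _ _ xp) (overlapE _ _ zp).
  by rewrite -/(overlap_size y z) yz cm.
split=> [ij|]; first by rewrite -Mx Mz.
apply: omega_ind => v; rewrite /meet_color.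
case yv : (color y (omega v)) => [i|]; last exact: yz0.
have [pv|vp] := leqP p v; first by rewrite zp// xp.
case xv : (color x (omega v)) => [j|]; last first.
  by case zv : (color z (omega v)) => [j|//]; rewrite -zv -zx ?zv// xv.
pose Pz u := pair_color (color y) (color z) (omega u) == (Some i, Some j).
pose Px u := pair_color (color y) (color x) (omega u) == (Some i, Some j).
have zxP u : Pz u -> Px u by move=> /eqP[yu zu]; rewrite /Px /pair_color zx zu// yu.
have cP : (count Px (iota 0 p) <= count Pz (iota 0 p))%N.
  by have := Mx (i, j); rewrite (overlapE _ _ xp) (overlapE _ _ zp) !count_map => ->.
have /allP/(_ v) := count_mono zxP cP.
rewrite mem_iota /= => /(_ vp)/implyP; rewrite /Px /Pz.
by rewrite /pair_color yv xv eqxx => /(_ isT) /eqP[].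
Qed.

Lemma overlap_meet d b (c : weight) (y : X d) (z : X c) (x : X b) :
  (forall i, color z i = meet_color y x i) -> overlap y z =1 overlap y x.
Proof.
move=> zE [i j]; have [p [yp xp]] := none_from_pair y x.
have zp : none_from (color z) p by move=> v pv; rewrite zE /meet_color yp.
rewrite (overlapE _ _ xp) (overlapE _ _ zp) !count_map; apply: eq_count => v /=.
by rewrite /pair_color zE /meet_color; case: (color y (omega v)).
Qed.

(** The weight of the coloring [meet_color y x] when m is the overlap of y and x. *)
Definition meet_weight (m : I * I -> nat) : weight :=
  weight_of t (fun j => (\sum_i m (i, j))%N).

Lemma deg_meet_weight m : deg (meet_weight m) = (\sum_ij m ij)%N.
Proof. by rewrite deg_weight_of sum_pair2. Qed.

Lemma meet_ex d b (y : X d) (x : X b) m : overlap y x =1 m ->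
  exists z : X (meet_weight m), forall i, color z i = meet_color y x i.
Proof.
move=> Mm; have [p [yp xp]] := none_from_pair y x.
apply: (@color_ex _ _ _ n_gt0 _ _ p) => [v pv|j]; first by rewrite /meet_color yp.
rewrite weight_ofE -(eq_bigr _ (fun i _ => Mm (i, j))).
rewrite (_ : word _ _ = unzip2 (word (pair_color (color y) (meet_color y x)) p));
  last first.
  by rewrite unzip2_pair_color.
rewrite count_sum big_option (_ : count_mem _ _ = 0%N) ?add0n; last first.
  apply/eqP; rewrite -leqn0 leqNgt -has_count -all_predC; apply/allP => _ /mapP[v _ ->].
  by rewrite /= /pair_color /meet_color; case: (color y (omega v)).
apply: eq_bigr => i _; rewrite (overlapE _ _ xp) !count_map; apply: eq_count => v /=.
by rewrite /pair_color /meet_color; case: (color y (omega v)).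
Qed.

(* Among the pairs with at most \sum m common points of the finite blocks, the
   composite through X^(meet_weight m) is the indicator of a single orbit. *)
Lemma restr_homE b d (m : I * I -> nat) (y : X d) (x : X b) :
  (overlap_size y x <= \sum_ij m ij)%N ->
  hcomp t (overlap_hom n_gt0 d (meet_weight m) m) (restr_hom b (meet_weight m)) (y, x)
    = [forall ij, overlap y x ij == m ij]%:R.
Proof.
move=> yx; have [p [yp xp]] := none_from_pair y x; rewrite /= /comp_fun /=.
have nz (z : X (meet_weight m)) :
    [forall ij, overlap y z ij == m ij]%:R * `[< subcolor z x >]%:R != 0 :> k ->
    overlap y x =1 m /\ forall i, color z i = meet_color y x i.
  case: (boolP [forall ij, _]) => [/forallP Mz|]; last by rewrite mul0r eqxx.
  case: (boolP `[< _ >]) => [/asboolP zx _|]; last by rewrite mulr0 eqxx.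
  by apply: subcolor_meet yx _ zx => [|ij]; [rewrite deg_meet_weight|apply/eqP].
have [/forallP Mx|Mx] := boolP [forall ij, overlap y x ij == m ij].
  have [z0 z0E] := meet_ex (fun ij => eqP (Mx ij)).
  rewrite (@integral_point _ char0 _ _ n_gt0 _ _ p z0).
  - rewrite asboolT ?mulr1; last first.
      by move=> i; rewrite z0E /meet_color; case: (color y i).
    rewrite (_ : [forall ij, _]) //; apply/forallP => ij.
    by rewrite (overlap_meet z0E).
  - by move=> v pv; rewrite z0E /meet_color yp.
  - exact: (hcomp_inv n_gt0 (overlap_hom n_gt0 d (meet_weight m) m)
    (restr_hom b (meet_weight m)) yp xp).
  move=> z zz0; apply: contrapT => /eqP/nz[_ zE]; apply: zz0.
  by apply: (color_inj n_gt0) => i; rewrite zE z0E.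
have z0 (z : X (meet_weight m)) : [forall ij, overlap y z ij == m ij]%:R *
  `[< subcolor z x >]%:R = 0 :> k.
  apply: contrapT => /eqP/nz[Mm _]; case/negP: Mx; apply/forallP => ij.
  by rewrite Mm.
rewrite (@integral_supp _ char0 _ _ n_gt0 _ p) => [|g gp z|z _]; rewrite ?z0//.
by rewrite big1.
Qed.

Definition hom_lmod b d : lmodType k := Hom b d.
Definition low_hom D b d (f : Hom b d) :=
  @low k weight hom_lmod (fun a b c => @hcomp k t (X a) (X b) (X c)) (@deg k t n) D b d f.

Lemma low_homZ D b d u (f : Hom b d) : low_hom D f -> low_hom D (u *: f).
Proof.
elim=> [|f' g' _ IH1 _ IH2|c g f' cD]; first by rewrite scaler0; constructor.
  by rewrite scalerDr; constructor.
have -> : u *: hcomp t g f' = hcomp t (u *: g) f'; last exact: low_comp.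
by have := hcomp_Pl char0 n_gt0 t u g 0 f'; rewrite addr0 comp0l addr0 => <-.
Qed.

Lemma low_hom_sum D b d (J : Type) (r : seq J) (P : pred J) (F : J -> Hom b d) :
  (forall j, P j -> low_hom D (F j)) -> low_hom D (\sum_(j <- r | P j) F j).
Proof.
move=> PF; apply: (big_ind (fun f : Hom b d => low_hom D f)) => //.
  exact: low0.
by move=> f g; exact: lowD.
Qed.

(** Clears the values on pairs of overlap 0, 1, 2 and so on. The composites of [restr_homE] with
    total overlap j factor through degree j < D; on pairs of overlap at most j they are orbit
    indicators, so the values already cleared stay zero. *)
Lemma low_level b d D (f : Hom b d) j : (j <= D)%N ->
  exists f' : Hom b d, low_hom D (f - f') /\ forall y x, (overlap_size y x < j)%N ->
    f' (y, x) = 0.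
Proof.
elim: j => [_|j IH jD]; first by exists f; split=> //; rewrite subrr; exact: low0.
have [f' [ff' f'0]] := IH (ltnW jD).
pose G (m : {ffun I * I -> 'I_(deg b).+1}) : Hom b d :=
  overlap_coef (ffun_nat m) f' *: hcomp t
    (overlap_hom n_gt0 d (meet_weight (ffun_nat m)) (ffun_nat m))
      (restr_hom b (meet_weight (ffun_nat m))).
pose P (m : {ffun I * I -> 'I_(deg b).+1}) := (\sum_ij ffun_nat m ij == j)%N.
exists (f' - \sum_(m | P m) G m); split.
  have -> : f - (f' - \sum_(m | P m) G m) = (f - f') + \sum_(m | P m) G m.
    by rewrite opprB addrA addrAC.
  apply: lowD => //; apply: low_hom_sum => m /eqP mj; apply: low_homZ.
  by apply: low_comp; rewrite deg_meet_weight mj.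
move=> y x; rewrite ltnS => yxj.
have -> : (f' - \sum_(m | P m) G m) (y, x) =
    f' (y, x) - \sum_(m | P m) overlap_coef (ffun_nat m) f' * (m == overlap_ffun y x)%:R.
  transitivity (f' (y, x) - (\sum_(m | P m) G m) (y, x)) => //; congr (_ - _).
  rewrite hom_sumE; apply: eq_bigr => m /eqP mj.
  transitivity (overlap_coef (ffun_nat m) f' * hcomp t
    (overlap_hom n_gt0 d (meet_weight (ffun_nat m)) (ffun_nat m))
     (restr_hom b (meet_weight (ffun_nat m))) (y, x)) => //.
  by rewrite restr_homE ?mj// overlap_ffunP.
have ME' : overlap y x =1 ffun_nat (overlap_ffun y x) by move=> ij;
  rewrite /ffun_nat overlap_ffunE.
have PMf : P (overlap_ffun y x) = (overlap_size y x == j).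
  by rewrite /P /overlap_size; congr (_ == _); apply: eq_bigr => ij _; rewrite ME'.
move: yxj; rewrite leq_eqVlt => /predU1P[yxj|yxj].
  rewrite (bigD1 (overlap_ffun y x)) ?PMf ?yxj//= big1 => [|m /andP[_ /negPf ->]];
    last by rewrite mulr0.
  by rewrite eqxx mulr1 addr0 (overlap_coefE n_gt0 f' ME') subrr.
rewrite f'0// big1 ?subr0// => m Pm; case: eqVneq => [mE|]; last by rewrite mulr0.
by move: Pm; rewrite mE PMf (ltn_eqF yxj).
Qed.
End Reduction.

(** * Morphisms between points of equal support *)

Lemma quasi_inverse (k : fieldType) (U : finType) (A : U -> U -> k) :
  exists Q : U -> U -> k, forall u v,
    \sum_u' \sum_v' A u u' * Q u' v' * A v' v = A u v.
Proof.
pose MA : 'M[k]_(#|U|) := \matrix_(i, j) A (enum_val i) (enum_val j).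
have MAE u v : MA (enum_rank u) (enum_rank v) = A u v by rewrite mxE !enum_rankK.
exists (fun u v => pinvmx MA (enum_rank u) (enum_rank v)) => u v.
rewrite -[RHS]MAE -[in RHS](mulmxKpV (submx_refl MA)) mxE.
rewrite exchange_big (reindex (@enum_val U U)) /=; last exact/onW_bij/enum_val_bij.
apply: eq_bigr => j _; rewrite mxE (reindex (@enum_val U U)) /=;
  last exact/onW_bij/enum_val_bij.
rewrite mulr_suml; apply: eq_bigr => i _.
by rewrite -2!MAE !enum_valK.
Qed.

(* Maschke: averaging a generalized inverse over the group makes it equivariant. *)
Lemma equivariant_inverse (k : fieldType) (char0 : [pchar k] =i pred0) (U : finType)
    (G : finGroupType) (ac : G -> U -> U)
      (acM : forall r s u, ac (r * s)%g u = ac s (ac r u))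
    (ac1 : forall u, ac 1%g u = u) (A : U -> U -> k)
    (Ainv : forall s u v, A (ac s u) (ac s v) = A u v) :
  exists Q : U -> U -> k, (forall s u v, Q (ac s u) (ac s v) = Q u v) /\
    forall u v, \sum_u' \sum_v' A u u' * Q u' v' * A v' v = A u v.
Proof.
have [Q QA] := quasi_inverse A.
have G0 : #|G|%:R != 0 :> k.
  move/pcharf0P: char0 => ->; rewrite -lt0n; apply/card_gt0P; exists 1%g.
  by [].
have ac_inj s : injective (ac s).
  by apply: (can_inj (g := ac s^-1%g)) => u; rewrite -acM mulgV ac1.
exists (fun u v => #|G|%:R^-1 * \sum_(s : G) Q (ac s u) (ac s v)); split=> [r u v|u v].
  congr (_ * _); rewrite [RHS](reindex_inj (mulgI r)) /=.
  by apply: eq_bigr => s _; rewrite !acM.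
under eq_bigr => u' _ do under eq_bigr => v' _ do
  rewrite mulrCA -mulrA mulr_sumr mulr_suml.
under eq_bigr => u' _ do rewrite -mulr_sumr exchange_big.
rewrite -mulr_sumr exchange_big /=.
rewrite (eq_bigr (fun=> A u v)) => [|s _].
  by rewrite sumr_const -[A u v *+ _]mulr_natl mulKf.
rewrite -(Ainv s) -[RHS]QA [RHS](reindex_inj (ac_inj s)); apply: eq_bigr => u' _.
by rewrite [RHS](reindex_inj (ac_inj s)); apply: eq_bigr => v' _; rewrite !Ainv.
Qed.

Section EqualSupport.
Context (k : fieldType) (char0 : [pchar k] =i pred0) (t : k) (n : nat)
  (n_gt0 : (0 < n)%N).
Local Notation weight := (weight t n).
Local Notation I := 'I_n.-1.
Local Notation T := (option I).
Implicit Types b d e : weight.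
Local Notation X b := (coset_obj b).
Local Notation Hom b d := (Defs.hom k (X b) (X d)).

Definition word_tuple D b (x : X b) : D.-tuple T := [tuple color x (omega i) | i < D].

Lemma word_tupleE D b (x : X b) : word_tuple D x = word (color x) D :> seq T.
Proof.
apply: (@eq_from_nth _ None) => [|v]; rewrite size_tuple ?size_word// => vD.
rewrite nth_word// -[v]/(nat_of_ord (Ordinal vD)) -tnth_nth tnth_mktuple.
by [].
Qed.

Definition tuple_perm D (s : 'S_D) (u : D.-tuple T) : D.-tuple T :=
  [tuple tnth u (s^-1%g i) | i < D].

Lemma tuple_permM D (r s : 'S_D) u : tuple_perm (r * s)%g u = tuple_perm s
  (tuple_perm r u).
Proof. by apply: eq_from_tnth => i; rewrite !tnth_mktuple invMg permM. Qed.

Lemma tuple_perm1 D (u : D.-tuple T) : tuple_perm 1%g u = u.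
Proof. by apply: eq_from_tnth => i; rewrite tnth_mktuple invg1 perm1. Qed.

Lemma word_tuple_act D b (x : X b) (h : Sinf) (s : 'S_D) :
  (forall o : 'I_D, h (omega o) = omega (s o)) ->
    word_tuple D (sact h x) = tuple_perm s (word_tuple D x).
Proof.
move=> hs; apply: eq_from_tnth => i; rewrite !tnth_mktuple color_act//; congr color.
by rewrite -{1}(permKV s i) -hs sfunK.
Qed.

Lemma perm_of_sinf D (h : Sinf) : (forall i, (val (h i) <= D)%N = (val i <= D)%N) ->
  exists s : 'S_D, forall o : 'I_D, h (omega o) = omega (s o).
Proof.
move=> hD; have hlt (o : 'I_D) : ((val (h (omega o))).-1 < D)%N.
  have := hD (omega o); rewrite [RHS]/= ltn_ord; case: (h (omega o)) => -[|v] //=.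
have f_inj : injective (fun o : 'I_D => Ordinal (hlt o)).
  move=> o o' /(congr1 val)/= e; apply: val_inj; apply: omega_inj.
  by apply: (can_inj (sfunK h)); rewrite -[LHS]omegaE e omegaE.
by exists (perm f_inj) => o; rewrite permE /= omegaE.
Qed.

Lemma color_None D b (x : X b) i : none_from (color x) D -> deg b = D ->
  (val i <= D)%N = (color x i != None).
Proof.
move=> xD bD; move: i; apply: omega_ind => v /=.
have [vD|Dv] := ltnP v D; first by rewrite color_full// bD.
by rewrite xD.
Qed.

Lemma act_preserves D b (x : X b) (h : Sinf) : none_from (color x) D -> deg b = D ->
  none_from (color (sact h x)) D -> forall i, (val (h i) <= D)%N = (val i <= D)%N.
Proof.
move=> xD bD hxD i; rewrite (color_None _ hxD)// (color_None _ xD)// color_act//.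
by rewrite sfunK.
Qed.

Definition same_supp d b (y : X d) (x : X b) : Prop :=
  forall i, (color y i == None) = (color x i == None).

Lemma same_supp_act d b g (y : X d) (x : X b) :
  same_supp (sact g y) (sact g x) <-> same_supp y x.
Proof.
split=> h i; last by rewrite !color_act.
by have := h (g i); rewrite !color_act// sfunK.
Qed.

Lemma same_supp_none_from d b (y : X d) (x : X b) p :
  same_supp y x -> none_from (color y) p -> none_from (color x) p.
Proof. by move=> yx yp v pv; apply/eqP; rewrite -yx yp. Qed.

Lemma none_from_same_supp D d b (y : X d) (x : X b) : deg d = D -> deg b = D ->
  none_from (color y) D -> none_from (color x) D -> same_supp y x.
Proof.
move=> dD bD yD xD i; apply: negb_inj.
by rewrite -(color_None _ yD)// -(color_None _ xD).
Qed.

Lemma overlap_size_same_supp d b (y : X d) (x : X b) : deg b = deg d ->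
  overlap_size y x = deg b -> same_supp y x.
Proof.
move=> bd yx i; apply/eqP/eqP; first exact: overlap_size_full.
by apply: overlap_size_full; rewrite overlap_size_tr yx.
Qed.

Section Inverse.
Context (D : nat) (b d : weight) (bD : deg b = D) (dD : deg d = D).
Context (K : D.-tuple T -> D.-tuple T -> k)
  (Kinv : forall s u v, K (tuple_perm s u) (tuple_perm s v) = K u v).

(** The matrix [K] only sees colorings supported in [1, D]. A pair with another common support is
    first moved there by a representative of x, whose choice is immaterial by the invariance of
    [K]. *)
Definition supp_fun (x : X b) (y : X d) : k := if `[< same_supp x y >] then
  K (word_tuple D (sact (coset_rep x)^-1%g x))
    (word_tuple D (sact (coset_rep x)^-1%g y)) else 0.

Lemma K_act (h : Sinf) (x : X b) (y : X d) :
  (forall i, (val (h i) <= D)%N = (val i <= D)%N) ->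
  K (word_tuple D (sact h x)) (word_tuple D (sact h y)) = K (word_tuple D x)
    (word_tuple D y).
Proof.
by move=> /perm_of_sinf[s hs]; rewrite !(word_tuple_act _ hs) Kinv.
Qed.

Lemma supp_fun_act g x y : supp_fun (sact g x) (sact g y) = supp_fun x y.
Proof.
rewrite /supp_fun (asbool_equiv_eq (same_supp_act g x y)); case: ifP => // _.
set h := ((coset_rep x)^-1)%g; set h' := ((coset_rep (sact g x))^-1)%g; pose e :=
  (h' * g * h^-1)%g.
have ptD : none_from (color (coset_pt b 1%g)) D by rewrite -bD; exact: none_from_pt1.
have eE (c : weight) (z : X c) : sact h' (sact g z) = sact e (sact h z).
  by rewrite -!actM /e mulgVK.
rewrite !eE K_act//; apply: (act_preserves (x := coset_pt b 1%g)) => //.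
by rewrite -(act_coset_repV x) -/h -eE act_coset_repV.
Qed.

Definition supp_hom : Hom d b := mkhom supp_fun_act.

Lemma supp_homE x y : none_from (color x) D -> none_from (color y) D ->
  supp_hom (x, y) = K (word_tuple D x) (word_tuple D y).
Proof.
move=> xD yD; rewrite /= /supp_fun asboolT; last exact: none_from_same_supp yD.
rewrite K_act//; apply: (act_preserves xD) => //.
by rewrite act_coset_repV -bD; exact: none_from_pt1.
Qed.

Lemma supp_hom0 x y : ~ same_supp x y -> supp_hom (x, y) = 0.
Proof. by move=> xy; rewrite /= /supp_fun asboolF. Qed.
End Inverse.

Lemma hcomp_supp (b d e : weight) D (g : Hom d e) (f : Hom b d) z x :
  none_from (color z) D -> none_from (color x) D ->
  (forall y, g (z, y) * f (y, x) != 0 -> none_from (color y) D) ->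
  hcomp t g f (z, x) = \sum_(w : D.-tuple T | full_word d w) g (z, word_pt d D w) * f
    (word_pt d D w, x).
Proof.
move=> zD xD gf; apply: (integral_supp char0 n_gt0 t (hcomp_inv n_gt0 g f zD xD)).
by move=> y yD; apply: contrapT => /eqP/gf.
Qed.

Lemma hcomp_supp0 (b d e : weight) (g : Hom d e) (f : Hom b d) z x :
  (forall y, g (z, y) * f (y, x) = 0) -> hcomp t g f (z, x) = 0.
Proof.
move=> gf; have [N [zN xN]] := none_from_pair z x.
rewrite (hcomp_supp zN xN) => [|y]; last by rewrite gf eqxx.
by rewrite big1.
Qed.

(** Morphisms that live on pairs of equal support compose within one D-element set at a time. The
    integrals are then finite sums free of t, and c amounts to an S_D-invariant matrix, to which
    [equivariant_inverse] applies. *)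
Lemma same_supp_regular (b d : weight) (c : Hom b d) : deg b = deg d ->
  (forall y x, ~ same_supp y x -> c (y, x) = 0) ->
  exists c' : Hom d b, hcomp t (hcomp t c c') c = c.
Proof.
move=> bd c0; set D := deg b in bd.
pose A (u v : D.-tuple T) : k :=
  if full_word d u && full_word b v then c (word_pt d D u, word_pt b D v) else 0.
have full_word_tuple_perm (e : weight) s (u : D.-tuple T) : full_word e
  (tuple_perm s u) = full_word e u.
  apply: eq_forallb => i; congr (_ == _); apply/seq.permP.
  apply/tuple_permP; exists s^-1%g.
  by congr val; apply: eq_from_tnth => j; rewrite !tnth_mktuple.
have word_pt_tuple_perm (e : weight) s (u : D.-tuple T) : full_word e u ->
    word_pt e D (tuple_perm s u) = sact (sinf_of_perm s) (word_pt e D u).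
  move=> eu; have e1 : word_tuple D (word_pt e D u) = u.
    by apply: val_inj; rewrite /= word_tupleE word_ptP ?size_tuple ?full_part_word.
  have -> : tuple_perm s u = word_tuple D (sact (sinf_of_perm s) (word_pt e D u)).
    by rewrite -{1}e1; apply/esym/word_tuple_act => o; exact: perm_ext_omega.
  rewrite word_tupleE word_pt_none_from//; apply: (full_word_none_from (b := e));
    rewrite -word_tupleE.
  rewrite (_ : word_tuple _ _ = tuple_perm s u) ?full_word_tuple_perm//.
  by rewrite -{2}e1; apply/word_tuple_act => o; exact: perm_ext_omega.
have [s u v|K [Kinv KA]] := equivariant_inverse char0 (@tuple_permM D) (@tuple_perm1 D)
  (A := A).
  by rewrite /A !full_word_tuple_perm; case: ifP => // /andP[du bv];
    rewrite !word_pt_tuple_perm// homP.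
exists (supp_hom d (erefl D : deg b = D) Kinv).
set c' := supp_hom _ _ _.
have AE y x : none_from (color y) D -> none_from (color x) D ->
  c (y, x) = A (word_tuple D y) (word_tuple D x).
  by move=> yD xD; rewrite /A !word_tupleE !full_word_color// !word_pt_none_from.
apply: hom_eq => y x; have [/asboolP yx|/asboolP yx] := boolP `[< same_supp y x >];
  last first.
  rewrite c0//; apply: hcomp_supp0 => y'.
  have [/asboolP y'x|/asboolP y'x] := boolP `[< same_supp y' x >];
    last by rewrite [c _]c0 ?mulr0.
  rewrite hcomp_supp0 ?mul0r// => x'.
  have [/asboolP yx'|/asboolP yx'] := boolP `[< same_supp y x' >];
    last by rewrite c0 ?mul0r.
  rewrite supp_hom0 ?mulr0// => x'y'; apply: yx => i.
  by rewrite yx' x'y' y'x.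
wlog xD : y x yx / none_from (color x) D.
  move=> H; rewrite -(homP _ (coset_rep x)^-1%g) -[RHS](homP _ (coset_rep x)^-1%g);
    apply: H.
    exact/same_supp_act.
  by rewrite act_coset_repV; exact: none_from_pt1.
have yD : none_from (color y) D by apply: same_supp_none_from xD => i; rewrite yx.
have supp_D (y' : X d) : c (y', x) != 0 -> none_from (color y') D.
  move=> y'x; apply: same_supp_none_from xD => i; have [/asboolP->//|/asboolP/c0 e] :=
    boolP `[< same_supp y' x >].
  by rewrite e eqxx in y'x.
rewrite (hcomp_supp yD xD); last first.
  by move=> y'; have [->|/supp_D//] := eqVneq (c (y', x)) 0; rewrite mulr0 eqxx.
(* Both sides become sums over pairs of words of length D; words that are not full contribute
   nothing because [A] vanishes on them. *)
rewrite (AE _ _ yD xD) -KA.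
under [RHS]eq_bigr => u _ do under eq_bigr => v _ do rewrite -mulrA.
rewrite [RHS]exchange_big [LHS]big_mkcond; apply: eq_bigr => v _.
case: ifP => dv; last first.
  by rewrite big1// => u _; rewrite {2}/A dv !mulr0.
have vD := none_from_word_pt n_gt0 (size_tuple v) dv.
have wv : word_tuple D (word_pt d D v) = v.
  by apply: val_inj; rewrite /= word_tupleE word_ptP ?size_tuple ?full_part_word.
rewrite (hcomp_supp yD vD); last first.
  move=> x'; have [/asboolP yx'|/asboolP/c0->] := boolP `[< same_supp y x' >].
    by move=> _; exact: same_supp_none_from yx' yD.
  by rewrite mul0r eqxx.
rewrite (AE _ _ vD xD) wv big_distrl big_mkcond /=; apply: eq_bigr => u _.
case: ifP => bu; last by rewrite {1}/A bu andbF mul0r.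
have uD := none_from_word_pt n_gt0 (size_tuple u) bu.
have wu : word_tuple D (word_pt b D u) = u.
  by apply: val_inj; rewrite /= word_tupleE word_ptP ?size_tuple ?full_part_word.
have /= -> := supp_homE (erefl D) (esym bd) Kinv uD vD.
by rewrite (AE _ _ yD uD) wu wv mulrA.
Qed.

(** Clearing all overlaps below [deg b] leaves the pairs of maximal overlap, which have equal
    supports since the degrees agree. *)
Lemma mod_low (b d : weight) (f : Hom b d) : deg b = deg d ->
  exists (c : Hom b d) (c' : Hom d b),
    hcomp t (hcomp t c c') c = c /\ low_hom (deg b) (f - c).
Proof.
move=> bd; have [c [fc c0]] := low_level char0 n_gt0 f (leqnn (deg b)).
have [|c' cc'] := same_supp_regular bd (c := c); last by exists c, c'.
move=> y x yx; apply: c0; rewrite ltn_neqAle overlap_size_leq andbT.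
by apply/eqP => e; apply: yx; exact: overlap_size_same_supp.
Qed.
End EqualSupport.

(** * Modules are sums of simple submodules *)

Section FiniteSupport.
Context (V : zmodType) (J : choiceType).
Implicit Types x y : J -> V.

Definition fsupp x := finite_set [set i | x i != 0].

Lemma fsupp_fset x : fsupp x -> exists A : {fset J}, forall i, i \notin A -> x i = 0.
Proof.
move=> fx; exists (fset_set [set i | x i != 0]) => i.
by apply: contraNeq => xi; rewrite in_fset_set//; exact/mem_set.
Qed.

Lemma fset_fsupp x (A : {fset J}) : (forall i, i \notin A -> x i = 0) -> fsupp x.
Proof.
move=> xA; apply: (sub_finite_set _ (finite_fset A)) => i /=.
by apply: contraNT => /xA ->.
Qed.

Lemma fsuppD x y : fsupp x -> fsupp y -> fsupp (fun i => x i + y i).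
Proof.
move=> /fsupp_fset[A xA] /fsupp_fset[B yB]; apply: (@fset_fsupp _ (A `|` B)%fset) => i.
by rewrite inE negb_or => /andP[/xA -> /yB ->]; rewrite addr0.
Qed.

Lemma fsumD x y : fsupp x -> fsupp y ->
  \sum_(i \in setT) (x i + y i) = \sum_(i \in setT) x i + \sum_(i \in setT) y i.
Proof.
move=> /fsupp_fset[A xA] /fsupp_fset[B yB].
have sA i : i \notin (A `|` B)%fset -> x i = 0 by rewrite inE negb_or => /andP[/xA].
have sB i : i \notin (A `|` B)%fset -> y i = 0 by rewrite inE negb_or => /andP[_ /yB].
rewrite (fsbigTE _ _ sA) (fsbigTE _ _ sB) (fsbigTE (A `|` B)%fset) ?big_split// => i iAB.
by rewrite sA// sB// addr0.
Qed.

Lemma fsum_morph (V' : zmodType) (f : V -> V') x : f 0 = 0 -> {morph f : u v / u + v} ->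
  fsupp x -> f (\sum_(i \in setT) x i) = \sum_(i \in setT) f (x i).
Proof.
move=> f0 fD /fsupp_fset[A xA]; rewrite (fsbigTE _ _ xA) (fsbigTE A).
  exact: (big_morph f fD f0).
by move=> i /xA ->.
Qed.

Lemma fsum_point x i0 : (forall i, i != i0 -> x i = 0) -> \sum_(i \in setT) x i = x i0.
Proof.
move=> x0; rewrite (fsbigTE [fset i0]%fset) ?big_seq_fset1// => i.
by rewrite inE; exact: x0.
Qed.
End FiniteSupport.

Section SchurModules.
Context (k : fieldType) (char0 : [pchar k] =i pred0) (t : k) (n : nat)
  (n_gt0 : (0 < n)%N).
Local Notation weight := (weight t n).
Local Notation schur := (schur t n).
Implicit Types b d e : weight.
Local Notation X b := (coset_obj b).
Local Notation Hom b d := (Defs.hom k (X b) (X d)).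

Theorem hom_regular b d (f : Hom b d) : n = 1%N \/ ~ (exists m, t = m%:R) ->
  exists h : Hom d b, hcomp t (hcomp t f h) f = f.
Proof.
move=> nt; refine (@all_regular k weight (@hom_lmod k t n)
  (fun a b c => @hcomp k t (X a) (X b) (X c)) (fun a => idmor k (X a)) _ _ _ _ _
  (@deg k t n) (@transpose k t n) _ _ _ _ (fin_deg t n) _ b d f).
- exact: hcompA.
- exact: hcomp1l.
- exact: hcomp1r.
- by move=> a c e; exact: hcomp_Pl.
- by move=> a c e; exact: hcomp_Pr.
- exact: transposeM.
- exact: transposeK.
- by move=> a c g; exact: hom_nondegenerate.
- move=> a c.
  exists [seq overlap_hom n_gt0 c a (ffun_nat m) | m <- enum
    {: {ffun 'I_n.-1 * 'I_n.-1 -> 'I_(deg a).+1}}].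
  move=> P P0 PD Ps g; rewrite (hom_coord n_gt0 g).
  apply: (big_ind P) => // [u v Pu Pv|m _]; first by rewrite -[u]scale1r; exact: PD.
  rewrite -[_ *: _]addr0; apply: PD => //; apply: Ps; apply: mem_In.
  exact/map_f/mem_enum.
- exact: mod_low.
Qed.

(** * Products of homogeneous elements of the Schur algebra *)

Lemma schur_injE b d (f : Hom b d) : schur_inj f b d = f.
Proof.
rewrite /= /schur_inj_component; case: eqP => // bb; case: eqP => // dd.
by rewrite (eq_axiomK bb) (eq_axiomK dd).
Qed.

Lemma schur_inj0 b d (f : Hom b d) b' d' : (b', d') != (b, d) -> schur_inj f b' d' = 0.
Proof.
rewrite /= /schur_inj_component; case: eqP => // bb; case: eqP => // dd.
by move/eqP => []; rewrite bb dd.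
Qed.

Lemma mul_injE (s : schur) b d e (f : Hom b d) :
  schur_mul s (schur_inj f) b e = hcomp t (s d e) f.
Proof.
rewrite /schur_mul /= (@fsum_point _ _ _ d) => [|c cd];
  first by rewrite [schur_inj_component f b d]schur_injE.
by rewrite [schur_inj_component f b c]schur_inj0 ?comp0r// xpair_eqE eqxx.
Qed.

Lemma mul_inj0 (s : schur) b d e b' (f : Hom b d) : b' != b ->
  schur_mul s (schur_inj f) b' e = 0.
Proof.
move=> bb'; apply: fsbig1 => c _.
by rewrite [schur_inj f b' c]schur_inj0 ?comp0r// xpair_eqE (negPf bb').
Qed.

Lemma inj_mulE (s : schur) b d e (g : Hom d e) :
  schur_mul (schur_inj g) s b e = hcomp t g (s b d).
Proof.
rewrite /schur_mul /= (@fsum_point _ _ _ d) => [|c cd];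
  first by rewrite [schur_inj_component g d e]schur_injE.
by rewrite [schur_inj_component g c e]schur_inj0 ?comp0l// xpair_eqE (negPf cd).
Qed.

Lemma inj_mul0 (s : schur) b d e e' (g : Hom d e) : e' != e ->
  schur_mul (schur_inj g) s b e' = 0.
Proof.
move=> ee'; apply: fsbig1 => c _.
by rewrite [schur_inj g c e']schur_inj0 ?comp0l// xpair_eqE (negPf ee') andbF.
Qed.

Lemma inj_mul b d e (g : Hom d e) (f : Hom b d) :
  schur_mul (schur_inj g) (schur_inj f) = schur_inj (hcomp t g f).
Proof.
apply: schurP => b' e'; have [->|bb'] := eqVneq b' b; last first.
  by rewrite mul_inj0// schur_inj0// xpair_eqE (negPf bb').
have [->|ee'] := eqVneq e' e; last first.
  by rewrite inj_mul0// schur_inj0// xpair_eqE (negPf ee') andbF.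
by rewrite mul_injE !schur_injE.
Qed.

Lemma inj_mul_neq b d d' e (g : Hom d' e) (f : Hom b d) : d != d' ->
  schur_mul (schur_inj g) (schur_inj f) = 0.
Proof.
move=> dd'; apply: schurP => b' e'; have [->|bb'] := eqVneq b' b; last first.
  by rewrite mul_inj0.
have [->|ee'] := eqVneq e' e; last by rewrite inj_mul0.
rewrite mul_injE schur_inj0 ?comp0l//.
by rewrite xpair_eqE (negPf dd').
Qed.

Lemma one_mul_inj (s : schur) b d e (f : Hom b d) :
  schur_mul (schur_one e) (schur_mul s (schur_inj f)) = schur_inj (hcomp t (s d e) f).
Proof.
apply: schurP => b' e'; have [->|ee'] := eqVneq e' e; last first.
  by rewrite inj_mul0// schur_inj0// xpair_eqE (negPf ee') andbF.
rewrite inj_mulE hcomp1l//; have [->|bb'] := eqVneq b' b.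
  by rewrite mul_injE schur_injE.
by rewrite mul_inj0// schur_inj0// xpair_eqE (negPf bb').
Qed.

Lemma schur_injP b d x (f g : Hom b d) : schur_inj (x *: f + g) = x *: schur_inj f +
  schur_inj g.
Proof.
apply: schurP => b' d'.
have [[-> ->]|e] := (@eqP _ (b', d') (b, d)).
  transitivity (x *: schur_inj f b d + schur_inj g b d) => //.
  by rewrite !schur_injE.
transitivity (x *: schur_inj f b' d' + schur_inj g b' d') => //.
by rewrite !schur_inj0 ?scaler0 ?addr0//; apply/eqP.
Qed.

Section Module.
Context (M : schur_module t n).
Local Notation act := (@module_act k t n M).

Lemma actDl s s' v : act (s + s') v = act s v + act s' v.
Proof. by rewrite -[s]scale1r module_act_linearl !scale1r. Qed.

Lemma act0l v : act 0 v = 0.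
Proof. by apply: (addrI (act 0 v)); rewrite -actDl !addr0. Qed.

Lemma actDr s v v' : act s (v + v') = act s v + act s v'.
Proof. by rewrite -[v]scale1r module_act_linearr !scale1r. Qed.

Lemma act0r s : act s 0 = 0.
Proof. by apply: (addrI (act s 0)); rewrite -actDr !addr0. Qed.

Local Notation hact f v := (act (schur_inj f) v).

Lemma hactD b d (f g : Hom b d) v : hact (f + g) v = hact f v + hact g v.
Proof. by rewrite -[f]scale1r schur_injP actDl !scale1r. Qed.

Lemma hactM b d e (g : Hom d e) (f : Hom b d) v : hact (hcomp t g f) v = hact g
  (hact f v).
Proof. by rewrite -inj_mul module_actA. Qed.

Lemma hact0 b d v : hact (0 : Hom b d) v = 0.
Proof. by apply: (addrI (hact (0 : Hom b d) v)); rewrite -hactD !addr0. Qed.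

(** Orthogonality of the idempotents [schur_one b] identifies the abstract components with the
    images of v under them. *)
Lemma weight_decomp v : exists x : weight -> M,
  [/\ fsupp x, v = \sum_(b \in setT) x b & forall b, x b = act (schur_one b) v].
Proof.
have [x [[xb fx vx] _]] := @module_weights k t n M v.
exists x; split=> // b; rewrite vx fsum_morph ?act0r//; last by move=> *; exact: actDr.
rewrite (@fsum_point _ _ _ b) => [|d db].
  by have [y _ <-] := xb b; rewrite -hactM hcomp1l.
have [y _ <-] := xb d; rewrite -module_actA inj_mul_neq ?act0l//.
Qed.

Lemma weight_comp_neq0 v : v <> 0 -> exists b, act (schur_one b) v <> 0.
Proof.
move=> v0; apply: contrapT => nb; apply: v0.
have [x [fx e xE]] := weight_decomp v; rewrite e; apply: fsbig1 => b _.
by rewrite xE; apply: contrapT => xb; apply: nb; exists b.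
Qed.

Inductive sum_of_simples : M -> Prop :=
| sum_of_simples0 : sum_of_simples 0
| sum_of_simplesD u v : sum_of_simples u -> sum_of_simples v -> sum_of_simples (u + v)
| sum_of_simples_in N u : is_simple N -> N u -> sum_of_simples u.

Definition cyclic v : set M := range (fun s => act s v).

Lemma cyclic_submodule v : is_submodule (cyclic v).
Proof.
split; first by exists 0 => //; rewrite act0l.
  by move=> a _ _ [s _ <-] [s' _ <-]; exists (a *: s + s') => //;
    rewrite module_act_linearl.
by move=> s _ [s' _ <-]; exists (schur_mul s s') => //; rewrite module_actA.
Qed.

Lemma hact_cyclic b d (f : Hom b d) v : cyclic (hact f v) (hact f v).
Proof. by exists (schur_one d) => //; rewrite -hactM hcomp1l. Qed.

Context (reg : forall b d (f : Hom b d), exists h : Hom d b, hcomp t (hcomp t f h) f = f).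
Local Notation "g \c f" := (hcomp t g f) (at level 40, left associativity).
Let cA a b c d := @hcompA k char0 t n n_gt0 t a b c d.

(** A nonzero submodule contains a nonzero weight vector a v with a e = a. If a h a = a, then e h a
    is a nonzero idempotent below e, hence equal to e, and e v = e h (a v) lies in the submodule. *)
Lemma primitive_simple b (e : Hom b b) v : e \c e = e ->
  (forall e1 : Hom b b, e1 \c e1 = e1 -> e \c e1 = e1 -> e1 \c e = e1 ->
    e1 = 0 \/ e1 = e) ->
  hact e v <> 0 -> is_simple (cyclic (hact e v)).
Proof.
move=> ee prim ev0; split; first exact: cyclic_submodule.
  by move=> c0; have := hact_cyclic e v; rewrite c0.
move=> N [N0 NP Nact] Nev.
have [N00|] := pselect (N = [set 0]); first by left.
move=> Nn0; right; apply/seteqP; split=> // _ [s _ <-].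
have [w Nw w0] : exists2 w, N w & w <> 0.
  apply: contrapT => nw; apply: Nn0; apply/seteqP; split=> [w Nw|w ->//].
  by apply: contrapT => w0; apply: nw; exists w.
have [d] := weight_comp_neq0 w0.
have [u _ uw] := Nev _ Nw.
have wE : act (schur_one d) w = hact (u b d \c e) v.
  by rewrite -uw -(module_actA u) -module_actA one_mul_inj.
rewrite wE; set a := u b d \c e in wE * => av0.
have ae : a \c e = a by rewrite /a -cA ee.
clearbody a.
have a0 : a <> 0 by move=> a0; apply: av0; rewrite a0 hact0.
have [h aha] := reg a.
have ath : a \c (e \c h \c a) = a by rewrite !cA ae aha.
have the : e \c h \c a = e.
  have [||||//] := prim (e \c h \c a).
  - by rewrite -[LHS]cA ath.
  - by rewrite !cA ee.
  - by rewrite -cA ae.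
  by move=> th0; case: a0; rewrite -ath th0 Defs.comp0r.
apply: (Nact); rewrite -the !hactM; apply: (Nact (schur_inj e));
  apply: (Nact (schur_inj h)).
by rewrite -wE; exact: Nact.
Qed.

(** * Splitting idempotents into primitive ones *)

Local Notation J b := {ffun 'I_n.-1 * 'I_n.-1 -> 'I_(deg b).+1}.

Definition hom_row b d (f : Hom b d) : 'rV[k]_(#|{: J b}|) :=
  \row_i overlap_coef (ffun_nat (enum_val i)) f.

(** Its row space consists of the coordinates of the left ideal End(X^b) e, so its rank is the
    dimension of this ideal. *)
Definition mulr_mx b (e : Hom b b) : 'M[k]_(#|{: J b}|) :=
  \matrix_i hom_row (overlap_hom n_gt0 b b (ffun_nat (enum_val i)) \c e).

Lemma hom_rowP b d u (f g : Hom b d) : hom_row (u *: f + g) = u *: hom_row f + hom_row g.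
Proof. by apply/rowP => i; rewrite !mxE overlap_coefP. Qed.

Lemma hom_row_inj b d : injective (@hom_row b d).
Proof.
move=> f g fg; rewrite (hom_coord n_gt0 f) (hom_coord n_gt0 g); apply: eq_bigr => m _.
by have := congr1 (fun r : 'rV[k]_(#|{: J b}|) => r 0 (enum_rank m)) fg;
  rewrite !mxE enum_rankK => ->.
Qed.

Lemma hom_row_mul b (r : 'rV[k]_(#|{: J b}|)) (e : Hom b b) :
  r *m mulr_mx e = hom_row ((\sum_i r 0 i *: overlap_hom n_gt0 b b
    (ffun_nat (enum_val i))) \c e).
Proof.
rewrite mulmx_sum_row; apply/esym.
apply: (big_ind2 (fun (f : Hom b b) (s : 'rV[k]_(#|{: J b}|)) => hom_row (f \c e) = s)).
- by rewrite comp0l; apply/rowP => i; rewrite !mxE /overlap_coef; case: pselect.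
- move=> f s f' s' <- <-; rewrite -[f]scale1r hcomp_Pl// hom_rowP.
  by rewrite !scale1r.
move=> i _; rewrite rowK -[_ *: overlap_hom _ _ _ _]addr0 hcomp_Pl// comp0l hom_rowP.
rewrite [Z in _ + Z](_ : _ = 0) ?addr0//.
by apply/rowP => j; rewrite !mxE /overlap_coef; case: pselect.
Qed.

Lemma hom_row_sub b (a e : Hom b b) : (hom_row (a \c e) <= mulr_mx e)%MS.
Proof.
have -> : hom_row (a \c e) = hom_row a *m mulr_mx e; last exact: submxMl.
rewrite hom_row_mul; congr (hom_row (_ \c _)); rewrite {1}(hom_coord n_gt0 a).
rewrite (reindex (@enum_val {: J b} {: J b})) /=; last exact/onW_bij/enum_val_bij.
by apply: eq_bigr => i _; rewrite mxE.
Qed.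

(** The left ideal of e1 lies in that of e. The inclusion is strict: if e2 belonged to the ideal of
    e1, then e2 = e2 e1 = 0. *)
Lemma rank_decrease b (e e1 e2 : Hom b b) : e1 \c e = e1 -> e2 \c e = e2 ->
  e1 \c e1 = e1 -> e2 \c e1 = 0 -> e2 <> 0 ->
  (\rank (mulr_mx e1) < \rank (mulr_mx e))%N.
Proof.
move=> e1e e2e e11 e21 e20.
suff : (mulr_mx e1 < mulr_mx e)%MS by rewrite ltmxErank => /andP[].
rewrite ltmxE; apply/andP; split.
  by apply/row_subP => i; rewrite rowK -e1e cA; exact: hom_row_sub.
apply/negP => ee1; apply: e20.
have /submx_trans/(_ ee1)/submxP[r] : (hom_row e2 <= mulr_mx e)%MS.
  by rewrite -e2e; exact: hom_row_sub.
rewrite hom_row_mul => /hom_row_inj e2E.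
by rewrite -e21 [in RHS]e2E -cA e11 -e2E.
Qed.

(** An idempotent that is not primitive splits as e1 + (e - e1) with orthogonal nonzero summands,
    both of smaller rank. *)
Lemma sum_of_simples_idempotent b (e : Hom b b) v : e \c e = e ->
  sum_of_simples (hact e v).
Proof.
elim: {e}(\rank (mulr_mx e)).+1 {-2}e (ltnSn (\rank (mulr_mx e))) => // r IH e;
  rewrite ltnS => er ee.
have [ev0|ev0] := pselect (hact e v = 0); first by rewrite ev0; exact: sum_of_simples0.
have [prim|nprim] := pselect (forall e1 : Hom b b,
    e1 \c e1 = e1 -> e \c e1 = e1 -> e1 \c e = e1 -> e1 = 0 \/ e1 = e).
  exact: sum_of_simples_in (primitive_simple ee prim ev0) (hact_cyclic e v).
have [e1 [e11 ee1 e1e /not_orP[e10 e1ne]]] : exists e1 : Hom b b,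
    [/\ e1 \c e1 = e1, e \c e1 = e1, e1 \c e = e1 & ~ (e1 = 0 \/ e1 = e)].
  apply: contrapT => ne; apply: nprim => e1 e11 ee1 e1e.
  by apply: contrapT => ne1; apply: ne; exists e1.
pose e2 := e - e1.
have subl (f g h : Hom b b) : (f - g) \c h = f \c h - g \c h.
  by rewrite -[f - g]addrC -scaleN1r hcomp_Pl// scaleN1r addrC.
have subr (f g h : Hom b b) : h \c (f - g) = h \c f - h \c g.
  by rewrite -[f - g]addrC -scaleN1r hcomp_Pr// scaleN1r addrC.
have e2e : e2 \c e = e2 by rewrite subl ee e1e.
have e21 : e2 \c e1 = 0 by rewrite subl ee1 e11 subrr.
have e12 : e1 \c e2 = 0 by rewrite subr e1e e11 subrr.
have e22 : e2 \c e2 = e2 by rewrite {2}/e2 subr e2e e21 subr0.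
have e20 : e2 <> 0 by move=> /eqP; rewrite subr_eq0 => /eqP/esym.
have -> : hact e v = hact e1 v + hact e2 v by rewrite -hactD addrC subrK.
apply: sum_of_simplesD; apply: IH => //; apply: leq_trans er.
  exact: rank_decrease e20.
exact: rank_decrease e10.
Qed.

Lemma sum_of_simples_all v : sum_of_simples v.
Proof.
have [x [fx vx xE]] := weight_decomp v; rewrite vx.
apply: (big_ind sum_of_simples) => [||b _];
  [exact: sum_of_simples0|exact: sum_of_simplesD|rewrite xE].
by apply: sum_of_simples_idempotent; exact: hcomp1l.
Qed.

End Module.
End SchurModules.

(** * Direct sums *)

Section DirectSum.
Context (k : fieldType) (t : k) (n : nat) (M : schur_module t n).
Local Notation act := (@module_act k t n M).
Implicit Types (F : set (set M)) (N : set M).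

Inductive sumof F : M -> Prop :=
| sumof0 : sumof F 0
| sumofD u v : sumof F u -> sumof F v -> sumof F (u + v)
| sumof_in N u : F N -> N u -> sumof F u.

Lemma sumofS F F' u : F `<=` F' -> sumof F u -> sumof F' u.
Proof.
move=> FF'; elim=> [|u' v _ IH1 _ IH2|N u' /FF' FN Nu]; first exact: sumof0.
  exact: sumofD.
exact: sumof_in FN Nu.
Qed.

Lemma submoduleZ N a v : is_submodule N -> N v -> N (a *: v).
Proof. by case=> N0 NP _ Nv; rewrite -[_ *: _]addr0; exact: NP. Qed.

Lemma submoduleN N v : is_submodule N -> N v -> N (- v).
Proof. by rewrite -scaleN1r; exact: submoduleZ. Qed.

Lemma submoduleD N u v : is_submodule N -> N u -> N v -> N (u + v).
Proof. by case=> N0 NP _ Nu Nv; rewrite -[u]scale1r; exact: NP. Qed.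

Lemma sumof_submodule F : (forall N, F N -> is_submodule N) -> is_submodule (sumof F).
Proof.
move=> FN; have Z a u : sumof F u -> sumof F (a *: u).
  elim=> [|u' v _ IH1 _ IH2|N u' NF Nu]; first by rewrite scaler0; exact: sumof0.
    by rewrite scalerDr; exact: sumofD.
  exact: sumof_in (NF) (submoduleZ a (FN _ NF) Nu).
split; first exact: sumof0.
  by move=> a u v Fu Fv; apply: sumofD => //; exact: Z.
move=> s u; elim=> [|u' v _ IH1 _ IH2|N u' NF Nu].
- by rewrite act0r; exact: sumof0.
- by rewrite actDr; exact: sumofD.
- by apply: sumof_in (NF) _; have [_ _] := FN _ NF; apply.
Qed.

Definition independent F := (forall N, F N -> is_simple N) /\
  forall N u, F N -> N u -> sumof (F `\ N) u -> u = 0.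

(** A sum involves finitely many submodules, so a relation over the union of a chain already occurs
    in a member of the chain. *)
Lemma independent_bigcup (C : set (set (set M))) :
  C `<=` independent -> total_on C subset -> independent (\bigcup_(F in C) F).
Proof.
move=> Ci Ct; split=> [N [F CF FN]|N u [F0 CF0 F0N] Nu su]; first by have [+ _] :=
  Ci _ CF; apply.
have [F [CF FN Fu]] : exists F, [/\ C F, F N & sumof (F `\ N) u].
  elim: su {Nu} => [|u' v _ [F1 [CF1 F1N F1u]] _ [F2 [CF2 F2N F2v]]|N' u'
    [[F CF FN'] NN'] Nu'].
  - by exists F0; split=> //; exact: sumof0.
  - have [F12|F21] := Ct _ _ CF1 CF2.
      by exists F2; split=> //; apply: sumofD => //; apply: sumofS F1u => N' [/F12].
    by exists F1; split=> //; apply: sumofD => //; apply: sumofS F2v => N' [/F21].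
  have [F0F|FF0] := Ct _ _ CF0 CF.
    by exists F; split=> //; [exact: F0F|apply: (sumof_in (N := N'))].
  by exists F0; split=> //; apply: (sumof_in (N := N')) => //; split=> //; exact: FF0.
by have [_ /(_ N u FN Nu Fu)] := Ci _ CF.
Qed.

(** For F maximal by Zorn, a simple S meets [sumof F] in 0 or in S. In the first case S could be
    added to F, against maximality. *)
Lemma maximal_independent : (forall v : M, sum_of_simples v) ->
  exists F, independent F /\ forall v, sumof F v.
Proof.
move=> sM; have [F [Fi Fmax]] := Zorn_bigcup independent_bigcup.
exists F; split=> // v; have [Fs Find] := Fi.
have sF : is_submodule (sumof F) by apply: sumof_submodule => N /Fs[].
elim: (sM v) => [|u w _ Fu _ Fw|S u simS Su]; [exact: sumof0|exact: sumofD|].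
have [Ssub S0 Smin] := simS.
pose K := S `&` sumof F.
have Ksub : is_submodule K.
  case: Ssub => [Sz SP Sact]; case: sF => [Fz FP Fact]; split=> //.
    by move=> a x y [Sx Fx] [Sy Fy]; split; [exact: SP|exact: FP].
  by move=> s x [Sx Fx]; split; [exact: Sact|exact: Fact].
have [K0|KS] := Smin K Ksub (@subIsetl _ _ _); last first.
  by have [] : K u by rewrite KS.
have SF0 x : S x -> sumof F x -> x = 0.
  by move=> Sx Fx; have : K x by []; rewrite K0.
exfalso; apply: (Fmax (F `|` [set S])).
  split=> [N FN|sub]; first by left.
  apply: S0; apply/seteqP; split=> [x Sx|x ->]; last by case: Ssub.
  by apply: SF0 => //; apply: (sumof_in (N := S)) => //; apply: sub; right.
split=> [N [/Fs//|->//]|N x [FN|->{N}] Nx sx]; last first.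
  apply: SF0 => //; apply: sumofS sx => N [[//|->]] /= NN.
  by case: NN.
have Nsub : is_submodule N by have [] := Fs _ FN.
(* The part z in S equals x - y, which lies in [sumof F], so it is 0 and the old independence
   applies to x = y. *)
have [y [z [Fy Sz xyz]]] : exists y z, [/\ sumof (F `\ N) y, S z & x = y + z].
  elim: sx {Nx} => [|x1 x2 _ [y1 [z1 [? ? ->]]] _ [y2 [z2 [? ? ->]]]|N' x'
    [[FN'|->] NN'] Nx'].
  - by exists 0, 0; rewrite addr0; split=> //; [exact: sumof0|case: Ssub].
  - exists (y1 + y2), (z1 + z2); rewrite addrACA; split=> //; first exact: sumofD.
    exact: submoduleD.
  - by exists x', 0; rewrite addr0; split=> //; [apply: (sumof_in (N := N'))|case: Ssub].
  - by exists 0, x'; rewrite add0r; split=> //; exact: sumof0.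
have z0 : z = 0.
  apply: SF0 => //; have -> : z = x - y by rewrite xyz addrC addKr.
  apply: submoduleD => //; first exact: sumof_in FN Nx.
  by apply: submoduleN => //; apply: sumofS Fy => N' [].
by apply: (Find _ _ FN Nx); rewrite xyz z0 addr0.
Qed.

(** For uniqueness, the difference of two components in N is minus the sum of the other differences,
    so it lies both in N and in the sum of the other members. *)
Lemma independent_direct F : independent F -> (forall v, sumof F v) ->
  is_direct_sum (fun N : set_type F => val N : set M).
Proof.
move=> [Fs Find] Fall v.
have Nsub (N : set_type F) : is_submodule (val N : set M).
  by have [] := Fs _ (set_mem (valP N)).
have [x [Nx fx vx]] : exists x : set_type F -> M,
    [/\ forall i, (val i : set M) (x i), fsupp x & v = \sum_(i \in setT) x i].
  elim: (Fall v) => [|u w _ [x [Nx fx ->]] _ [y [Ny fy ->]]|N u FN Nu].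
  - exists (fun=> 0); split=> [N||]; [by case: (Nsub N)| |by rewrite fsbig1].
    by apply: (@fset_fsupp _ _ _ fset0).
  - exists (fun i => x i + y i); split; [|exact: fsuppD|by rewrite fsumD].
    by move=> N; exact: submoduleD.
  - pose N0 : set_type F := SigSub (mem_set FN).
    exists (fun i => if i == N0 then u else 0); split=> [N'||].
    + by case: eqP => [->//|_]; case: (Nsub N').
    + by apply: (@fset_fsupp _ _ _ [fset N0]%fset) => N'; rewrite inE => /negPf ->.
    + by rewrite (@fsum_point _ _ _ N0) ?eqxx// => N' /negPf ->.
exists x; split=> // y [Ny fy vy]; apply/funext => N.
have Nd i : (val i : set M) (x i - y i).
  by apply: submoduleD => //; exact: submoduleN.
apply/eqP; rewrite -subr_eq0; apply/eqP.
have FN : F (val N) := set_mem (valP N).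
apply: (Find _ _ FN (Nd N)).
have fy' : fsupp (fun i => - y i).
  by have [A yA] := fsupp_fset fy; apply: (@fset_fsupp _ _ _ A) => i /yA ->;
    rewrite oppr0.
have fd := fsuppD fx fy'.
have [A dA] := fsupp_fset fd.
have s0 : \sum_(i \in setT) (x i - y i) = 0.
  rewrite fsumD// -vx -(fsum_morph (f := -%R)) ?oppr0// -?vy ?subrr//.
  by move=> u w; rewrite opprD.
have : \sum_(i \in setT) (if i == N then 0 else x i - y i) = - (x N - y N).
  apply/eqP; rewrite -addr_eq0.
  rewrite -[Z in _ + Z](_ : \sum_(i \in setT) (if i == N then x i - y i else 0) = _).
    rewrite -fsumD.
    - rewrite -[Z in _ == Z]s0; apply/eqP/eq_fsbigr => i _.
      by case: ifP; rewrite ?add0r ?addr0.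
    - by apply: (@fset_fsupp _ _ _ A) => i /dA ->; case: ifP.
    - by apply: (@fset_fsupp _ _ _ A) => i /dA ->; case: ifP.
  by rewrite (@fsum_point _ _ _ N) ?eqxx// => i /negPf ->.
move=> e; rewrite -[x N - y N]opprK -e; apply: submoduleN.
  by apply: sumof_submodule => N' [FN' _]; have [] := Fs _ FN'.
apply: (big_ind (sumof (F `\ val N))) => [||i _]; [exact: sumof0|exact: sumofD|].
case: eqP => [_|iN]; first exact: sumof0.
apply: sumof_in (Nd i); split; first exact: set_mem (valP i).
by move=> /= /val_inj.
Qed.
End DirectSum.

Theorem schur_semisimple_generic (k : fieldType) (char0 : [pchar k] =i pred0) (t : k)
  (n : nat)
  (n_gt0 : (0 < n)%N) : n = 1%N \/ ~ (exists m, t = m%:R) -> schur_semisimple t n.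
Proof.
move=> nt M.
have [|F [Fi Fall]] := @maximal_independent k t n M.
  by move=> v; apply: (sum_of_simples_all char0 n_gt0) => b d f; exact: hom_regular.
exists (set_type F), (fun N => val N : set M); split; last exact: independent_direct.
by move=> N; have [+ _] := Fi; apply; exact: set_mem (valP N).
Qed.

(** * The regular module *)

Section RegularModule.
Context (k : fieldType) (char0 : [pchar k] =i pred0) (t : k) (n : nat)
  (n_gt0 : (0 < n)%N).
Local Notation weight := (weight t n).
Local Notation schur := (schur t n).
Implicit Types b d e : weight.
Local Notation X b := (coset_obj b).
Local Notation Hom b d := (Defs.hom k (X b) (X d)).

Lemma schur_supp (s : schur) : exists A : {fset weight},
  forall b d, (b \notin A) || (d \notin A) -> s b d = 0.
Proof.
pose S := [set bd : weight * weight | s bd.1 bd.2 != 0].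
have fS : finite_set S := component_finite s.
exists (fset_set (fst @` S) `|` fset_set (snd @` S))%fset => b d.
apply: contraTeq => bd; rewrite negb_or !negbK !inE.
rewrite !in_fset_set; try exact: finite_image.
by apply/andP; split; apply/orP; [left|right]; apply/mem_set; exists (b, d).
Qed.

Lemma schur_mulE (s s' : schur) (A : {fset weight}) b e :
  (forall d, d \notin A -> s d e = 0 \/ s' b d = 0) ->
  schur_mul s s' b e = \sum_(d <- A) hcomp t (s d e) (s' b d).
Proof.
move=> sA; apply: fsbigTE => d /sA[->|->]; first exact: Defs.comp0l.
exact: Defs.comp0r.
Qed.

Lemma hcomp_suml b d e (J : Type) (r : seq J) (F : J -> Hom d e) (f : Hom b d) :
  hcomp t (\sum_(j <- r) F j) f = \sum_(j <- r) hcomp t (F j) f.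
Proof.
apply: (big_morph (fun g => hcomp t g f)) => [u v|]; last exact: Defs.comp0l.
by rewrite -[u]scale1r hcomp_Pl// !scale1r.
Qed.

Lemma hcomp_sumr b d e (J : Type) (r : seq J) (F : J -> Hom b d) (g : Hom d e) :
  hcomp t g (\sum_(j <- r) F j) = \sum_(j <- r) hcomp t g (F j).
Proof.
apply: (big_morph (fun f => hcomp t g f)) => [u v|]; last exact: Defs.comp0r.
by rewrite -[u]scale1r hcomp_Pr// !scale1r.
Qed.

Lemma schur_mulA (s s' s'' : schur) :
  schur_mul (schur_mul s s') s'' = schur_mul s (schur_mul s' s'').
Proof.
have [A sA] := schur_supp s; have [B sB] := schur_supp s''.
apply: schurP => b e; rewrite (@schur_mulE _ _ B) => [|d dB]; last first.
  by right; apply: sB; rewrite dB orbT.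
rewrite (@schur_mulE _ _ A) => [|d dA]; last by left; apply: sA; rewrite dA.
under eq_bigr => d _.
  rewrite (@schur_mulE _ _ A) => [|c cA]; last by left; apply: sA; rewrite cA.
  rewrite hcomp_suml; over.
under [RHS]eq_bigr => d _.
  rewrite (@schur_mulE _ _ B) => [|c cB]; last by right; apply: sB; rewrite cB orbT.
  rewrite hcomp_sumr; over.
rewrite exchange_big; apply: eq_bigr => c _; apply: eq_bigr => d _.
by rewrite hcompA.
Qed.

Lemma schur_mulPl (x : k) (s s' u : schur) :
  schur_mul (x *: s + s') u = x *: schur_mul s u + schur_mul s' u.
Proof.
have [B sB] := schur_supp u; apply: schurP => b e.
have uB d : d \notin B -> u b d = 0 by move=> dB; apply: sB; rewrite dB orbT.
rewrite -[RHS]/(x *: schur_mul s u b e + schur_mul s' u b e).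
rewrite !(@schur_mulE _ _ B); try by move=> d /uB; right.
rewrite scaler_sumr -big_split; apply: eq_bigr => d _.
exact: hcomp_Pl.
Qed.

Lemma schur_mulPr (u : schur) (x : k) (s s' : schur) :
  schur_mul u (x *: s + s') = x *: schur_mul u s + schur_mul u s'.
Proof.
have [A sA] := schur_supp u; apply: schurP => b e.
have uA d : d \notin A -> u d e = 0 by move=> dA; apply: sA; rewrite dA.
rewrite -[RHS]/(x *: schur_mul u s b e + schur_mul u s' b e).
rewrite !(@schur_mulE _ _ A); try by move=> d /uA; left.
rewrite scaler_sumr -big_split; apply: eq_bigr => d _.
exact: hcomp_Pr.
Qed.

Lemma one_mulE b (s : schur) a e : schur_mul (schur_one b) s a e = if e == b then s a e
  else 0.
Proof.
case: eqP => [->|/eqP eb]; last exact: inj_mul0.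
by rewrite inj_mulE hcomp1l.
Qed.

Lemma one_mul_range b d (s : schur) : schur_mul (schur_one b)
  (schur_mul (schur_one d) s) =
  if d == b then schur_mul (schur_one b) s else 0.
Proof.
apply: schurP => a e; case: eqP => [->|/eqP db]; rewrite !one_mulE.
  by case: eqP.
by case: eqP => // ->; rewrite eq_sym (negPf db).
Qed.

(** Left multiplication by [schur_one b] keeps the components with target X^b, and almost all of
    these truncations of s vanish. *)
Lemma regular_weights : is_direct_sum (fun b => range (schur_mul (schur_one b))).
Proof.
move=> s; have [A sA] := schur_supp s.
have x0 b : b \notin A -> schur_mul (schur_one b) s = 0.
  move=> bA; apply: schurP => a e; rewrite one_mulE; case: eqP => // ->.
  by rewrite sA// bA orbT.
have fx : fsupp (fun b => schur_mul (schur_one b) s) by exact: fset_fsupp x0.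
exists (fun b => schur_mul (schur_one b) s); split.
  split=> [b||]; [by exists s|exact: fx|].
  apply: schurP => a e; rewrite (@fsum_morph _ _ _ (fun u : schur => u a e))//.
  rewrite (@fsum_point _ _ _ e) => [|b be]; rewrite one_mulE ?eqxx//.
  by rewrite eq_sym (negPf be).
move=> y [yr fy ->]; apply/funext => b.
rewrite (@fsum_morph _ _ _ (schur_mul (schur_one b)))//.
- rewrite (@fsum_point _ _ _ b) => [|d db].
    by have [u _ <-] := yr b; rewrite one_mul_range eqxx.
  by have [u _ <-] := yr d; rewrite one_mul_range (negPf db).
- by apply: schurP => a e; rewrite one_mulE; case: eqP.
- by move=> u v; rewrite -[u]scale1r schur_mulPr !scale1r.
Qed.

Definition regular_module : schur_module t n := SchurModule
  (fun x s s' m => schur_mulPl x s s' m) (fun s x m m' => schur_mulPr s x m m')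
  schur_mulA regular_weights.

(* If a v <> 0 then v = s a v for some s, whence a v = a s a v = 0. *)
Lemma nilpotent_simple (b d : weight) (a : Hom b d) (M : schur_module t n) (N : set M) v :
  (forall c : Hom d b, hcomp t c a = 0) -> is_simple N -> N v ->
  module_act (schur_inj a) v = 0.
Proof.
move=> ca [[N0 NP Nact] Nn0 Nmin] Nv; apply: contrapT => av0.
set w := module_act (schur_inj a) v in av0.
have Nw : N w by exact: Nact.
have cwN : cyclic w `<=` N by move=> _ [s _ <-]; exact: Nact.
have cww : cyclic w w by exact: hact_cyclic.
have [w0|Nw'] := Nmin (cyclic w) (cyclic_submodule w) cwN.
  by apply: av0; rewrite w0 in cww.
have [s _ sw] : cyclic w v by rewrite Nw'.
apply: av0; rewrite /w -sw /w -(module_actA s) -module_actA.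
suff -> : schur_mul (schur_inj a) (schur_mul s (schur_inj a)) = 0 by rewrite act0l.
apply: schurP => b' d'; have [->|dd'] := eqVneq d' d; last by rewrite inj_mul0.
rewrite inj_mulE; have [->|bb'] := eqVneq b' b; last by rewrite mul_inj0// Defs.comp0r.
by rewrite mul_injE ca Defs.comp0r.
Qed.
End RegularModule.

Theorem schur_not_semisimple (k : fieldType) (char0 : [pchar k] =i pred0) (m n : nat) :
  (1 < n)%N -> ~ schur_semisimple (m%:R : k) n.
Proof.
move=> n1; have n_gt0 := ltnW n1; set t : k := m%:R.
have i0 : 'I_n.-1 by exists 0%N; case: n n1 {n_gt0} => [|[]].
pose b : weight t n := weight_of t (fun=> 0%N); pose d : weight t n :=
  weight_of t (fun=> m.+1).
pose a : Defs.hom k (coset_obj b) (coset_obj d) :=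
  mkhom (f := fun _ _ => 1) (fun g y x => erefl).
have a0 : a <> 0.
  move=> /(congr1 (fun f : Defs.hom k (coset_obj b) (coset_obj d) =>
    f (coset_pt d 1%g, coset_pt b 1%g))).
  by move=> /= /eqP; rewrite oner_eq0.
(* The integral computing c a is a multiple of t (t - 1) ... (t - m) = 0. *)
have ca (c : Defs.hom k (coset_obj d) (coset_obj b)) : hcomp t c a = 0.
  apply: hom_eq => p x; rewrite /= /comp_fun /=.
  (* Points of X^b have no colored points, so all pairs (p, y) lie in one orbit. *)
  have cc y : c (p, y) = c (p, coset_pt d 1%g).
    have [|g [{2}<- <-]] := @overlap_orbit k t n n_gt0 b d p p y (coset_pt d 1%g);
      last by rewrite homP.
    have M0 (z : coset_obj d) ij : overlap p z ij = 0%N.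
      case: ij => i j; have [q [pq zq]] := none_from_pair p z.
      have /eqP := count_None1 i pq zq; rewrite weight_ofE addn_eq0 sum_nat_eq0.
      by move=> /andP[_ /forallP/(_ j)/eqP].
    by move=> ij; rewrite !M0.
  (* With N = 0 only the empty word occurs, and all letters are missing. *)
  rewrite (@integralE k t n n_gt0 char0 d 0); last by move=> g _ y; rewrite !cc.
  apply: big1 => w _; rewrite ext_numE//; last by apply/forallP => i; rewrite (tuple0 w).
  (* The part of color [i0], which exists because n >= 2, already has size m + 1; so the factor of
     index m, which is t - m = 0, does occur. *)
  have mD : (m < \sum_i missing d w i)%N.
    by rewrite (bigD1 i0)//= {1}/missing weight_ofE (tuple0 w) /= subn0 ltn_addr.
  by rewrite (bigD1 (Ordinal mD))//= add0n subrr mul0r !mulr0.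
move=> /(_ (regular_module char0 t n_gt0))[I [N [Ns Nd]]].
have [xs [[Nx fx e] _]] := Nd (schur_one b).
(* In the regular module, a is the result of its own action on [schur_one b], whose simple
   components are all killed by a. *)
apply: a0; rewrite -[LHS]schur_injE -[a in LHS](hcomp1r char0 n_gt0 t) -inj_mul.
rewrite [schur_mul _ _](_ : _ = 0)//.
rewrite -[schur_mul _ _]/(@module_act k t n (regular_module char0 t n_gt0)
  (schur_inj a) (schur_one b)).
rewrite e fsum_morph ?act0r//; last by move=> u v; exact: actDr.
apply: fsbig1 => i _.
exact: (nilpotent_simple char0 n_gt0 ca (Ns i) (Nx i)).
Qed.

Theorem theorem7p5p1 (k : fieldType) (char0 : [pchar k] =i pred0) (t : k)
    (n : nat) (n_gt0 : (0 < n)%N) :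
  schur_semisimple t n <->
  n = 1%N \/ ((2 <= n)%N /\ ~ exists m : nat, t = m%:R).
Proof.
split=> [ss|nt].
  have [n1|n1] := leqP n 1; [left|right]; first by apply/eqP; rewrite eqn_leq n1.
  by split=> // -[m tm]; subst t; exact: (schur_not_semisimple char0 n1 ss).
apply: (schur_semisimple_generic char0 n_gt0); case: nt => [->|[_ tn]]; first by left.
by right.
Qed.
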